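(* Let $\Omega$ be a bounded domain in $\mathbb{H}$ with boundary of class $C^1$. Let $f:\partial\Omega\to\mathbb{H}$ be a continuous function. Then there exists a (left-)$\psi$-regular function $F$ on $\Omega$, continuous on $\overline\Omega$, such that $F_{|\partial\Omega}=f$, if and only if $$\int_{\partial\Omega}\bar f\,(\overline\partial_n-jL)(\phi)\,d\sigma=0\qquad\text{for every }\phi\in Harm^1(\overline\Omega).$$
   Context: Let $\mathbb{H}$ be the quaternions, with basic units $i,j,k$. Identify $\mathbb{C}^2$ with $\mathbb{H}$ by $(z_1,z_2)=(x_0+ix_1,x_2+ix_3)\mapsto q=z_1+z_2j=x_0+ix_1+jx_2+kx_3$; then $aj=j\bar a$ for $a\in\mathbb{C}$. An $\mathbb{H}$-valued function is written $f=f_1+f_2j$ with $f_1,f_2$ complex-valued; its quaternionic conjugate is $\bar f=\overline{f_1}-f_2j$. A $C^1$ function $f$ is (left-)$\psi$-regular on $\Omega$ if $\left(\frac{\partial}{\partial\bar z_1}+j\frac{\partial}{\partial\bar z_2}\right)f=0$ on $\Omega$; equivalently $\frac{\partial f_1}{\partial\bar z_1}=\frac{\partial\overline{f_2}}{\partial z_2}$ and $\frac{\partial f_1}{\partial\bar z_2}=-\frac{\partial\overline{f_2}}{\partial z_1}$. $\Omega=\{\rho<0\}$ with $\rho$ a real function of class $C^1$ on $\mathbb{C}^2$ and $d\rho\neq0$ on $\partial\Omega$; $|\overline\partial\rho|^2=\sum_{k=1}^2\left|\frac{\partial\rho}{\partial\bar z_k}\right|^2$. $Harm^1(\overline\Omega)$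 is the space of complex-valued harmonic functions on $\Omega$ of class $C^1$ on $\overline\Omega$, and $d\sigma$ is the Lebesgue surface measure on $\partial\Omega$. For $\phi\in Harm^1(\overline\Omega)$, on $\partial\Omega$, $$\overline\partial_n\phi=\frac1{|\overline\partial\rho|}\sum_{k=1}^2\frac{\partial\rho}{\partial z_k}\frac{\partial\phi}{\partial\bar z_k},\qquad L(\phi)=\frac1{|\overline\partial\rho|}\left(\frac{\partial\rho}{\partial\bar z_2}\frac{\partial\phi}{\partial\bar z_1}-\frac{\partial\rho}{\partial\bar z_1}\frac{\partial\phi}{\partial\bar z_2}\right),$$ and $(\overline\partial_n-jL)(\phi)=\overline\partial_n\phi-j\,L(\phi)$, an $\mathbb{H}$-valued function; products are quaternionic products in the order written. *)

(* Defs.v *)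
From HB Require Import structures.
From mathcomp Require Import all_boot all_order all_algebra.
From mathcomp Require Import complex.
From mathcomp Require Import all_classical all_reals all_analysis.

Set Implicit Arguments.
Unset Strict Implicit.
Unset Printing Implicit Defensive.

Import Order.TTheory GRing.Theory Num.Theory.
Import numFieldNormedType.Exports.

Local Open Scope classical_set_scope.
Local Open Scope ring_scope.

(* The row (x0, x1, x2, x3) is both the point (z1, z2) = (x0 + i x1, x2 + i x3)
   of C^2 and the quaternion z1 + z2 j = x0 + i x1 + j x2 + k x3 with
   k = i j.  The norm of 'rV is the sup norm; it is only used for the topology
   and for boundedness. *)
Notation quaternion R := 'rV[R]_4 (only parsing).

Section Quaternions.
Variable R : realType.
Implicit Types (a b : R[i]) (p q : quaternion R).

Definition imag_unit : R[i] := Complex 0 1.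

Definition z1 q : R[i] := Complex (q 0 0) (q 0 1).
Definition z2 q : R[i] := Complex (q 0 2) (q 0 3).

(* a + b j *)
Definition cquat a b : quaternion R :=
  \row_k [:: complex.Re a; complex.Im a; complex.Re b; complex.Im b]`_k.

Definition qj : quaternion R := cquat 0 1.

(* From a j = j (conj a) and j j = -1:
   (a + b j)(c + d j) = (a c - b (conj d)) + (a d + b (conj c)) j. *)
Definition qmul p q : quaternion R :=
  cquat (z1 p * z1 q - z2 p * conjc (z2 q))
        (z1 p * z2 q + z2 p * conjc (z1 q)).

Definition qconj q : quaternion R := cquat (conjc (z1 q)) (- z2 q).

End Quaternions.
Arguments qj {R}.
Arguments imag_unit {R}.

Section Calculus.
Variable R : realType.

Definition bdry (T : topologicalType) (D : set T) : set T :=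
  closure D `\` interior D.

Definition partial n (k : 'I_n.+1) (u : 'rV[R]_n.+1 -> R) (x : 'rV[R]_n.+1) : R :=
  'D_(delta_mx 0 k) u x.

(* For open D. *)
Definition C1_on n (D : set 'rV[R]_n.+1) (u : 'rV[R]_n.+1 -> R) : Prop :=
  forall x, D x ->
    differentiable u x /\ forall k, {for x, continuous (partial k u)}.

(* u and its first partial derivatives on the open set D extend continuously
   to the closure of D; u itself is the extension. *)
Definition C1_closure n (D : set 'rV[R]_n.+1) (u : 'rV[R]_n.+1 -> R) : Prop :=
  [/\ C1_on D u,
      {within closure D, continuous u} &
      forall k, exists2 v : 'rV[R]_n.+1 -> R,
        {within closure D, continuous v} & forall x, D x -> partial k u x = v x].

(* Value at x in closure D of the continuous extension of a partial derivative;
   the values of u outside closure D are irrelevant. *)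
Definition partial_closure n (D : set 'rV[R]_n.+1) (k : 'I_n.+1)
    (u : 'rV[R]_n.+1 -> R) (x : 'rV[R]_n.+1) : R :=
  lim (partial k u @ within D (nbhs x)).

Definition harmonic_on n (D : set 'rV[R]_n.+1) (u : 'rV[R]_n.+1 -> R) : Prop :=
  [/\ C1_on D u,
      forall k, C1_on D (partial k u) &
      forall x, D x -> \sum_k partial k (partial k u) x = 0].

(* Wirtinger derivatives, as functions of the family d of the four real partial
   derivatives; the index 0 (resp. 1) of 'I_2 stands for z1 (resp. z2). *)
Definition dz (d : 'I_4 -> R[i]) (k : 'I_2) : R[i] :=
  if k == 0 then (d 0 - imag_unit * d 1) / 2 else (d 2 - imag_unit * d 3) / 2.
Definition dzbar (d : 'I_4 -> R[i]) (k : 'I_2) : R[i] :=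
  if k == 0 then (d 0 + imag_unit * d 1) / 2 else (d 2 + imag_unit * d 3) / 2.

Definition grad_real (rho : quaternion R -> R) (x : quaternion R) (k : 'I_4) : R[i] :=
  real_complex R (partial k rho x).

Definition grad (u : quaternion R -> R[i]) (x : quaternion R) (k : 'I_4) : R[i] :=
  Complex (partial k (fun y => complex.Re (u y)) x)
          (partial k (fun y => complex.Im (u y)) x).

Definition grad_closure (D : set (quaternion R)) (u : quaternion R -> R[i])
    (x : quaternion R) (k : 'I_4) : R[i] :=
  Complex (partial_closure D k (fun y => complex.Re (u y)) x)
          (partial_closure D k (fun y => complex.Im (u y)) x).

(* F is C^1 and (d/dzbar1 + j d/dzbar2) F = 0 on the open set D, where d/dzbark
   acts on each complex component of F = F1 + F2 j:
   (d/dzbark) F = dF1/dzbark + (dF2/dzbark) j. *)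
Definition psi_regular (D : set (quaternion R)) (F : quaternion R -> quaternion R) : Prop :=
  (forall m, C1_on D (fun q => F q 0 m)) /\
  forall q, D q ->
    let dF k := cquat (dzbar (grad (fun p => z1 (F p)) q) k)
                      (dzbar (grad (fun p => z2 (F p)) q) k) in
    dF 0 + qmul qj (dF 1) = 0.

Definition Harm1 (D : set (quaternion R)) (phi : quaternion R -> R[i]) : Prop :=
  [/\ harmonic_on D (fun x => complex.Re (phi x)),
      harmonic_on D (fun x => complex.Im (phi x)),
      C1_closure D (fun x => complex.Re (phi x)) &
      C1_closure D (fun x => complex.Im (phi x))].

Section BoundaryOperators.
Variables (D : set (quaternion R)) (rho : quaternion R -> R).

Definition norm_dbar (x : quaternion R) : R :=
  Num.sqrt (\sum_(k < 2) Normc.normc (dzbar (grad_real rho x) k) ^+ 2).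

Definition dbar_n (phi : quaternion R -> R[i]) (x : quaternion R) : R[i] :=
  (real_complex R (norm_dbar x))^-1 *
  \sum_(k < 2) dz (grad_real rho x) k * dzbar (grad_closure D phi x) k.

Definition L_op (phi : quaternion R -> R[i]) (x : quaternion R) : R[i] :=
  (real_complex R (norm_dbar x))^-1 *
  (dzbar (grad_real rho x) 1 * dzbar (grad_closure D phi x) 0
   - dzbar (grad_real rho x) 0 * dzbar (grad_closure D phi x) 1).

Definition dbar_n_sub_jL (phi : quaternion R -> R[i]) (x : quaternion R) : quaternion R :=
  cquat (dbar_n phi x) 0 - qmul qj (cquat (L_op phi x) 0).

End BoundaryOperators.
End Calculus.

Section SurfaceMeasure.
Variable R : realType.

(* R^4 with its Borel sets. *)
Definition borel4 := g_sigma_algebraType (@open (quaternion R)).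

Definition lebesgue3 :=
  ((@lebesgue_measure R \x @lebesgue_measure R) \x @lebesgue_measure R)%E.

Definition vec3 (y : R * R * R) : 'rV[R]_3 := \row_k [:: y.1.1; y.1.2; y.2]`_k.

(* The point of the graph of g over the i-th coordinate hyperplane lying over y:
   its i-th coordinate is g y, the other ones, in order, are those of y. *)
Definition graph_pt (i : 'I_4) (g : 'rV[R]_3 -> R) (y : 'rV[R]_3) : quaternion R :=
  \row_k if unlift i k is Some l then y 0 l else g y.

(* sigma is the Lebesgue surface measure on the C^1 hypersurface S: on every
   graph of a C^1 function g contained in S, in any of the four coordinate
   directions, it is sqrt (1 + |grad g|^2) times Lebesgue measure.  A C^1
   hypersurface is covered by countably many such graphs, so this determines
   sigma on the Borel subsets of S; nothing is required of sigma off S. *)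
Definition is_surface_measure (S : set (quaternion R))
    (sigma : {measure set borel4 -> \bar R}) : Prop :=
  forall (i : 'I_4) (U : set 'rV[R]_3) (g : 'rV[R]_3 -> R),
    open U -> C1_on U g -> (forall y, U y -> S (graph_pt i g y)) ->
  forall A : set borel4, measurable A ->
    sigma (A `&` (graph_pt i g @` U)) =
    (\int[lebesgue3]_(y in [set y | U (vec3 y) /\ A (graph_pt i g (vec3 y))])
       (Num.sqrt (1 + \sum_l (partial l g (vec3 y)) ^+ 2))%:E)%E.

Definition qintegral (sigma : {measure set borel4 -> \bar R})
    (S : set (quaternion R)) (h : quaternion R -> quaternion R) : quaternion R :=
  \row_k Rintegral sigma S (fun x => h x 0 k).

End SurfaceMeasure.

(* Main.v *)
(* For real phi the form [conj f (dbar_n - j L) phi d sigma] is, up to the factor 1/2,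
   conj f conj N (grad phi) d sigma, with N the unit normal and the third coordinate of N and
   of grad phi reversed.  Its components are the fluxes of vector fields which are
   divergence-free when f is psi-regular and phi is harmonic, so they vanish by the divergence
   theorem.  That theorem is obtained without a C^2 boundary by multiplying the field with
   theta (k rho), theta a C^1 cutoff: the integral over R^4 of a divergence with compact support
   is 0, and k theta' (k rho) tends to surface measure over |grad rho| in charts of the boundary.

   Conversely test with the Newton kernels phi_z(w) = 1 / |w - z|^2.  For z in Omega the
   integral of a constant f against phi_z is c conj f with c != 0 independent of z, and for z
   outside the closure it is 0, like that of the given f.  So F(z) = conj (int) / c is the
   candidate.  It is psi-regular by differentiation under the integral sign.  At a boundary
   point x, subtract the integral of the constant f(x), and, for free, the same expression at
   the mirror image z' of z outside Omega: what remains is f(w) - f(x) against the difference of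
   the two kernels, bounded by C t / max (t, |w - y|)^4, where t is the height of z over its
   foot y on the boundary.  By dyadic summation this has a surface integral bounded
   independently of z, and the continuity of f at x concludes. *)
Require Import Defs.
From HB Require Import structures.
From mathcomp Require Import all_boot all_order all_algebra.
From mathcomp Require Import complex ring lra.
From mathcomp Require Import all_classical all_reals all_analysis measurable_realfun.

Import Order.TTheory GRing.Theory Num.Theory.
Import numFieldNormedType.Exports.

Set Implicit Arguments.
Unset Strict Implicit.
Unset Printing Implicit Defensive.

Local Open Scope classical_set_scope.
Local Open Scope ring_scope.

(** * Calculus on row vectors *)

Section RowVectors.
Variable R : realType.

(** In the converse [f] is merely continuous. The kernel [newton_grad] has size $|w-z|^{-3}$ and the
    boundary has dimension three, so the integral of its absolute value grows logarithmically as z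
    nears the boundary, and small oscillation of [f] alone does not control the Cauchy integral.
    Subtracting the kernel at the mirror point gains one order: $t|w-y|^{-4}$ contributes about
    $2^{-j}$ on the shell $|w-y| \sim 2^j t$. Orthogonality enters only there, through the vanishing
    of the Cauchy integral outside the closure. The constant c is never computed: cutting off the
    pole turns it into the volume integral of a radial function of one sign, and translation
    invariance makes it independent of z. In the divergence theorem the fields are $C^1$ only inside
    and have no extension across the boundary; hence the cutoff already vanishes where $k\rho \ge
    -1$. A divergence supported away from the boundary is kept on the right-hand side, so that one
    theorem yields both the vanishing fluxes and the constant c. *)

Lemma near_continuous (T U : topologicalType) (f g : T -> U) x :
  continuous_at x f -> (\forall y \near x, f y = g y) ->
  continuous_at x g.
Proof.
move=> cf fg; rewrite /continuous_at -(nbhs_singleton fg).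
by apply: cvg_trans cf; apply: near_eq_cvg; apply: filterS fg => y ->.
Qed.

Section ContinuousAt.
Variables (T : topologicalType) (x : T).
Implicit Types (f g : T -> R).

Lemma cat_cst (U : topologicalType) (c : U) : continuous_at x (fun=> c).
Proof. exact: cvg_cst. Qed.

Lemma catD f g : continuous_at x f -> continuous_at x g ->
  continuous_at x (fun y => f y + g y).
Proof. by move=> cf cg; apply: cvgD; [exact: cf|exact: cg]. Qed.

Lemma catN f : continuous_at x f -> continuous_at x (fun y => - f y).
Proof. by move=> cf; apply: cvgN; exact: cf. Qed.

Lemma catB f g : continuous_at x f -> continuous_at x g ->
  continuous_at x (fun y => f y - g y).
Proof. by move=> cf cg; apply: catD => //; exact: catN. Qed.

Lemma catM f g : continuous_at x f -> continuous_at x g ->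
  continuous_at x (fun y => f y * g y).
Proof. by move=> cf cg; apply: cvgM; [exact: cf|exact: cg]. Qed.

Lemma catX f m : continuous_at x f -> continuous_at x (fun y => f y ^+ m).
Proof.
move=> cf; elim: m => [|m IH]; first exact: cat_cst.
by under [X in continuous_at x X]eq_fun do rewrite exprS; exact: catM.
Qed.

Lemma catV f : f x != 0 -> continuous_at x f ->
  continuous_at x (fun y => (f y)^-1).
Proof. by move=> f0 cf; apply: cvgV => //; exact: cf. Qed.

Lemma cat_norm f : continuous_at x f -> continuous_at x (fun y => `|f y|).
Proof. by move=> cf; apply: cvg_norm; exact: cf. Qed.

Lemma cat_comp (U V : topologicalType) (h : T -> U) (k : U -> V) :
  continuous_at x h -> continuous_at (h x) k ->
  continuous_at x (fun y => k (h y)).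
Proof. by move=> ch ck; apply: continuous_comp; [exact: ch|exact: ck]. Qed.

Lemma cat_sum (I : Type) (r : seq I) (F : I -> T -> R) :
  (forall i, continuous_at x (F i)) ->
  continuous_at x (fun y => \sum_(i <- r) F i y).
Proof.
move=> cF; elim: r => [|i r IHr].
  under [X in continuous_at x X]eq_fun do rewrite big_nil.
  exact: cat_cst.
under [X in continuous_at x X]eq_fun do rewrite big_cons.
exact: catD.
Qed.
End ContinuousAt.

Lemma ord4P (P : 'I_4 -> Prop) : P 0 -> P 1 -> P 2 -> P 3 -> forall k, P k.
Proof.
move=> P0 P1 P2 P3 [[|[|[|[|//]]]] lti].
- by rewrite (_ : Ordinal lti = 0) //; exact/val_inj.
- by rewrite (_ : Ordinal lti = 1) //; exact/val_inj.
- by rewrite (_ : Ordinal lti = 2) //; exact/val_inj.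
- by rewrite (_ : Ordinal lti = 3) //; exact/val_inj.
Qed.

Lemma sum4E (V : nmodType) (E : 'I_4 -> V) :
  \sum_k E k = E 0 + E 1 + E 2 + E 3.
Proof.
rewrite !big_ord_recr big_ord0 /= add0r.
by congr (_ + _ + _ + _); congr E; exact/val_inj.
Qed.

Lemma mx_norm_leP m n (x : 'M[R]_(m, n)) (e : R) : 0 <= e ->
  (`|x| <= e) <-> (forall i j, `|x i j| <= e).
Proof.
move=> e0; rewrite /Num.norm /= mx_normrE; split.
  by move=> /bigmax_leP[_ h] i j; exact: (h (i, j)).
by move=> h; apply/bigmax_leP; split => // -[i j] _; exact: h.
Qed.

Lemma mx_norm_ltP m n (x : 'M[R]_(m, n)) (e : R) : 0 < e ->
  (`|x| < e) <-> (forall i j, `|x i j| < e).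
Proof.
move=> e0; rewrite /Num.norm /= mx_normrE; split.
  by move=> /bigmax_ltP[_ h] i j; exact: (h (i, j)).
by move=> h; apply/bigmax_ltP; split => // -[i j] _; exact: h.
Qed.

Lemma rV_norm_leP n (x : 'rV[R]_n) (e : R) : 0 <= e ->
  (`|x| <= e) <-> (forall k, `|x 0 k| <= e).
Proof.
move=> e0; apply: (iff_trans (mx_norm_leP _ e0)); split => [h k|h i k].
  exact: h.
by rewrite (ord1 i).
Qed.

Lemma rV_norm_ltP n (x : 'rV[R]_n) (e : R) : 0 < e ->
  (`|x| < e) <-> (forall k, `|x 0 k| < e).
Proof.
move=> e0; apply: (iff_trans (mx_norm_ltP _ e0)); split => [h k|h i k].
  exact: h.
by rewrite (ord1 i).
Qed.

Lemma le_coord_norm n (x : 'rV[R]_n) k : `|x 0 k| <= `|x|.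
Proof. by apply: (rV_norm_leP x (normr_ge0 x)).1 => //; exact: lexx. Qed.

Lemma continuous_rV (T : topologicalType) n (v : T -> 'rV[R]_n) x :
  (forall k, continuous_at x (fun t => v t 0 k)) -> continuous_at x v.
Proof.
move=> h; apply/cvgrPdist_lt => e e0.
have : \forall t \near x, forall k, `|v x 0 k - v t 0 k| < e.
  by apply: filter_forall => k; have /cvgrPdist_lt := h k; exact.
by apply: filterS => t ht; apply/(rV_norm_ltP _ e0) => k; rewrite !mxE.
Qed.

Definition dlin n (a : 'I_n -> R) (h : 'rV[R]_n) : R := \sum_k a k * h 0 k.

Fact dlin_is_linear n (a : 'I_n -> R) : linear (dlin a).
Proof.
move=> c u v; rewrite /dlin scaler_sumr -big_split /=; apply: eq_bigr => k _.
by rewrite !mxE mulrDr mulrCA.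
Qed.

HB.instance Definition _ n (a : 'I_n -> R) :=
  GRing.isLinear.Build R 'rV[R]_n R _ (dlin a) (dlin_is_linear a).

Lemma dlin_le n (a : 'I_n -> R) (M : R) h : (forall k, `|a k| <= M) ->
  `|dlin a h| <= n%:R * M * `|h|.
Proof.
move=> aM; apply: le_trans (ler_norm_sum _ _ _) _.
have -> : n%:R * M * `|h| = \sum_(k < n) M * `|h|.
  by rewrite sumr_const card_ord -[RHS]mulr_natl mulrA.
apply: ler_sum => k _; rewrite normrM.
by apply: ler_pM => //; exact: le_coord_norm.
Qed.

Lemma dlin_continuous n (a : 'I_n -> R) : continuous (dlin a).
Proof.
move=> x; apply: cat_sum => k; apply: catM; first exact: cat_cst.
exact: coord_continuous.
Qed.

Lemma dlin_delta n (a : 'I_n -> R) k : dlin a (delta_mx 0 k) = a k.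
Proof.
rewrite /dlin (bigD1 k) //= mxE !eqxx mulr1 big1 ?addr0 // => i ik.
by rewrite mxE eqxx (negbTE ik) mulr0.
Qed.
End RowVectors.

Lemma dist_half (R : realType) (a b c e : R) :
  `|a - c| < e / 2 -> `|b - c| < e / 2 -> `|a - b| <= e.
Proof.
rewrite !ltr_norml => /andP[h1 h2] /andP[h3 h4]; rewrite ler_norml.
by apply/andP; split; lra.
Qed.

(** * First-order calculus with explicit derivatives, and symmetry of second derivatives *)

Section Differentiation.
Variables (R : realType) (n : nat).
Local Notation E := 'rV[R]_n.+1.
Implicit Types (u v : E -> R) (x h : E) (D : set E).

Lemma diff_partialE u x h : differentiable u x ->
  'd u x h = dlin (fun k => partial k u x) h.
Proof.
move=> du; rewrite [in LHS](row_sum_delta h) linear_sum /=.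
by apply: eq_bigr => k _; rewrite linearZ /= /partial deriveE // mulrC.
Qed.

Lemma differentiable_eps u x : differentiable u x ->
  forall e, 0 < e -> exists2 d, 0 < d &
  forall h, `|h| < d ->
    `|u (x + h) - u x - dlin (fun k => partial k u x) h| <= e * `|h|.
Proof.
move=> du e e0; have [_ hu] := (diff_locallyP _ _).1 du.
have /eqaddoP/(_ _ e0)/nbhs_ballP[d d0 hd] := hu.
exists d => // h hd'; have := hd h; rewrite /= -ball_normE /ball_/= sub0r normrN.
move=> /(_ hd'); rewrite -diff_partialE //.
by rewrite !fctE /= [h + x]addrC opprD addrA.
Qed.

(** A candidate gradient with error o(|h|) settles differentiability and the values of all partial
    derivatives at once; graphs, translates and parametric integrals are handled through it. *)
Lemma differentiableP_eps u x (a : 'I_n.+1 -> R) :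
  (forall e, 0 < e -> exists2 d, 0 < d &
    forall h, `|h| < d -> `|u (x + h) - u x - dlin a h| <= e * `|h|) ->
  differentiable u x /\ forall k, partial k u x = a k.
Proof.
move=> H.
have hu : u \o shift x = cst (u x) + (dlin a : E -> R) +o_ (0 : E) id.
  apply/eqaddoP => e e0; have [d d0 hd] := H e e0.
  apply/nbhs_ballP; exists d => // h; rewrite -ball_normE /ball_ /= sub0r normrN.
  by move=> /hd; rewrite !fctE [h + x]addrC opprD addrA.
have dE := diff_unique (@dlin_continuous R _ a) hu.
have du : differentiable u x.
  apply/diff_locallyP; rewrite dE; split => //; exact: dlin_continuous.
by split => // k; rewrite /partial deriveE // dE /= dlin_delta.
Qed.

(** The derivatives are carried as explicit functions [du], so that each rule below also computes
    the gradient. Continuity of [du] is asked in the ambient topology, which is why transfers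
    between functions equal on [D] require [D] open. *)
Definition C1d D u (du : 'I_n.+1 -> E -> R) := forall x, D x ->
  [/\ differentiable u x, forall k, partial k u x = du k x &
      forall k, continuous_at x (du k)].

Lemma C1d_C1_on D u du : open D -> C1d D u du -> C1_on D u.
Proof.
move=> oD H x Dx; have [du0 duE duc] := H x Dx; split => // k.
apply: near_continuous (duc k) _.
have := open_nbhs_nbhs (conj oD Dx); apply: filterS => y Dy.
by have [_ ->] := H y Dy.
Qed.

Lemma C1_on_C1d D u : C1_on D u -> C1d D u (fun k => partial k u).
Proof. by move=> H x Dx; have [? ?] := H x Dx; split. Qed.

Lemma C1d_sub D D' u du : D' `<=` D -> C1d D u du -> C1d D' u du.
Proof. by move=> DD' H x /DD'; exact: H. Qed.

Lemma C1d_continuous D u du x : C1d D u du -> D x -> continuous_at x u.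
Proof. by move=> H /H[du0 _ _]; exact: differentiable_continuous. Qed.

Lemma partial_diffE k u x : differentiable u x ->
  partial k u x = 'd u x (delta_mx 0 k).
Proof. exact: deriveE. Qed.

Lemma C1d_eq D u v du dv : open D -> {in D, u =1 v} ->
  (forall k, {in D, du k =1 dv k}) -> C1d D u du -> C1d D v dv.
Proof.
move=> oD uv duv H x Dx; have [du0 duE duc] := H x Dx.
have nD : \forall y \near x, D y by exact: open_nbhs_nbhs.
have xv : differentiable v x /\ forall k, partial k v x = du k x.
  apply: differentiableP_eps => e e0.
  have [d d0 hd] := differentiable_eps du0 e0.
  have /nbhs_ballP[d' d'0 hd'] := nD.
  exists (Num.min d d'); first by rewrite lt_min d0.
  move=> h; rewrite lt_min => /andP[hd0 hd1].
  have Dh : D (x + h) by apply: hd'; rewrite -ball_normE /ball_/= opprD addNKr normrN.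
  rewrite -!uv ?inE //; have := hd h hd0.
  by rewrite /dlin; under eq_bigr => k _ do rewrite duE.
split => [|k|k]; [exact: xv.1|by rewrite xv.2 duv ?inE|].
apply: near_continuous (duc k) _; apply: filterS nD => y Dy.
by rewrite duv ?inE.
Qed.

Lemma C1d_cst D (c : R) : C1d D (fun=> c) (fun _ _ => 0).
Proof.
move=> x _; split => [|k|k]; first exact: differentiable_cst; last exact: cat_cst.
exact: derive_cst.
Qed.

Lemma C1d_coord D j : C1d D (fun x => x 0 j) (fun k _ => (j == k)%:R).
Proof.
move=> x _; have H : differentiable (fun y : E => y 0 j) x /\
    forall k, partial k (fun y : E => y 0 j) x = (j == k)%:R.
  apply: differentiableP_eps => e e0; exists 1 => // h _.
  rewrite mxE [x 0 j + _]addrC addrK /dlin (bigD1 j) //= eqxx mul1r big1 ?addr0.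
    by rewrite subrr normr0 mulr_ge0 // ltW.
  by move=> i; rewrite eq_sym => /negbTE ->; rewrite mul0r.
split; [exact: H.1|exact: H.2|move=> k; exact: cat_cst].
Qed.

Lemma C1dD D u v du dv : C1d D u du -> C1d D v dv ->
  C1d D (fun x => u x + v x) (fun k x => du k x + dv k x).
Proof.
move=> Hu Hv x Dx; have [du0 duE duc] := Hu x Dx; have [dv0 dvE dvc] := Hv x Dx.
split => [|k|k]; first exact: differentiableD.
  by rewrite /partial deriveD ?duE ?dvE //; [rewrite -duE -dvE|exact: diff_derivable..].
exact: catD.
Qed.

Lemma C1dM D u v du dv : C1d D u du -> C1d D v dv ->
  C1d D (fun x => u x * v x) (fun k x => du k x * v x + u x * dv k x).
Proof.
move=> Hu Hv x Dx; have [du0 duE duc] := Hu x Dx; have [dv0 dvE dvc] := Hv x Dx.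
have cu := C1d_continuous Hu Dx; have cv := C1d_continuous Hv Dx.
split => [|k|k]; first exact: differentiableM.
  rewrite /partial deriveM; [|exact: diff_derivable..].
  by rewrite -/(partial k u x) -/(partial k v x) duE dvE addrC; congr (_ + _); exact: mulrC.
by apply: catD; exact: catM.
Qed.

Lemma C1dZ D (c : R) u du : C1d D u du ->
  C1d D (fun x => c * u x) (fun k x => c * du k x).
Proof.
move=> Hu x Dx; have [] := C1dM (C1d_cst c) Hu Dx => d dE dc.
split => // k; first by rewrite dE mul0r add0r.
by have := dc k; under [X in continuous_at _ X -> _]eq_fun do rewrite mul0r add0r.
Qed.

Lemma C1d_sum D m (u : 'I_m -> E -> R) du :
  (forall i, C1d D (u i) (du i)) ->
  C1d D (fun x => \sum_i u i x) (fun k x => \sum_i du i k x).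
Proof.
elim: m u du => [|m IH] u du H.
  move=> x Dx; have [] := C1d_cst 0 Dx => d dE dc.
  split => [|k|k]; first by under eq_fun do rewrite big_ord0.
    by under eq_fun do rewrite big_ord0; rewrite big_ord0 dE.
  by have := dc k; under [X in _ -> continuous_at _ X]eq_fun do rewrite big_ord0.
have := C1dD (H ord0) (IH _ _ (fun i => H (lift ord0 i))).
move=> Hs x Dx; have [d dE dc] := Hs x Dx.
split => [|k|k]; first by under eq_fun do rewrite big_ord_recl.
  by under eq_fun do rewrite big_ord_recl; rewrite big_ord_recl dE.
by have := dc k; under [X in _ -> continuous_at _ X]eq_fun do rewrite big_ord_recl.
Qed.

Lemma C1d_comp D (g dg : R -> R) u du :
  (forall x, D x -> is_derive (u x) 1 g (dg (u x))) ->
  (forall x, D x -> continuous_at (u x) dg) ->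
  C1d D u du -> C1d D (fun x => g (u x)) (fun k x => dg (u x) * du k x).
Proof.
move=> gd gc Hu x Dx; have [du0 duE duc] := Hu x Dx.
have cu := C1d_continuous Hu Dx.
have dg0 : differentiable g (u x).
  by apply/derivable1_diffP; have [] := gd x Dx.
split => [|k|k]; first exact: differentiable_comp.
  rewrite partial_diffE; last exact: differentiable_comp.
  rewrite diff_comp //= -partial_diffE // duE.
  rewrite -[X in 'd g _ X]mulr1 -[X in 'd g _ X]/(du k x *: 1) linearZ /=.
  rewrite -deriveE //; have [_ ->] := gd x Dx.
  exact: mulrC.
by apply: catM; [apply: cat_comp => //; exact: gc|exact: duc].
Qed.

Lemma C1dV D u du : (forall x, D x -> u x != 0) -> C1d D u du ->
  C1d D (fun x => (u x)^-1) (fun k x => - (u x) ^- 2 * du k x).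
Proof.
move=> u0; apply: (@C1d_comp D (fun t => t^-1) (fun t => - t ^- 2)) => x Dx.
  have := is_deriveV (u0 x Dx) (is_derive_id (u x : R^o) 1).
  by rewrite -[_ *: _]/(_ * _) mulr1.
apply: catN; apply: catV; first by rewrite expf_neq0 // u0.
exact: exprn_continuous.
Qed.

Lemma mean_value u x h :
  (forall t, 0 <= t <= 1 -> differentiable u (x + t *: h)) ->
  exists2 t, 0 <= t <= 1 &
    u (x + h) - u x = dlin (fun k => partial k u (x + t *: h)) h.
Proof.
move=> du.
pose p (t : R) := x + t *: h.
have dp (t : R) : is_diff t p ( *:%R^~ h).
  have := @is_diffD R _ _ (cst x) (fun t : R => t *: h) _ _ t (is_diff_cst x t)
     (is_diff_scalel t h).
  by rewrite add0r.
pose dv t := dlin (fun k => partial k u (p t)) h.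
have dup (t : R) : 0 <= t <= 1 -> differentiable (u \o p) t.
  move=> t01; apply: differentiable_comp; last exact: du.
  by have [] := dp t.
have [t|t|t tin] := @MVT_segment R (u \o p) dv 0 1 ler01.
- rewrite in_itv /= => /andP[t0 t1].
  have t01 : 0 <= t <= 1 by rewrite !ltW.
  have d1 := dup _ t01.
  apply: DeriveDef; first exact: diff_derivable.
  rewrite deriveE // diff_comp //=; last exact: du.
  have [_ ->] := dp t.
  by rewrite scale1r diff_partialE //; exact: du.
- apply: continuous_in_subspaceT => s; rewrite inE /= in_itv /= => s01.
  exact/differentiable_continuous/dup.
rewrite /p /= scale1r scale0r addr0 subr0 mulr1 => e.
by exists t => //; move: tin; rewrite in_itv.
Qed.
Lemma mean_value_coord u x k (s : R) :
  (forall t, 0 <= t <= 1 -> differentiable u (x + (t * s) *: delta_mx 0 k)) ->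
  exists2 t, 0 <= t <= 1 & u (x + s *: delta_mx 0 k) - u x =
    s * partial k u (x + (t * s) *: delta_mx 0 k).
Proof.
move=> du; have [t t01|t t01 ->] := @mean_value u x (s *: delta_mx 0 k).
  by rewrite scalerA; exact: du.
exists t => //; rewrite linearZ /= -[LHS]/(s * dlin _ _) dlin_delta.
by rewrite scalerA.
Qed.

Lemma norm_delta_le (k : 'I_n.+1) (s : R) : `|s *: delta_mx 0 k : E| <= `|s|.
Proof.
apply/rV_norm_leP => // i; rewrite !mxE eqxx /=.
by case: (i == k); rewrite ?mulr1 ?mulr0 ?normr0.
Qed.

Lemma ball_in (x : E) (d : R) h : `|h| < d -> ball x d (x + h).
Proof. by rewrite -ball_normE /ball_ /= opprD addNKr normrN. Qed.

(** The mean value theorem is used twice: on the increment of [u] in direction [a], moved along [b],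
    then on [partial b u] along [a]. All points involved lie within [2 * s] of [x], hence in the
    open ball. *)
Lemma second_difference u x a b (s d : R) : 0 < s -> 3 * s <= d ->
  (forall y, ball x d y -> differentiable u y) ->
  (forall y, ball x d y -> differentiable (partial b u) y) ->
  exists2 y, ball x d y &
    u (x + s *: delta_mx 0 b + s *: delta_mx 0 a) - u (x + s *: delta_mx 0 b)
    - (u (x + s *: delta_mx 0 a) - u x) = s * s * partial a (partial b u) y.
Proof.
move=> s0 sd du dbu.
have d0 : 0 < d by apply: lt_le_trans sd; rewrite mulr_gt0.
have smallm (t : R) k : 0 <= t <= 1 -> `|(t * s) *: delta_mx 0 k : E| <= s.
  move=> /andP[t0 t1]; apply: le_trans (norm_delta_le _ _) _.
  by rewrite ger0_norm ?mulr_ge0 ?(ltW s0) // ler_piMl // ltW.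
have inb (t t' : R) : 0 <= t <= 1 -> 0 <= t' <= 1 ->
    ball x d (x + (t * s) *: delta_mx 0 b + (t' * s) *: delta_mx 0 a).
  move=> t01 t'01; rewrite -addrA; apply: ball_in.
  apply: le_lt_trans (ler_normD _ _) _.
  have := smallm t b t01; have := smallm t' a t'01; lra.
have ina (t : R) : 0 <= t <= 1 -> ball x d (x + (t * s) *: delta_mx 0 b).
  by move=> t01; have := inb t 0 t01; rewrite mul0r scale0r addr0; apply; rewrite lexx ler01.
pose w y := u (y + s *: delta_mx 0 a) - u y.
have sh y : differentiable u (y + s *: delta_mx 0 a) ->
    differentiable (fun y => u (y + s *: delta_mx 0 a)) y /\
    forall k, partial k (fun y => u (y + s *: delta_mx 0 a)) y =
      partial k u (y + s *: delta_mx 0 a).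
  move=> /differentiable_eps dy; apply: differentiableP_eps => e e0.
  have [r r0 hr] := dy e e0; exists r => // h hh.
  by rewrite [y + h + _]addrAC; exact: hr.
have oneb : 0 <= (1 : R) <= 1 by apply/andP.
have dsh (t : R) : 0 <= t <= 1 ->
    differentiable u (x + (t * s) *: delta_mx 0 b + s *: delta_mx 0 a).
  by move=> t01; apply: du; have := inb t 1 t01 oneb; rewrite mul1r.
have [t t01|t t01] := @mean_value_coord w x b s.
  by apply: differentiableB; [exact: (sh _ (dsh _ t01)).1|exact/du/ina].
have -> : partial b w (x + (t * s) *: delta_mx 0 b) =
    partial b u (x + (t * s) *: delta_mx 0 b + s *: delta_mx 0 a) -
    partial b u (x + (t * s) *: delta_mx 0 b).
  rewrite {1}/partial deriveB; [| |exact/diff_derivable/du/ina].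
    by rewrite -[X in X - _]/(partial b _ _) (sh _ (dsh _ t01)).2.
  exact/diff_derivable/(sh _ (dsh _ t01)).1.
rewrite /w => ->.
have [t' t'01|t' t'01 ->] := @mean_value_coord (partial b u)
    (x + (t * s) *: delta_mx 0 b) a s.
  exact/dbu/inb.
by exists (x + (t * s) *: delta_mx 0 b + (t' * s) *: delta_mx 0 a);
  [exact: inb|rewrite mulrA].
Qed.

(** The second difference is unchanged when [a] and [b] are exchanged; divided by the square of the
    step, it equals each mixed derivative at some point near [x], and continuity closes the gap.
    This supplies the symmetric Hessian that [tri_divergence] asks for. *)
Lemma partialC D u x a b : open D -> C1_on D u ->
  (forall k, C1_on D (partial k u)) -> D x ->
  partial a (partial b u) x = partial b (partial a u) x.
Proof.
move=> oD Du Ddu Dx; apply/eqP; rewrite -subr_eq0 -normr_le0.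
apply/ler_addgt0Pl => e e0; rewrite addr0.
have e20 : 0 < e / 2 by rewrite divr_gt0.
have cAB k l : \forall y \near x,
    `|partial k (partial l u) x - partial k (partial l u) y| < e / 2.
  by have [_ /(_ k)/cvgrPdist_lt/(_ _ e20)] := Ddu l x Dx.
have nD : \forall y \near x, D y by exact: open_nbhs_nbhs.
have /nbhs_ballP[d /= d0 hd] : \forall y \near x, [/\ D y,
    `|partial a (partial b u) x - partial a (partial b u) y| < e / 2 &
    `|partial b (partial a u) x - partial b (partial a u) y| < e / 2].
  by apply: filterS3 nD (cAB a b) (cAB b a) => y; split.
have s0 : 0 < d / 3 by rewrite divr_gt0.
have sd : 3 * (d / 3) <= d by rewrite mulrC divfK.
have du y : ball x d y -> differentiable u y.
  by move=> /hd[Dy _ _]; have [] := Du y Dy.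
have ddu k y : ball x d y -> differentiable (partial k u) y.
  by move=> /hd[Dy _ _]; have [] := Ddu k y Dy.
have [y1 b1 e1] := second_difference a s0 sd du (ddu b).
have [y2 b2 e2] := second_difference b s0 sd du (ddu a).
have : partial a (partial b u) y1 = partial b (partial a u) y2.
  have ss0 : d / 3 * (d / 3) != 0 by rewrite mulf_neq0 // gt_eqF.
  rewrite (addrAC x) in e2.
  apply: (@mulfI R _ ss0); apply: etrans (esym e1) (etrans _ e2).
  ring.
have [_ + _] := hd _ b1; have [_ _ +] := hd _ b2.
move=> h2 h1 h; rewrite h in h1; exact: dist_half h1 h2.
Qed.

End Differentiation.

Lemma is_derive_line (R : realType) n (u : 'rV[R]_n.+1 -> R) (x v : 'rV[R]_n.+1)
    (t : R) : differentiable u (x + t *: v) ->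
  is_derive t 1 (fun s : R => u (x + s *: v))
    (dlin (fun k => partial k u (x + t *: v)) v).
Proof.
move=> du; pose p (s : R) := x + s *: v.
have dp : is_diff t p ( *:%R^~ v).
  have := @is_diffD R _ _ (cst x) (fun t : R => t *: v) _ _ t (is_diff_cst x t)
     (is_diff_scalel t v).
  by rewrite add0r.
have [dpt dpE] := dp.
have dup : differentiable (u \o p) t by apply: differentiable_comp.
apply: DeriveDef; first exact: diff_derivable.
rewrite deriveE // diff_comp //= dpE scale1r diff_partialE //.
Qed.

Lemma near_forall (T : topologicalType) (x : T) n (P : 'I_n -> T -> Prop) :
  (forall k, \forall y \near x, P k y) -> \forall y \near x, forall k, P k y.
Proof. by move=> h; apply: filter_forall. Qed.

Lemma continuous_at_eps (R : realType) n (g : 'rV[R]_n.+1 -> R) y :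
  continuous_at y g <-> forall e, 0 < e -> exists2 d, 0 < d &
    forall h, `|h| < d -> `|g (y + h) - g y| < e.
Proof.
split=> [cg e e0|H].
  have /cvgrPdist_lt/(_ _ e0)/nbhs_ballP[d /= d0 hd] := cg.
  by exists d => // h hd'; rewrite distrC; apply: hd; exact: ball_in.
apply/(@cvgrPdist_lt _ _ _ (nbhs y) (nbhs_filter y)) => e e0; have [d d0 hd] := H e e0.
apply/nbhs_ballP; exists d => // y'; rewrite -ball_normE /ball_ /= distrC => /hd.
by rewrite subrKC distrC.
Qed.

(** * Borel measurability tested on coordinates *)

Section BorelMeasurability.
Variable R : realType.

(** An open set is a countable union of sup-norm balls with rational centres and radii $1/(n+1)$,
    and membership in such a ball is a finite conjunction of conditions on single coordinates. *)
Lemma measurable_comp_rV d (T : measurableType d) n (D : set T)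
    (v : T -> 'rV[R]_n) (O : set 'rV[R]_n) :
  measurable D -> (forall k, measurable_fun D (fun t => v t 0 k)) -> open O ->
  measurable (D `&` v @^-1` O).
Proof.
move=> mD mv oO.
pose q (c : 'rV[rat]_n) : 'rV[R]_n := map_mx ratr c.
pose B (c : 'rV[rat]_n * nat) := ball (q c.1) (c.2.+1%:R^-1 : R).
pose F c := if `[< B c `<=` O >] then D `&` v @^-1` B c else set0.
have -> : D `&` v @^-1` O = \bigcup_c F c.
  apply/seteqP; split => [t [Dt /= Ot]|t [c _]]; last first.
    by rewrite /F; case: asboolP => // BO [Dt /BO].
  have /nbhs_ballP[e /= e0 he] : nbhs (v t) O by exact: open_nbhs_nbhs.
  (* A radius below [e / 2] lets a ball that contains [v t] fit into the ball of radius [e] around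
     it. *)
  have [N hN] : exists N : nat, (N.+1%:R^-1 : R) < e / 2.
    have /archi_boundP := ltW (divr_gt0 (ltr0n R 2) e0).
    set N := Num.bound _ => hN; exists N.
    rewrite invf_plt ?posrE ?divr_gt0 // invf_div.
    by apply: lt_le_trans hN _; rewrite ler_nat.
  have N0 : 0 < (N.+1%:R^-1 : R) by rewrite invr_gt0.
  have /choice[c hc] : forall k : 'I_n, exists r : rat,
      `|v t 0 k - ratr r| < N.+1%:R^-1.
    move=> k; have /rat_in_itvoo[r] : v t 0 k - N.+1%:R^-1 < v t 0 k + N.+1%:R^-1.
      by rewrite ltrD2l gt0_cp.
    rewrite in_itv /= => /andP[r1 r2]; exists r.
    by rewrite ltr_distlC r1 r2.
  have qv : ball (q (\row_k c k)) N.+1%:R^-1 (v t).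
    rewrite -ball_normE /ball_ /= distrC; apply/(rV_norm_ltP _ N0) => k.
    by rewrite !mxE; exact: hc.
  exists (\row_k c k, N) => //; rewrite /F; case: asboolP => // -[] y By.
  apply: he; rewrite [e]splitr.
  apply: (@ball_triangle _ _ (q (\row_k c k))).
    by apply: (le_ball (ltW hN)); exact: ball_sym.
  by apply: (le_ball (ltW hN)).
apply: countable_bigcupT_measurable => // c; rewrite /F; case: asboolP => // _.
have -> : D `&` v @^-1` B c =
    D `&` \bigcap_(k in [set: 'I_n]) (D `&` (fun t => v t 0 k) @^-1`
      ball (q c.1 0 k) (c.2.+1%:R^-1 : R)).
  have c0 : 0 < (c.2.+1%:R^-1 : R) by rewrite invr_gt0.
  apply/seteqP; split => t [Dt] /=.
    rewrite /B -ball_normE /ball_ /= => /(rV_norm_ltP _ c0) h.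
    split => // k _; split => //=; rewrite -ball_normE /ball_ /=.
    by have := h k; rewrite !mxE.
  move=> h; split => //; rewrite /B -ball_normE /ball_ /=.
  apply/(rV_norm_ltP _ c0) => k; have [_] := h k I; rewrite /= -ball_normE /ball_/=.
  by rewrite !mxE.
apply: measurableI => //; apply: fin_bigcap_measurable; first exact: finite_finset.
move=> k _; apply: mv => //; apply: open_measurable; exact: ball_open.
Qed.

Lemma measurable_fun_borel4 d (T : measurableType d) (D : set T)
    (v : T -> borel4 R) : measurable D ->
  (forall k, measurable_fun D (fun t => (v t : 'rV[R]_4) 0 k)) ->
  measurable_fun D v.
Proof.
move=> mD mv; apply: (@measurability _ _ _ _ D v (@open 'rV[R]_4)) => //.
by move=> _ [V oV <-]; exact: measurable_comp_rV.
Qed.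

Lemma open_measurable_borel4 (O : set 'rV[R]_4) :
  open O -> measurable (O : set (borel4 R)).
Proof. by move=> oO; exact: sub_sigma_algebra. Qed.

Lemma closed_measurable_borel4 (C : set 'rV[R]_4) :
  closed C -> measurable (C : set (borel4 R)).
Proof.
move=> cC; rewrite -(setCK C); apply: measurableC; apply: open_measurable_borel4.
exact: closed_openC.
Qed.

Lemma within_continuous_measurable_borel4 (C : set 'rV[R]_4) (h : 'rV[R]_4 -> R) :
  measurable (C : set (borel4 R)) -> {within C, continuous h} ->
  measurable_fun (C : set (borel4 R)) (h : borel4 R -> R).
Proof.
move=> mC ch; apply: (measurability _ (RGenOpens.measurableE R)).
move=> _ [_ [a [b ->]] <-].
have : open ((h : subspace C -> R) @^-1` `]a, b[).
  by move/continuousP : ch; apply; exact: interval_open.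
move=> /open_subspaceP[V oV VC].
rewrite setIC -VC; apply: measurableI => //; exact: open_measurable_borel4.
Qed.

Lemma continuous_measurable_borel4 (h : 'rV[R]_4 -> R) :
  continuous h -> measurable_fun setT (h : borel4 R -> R).
Proof.
move=> ch; apply: within_continuous_measurable_borel4 => //.
exact: continuous_subspaceT.
Qed.

Lemma measurable_coord_borel4 (k : 'I_4) :
  measurable_fun setT (fun x : borel4 R => (x : 'rV[R]_4) 0 k).
Proof. apply: continuous_measurable_borel4; exact: coord_continuous. Qed.

End BorelMeasurability.

(** * Volume measure and volume integrals *)

Section Volume.
Variable R : realType.
Local Notation leb := (@lebesgue_measure R).
Local Notation leb3 := (@lebesgue3 R).

Lemma lebesgue3E (A B C : set R) :
  measurable (A : set (measurableTypeR R)) ->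
  measurable (B : set (measurableTypeR R)) ->
  measurable (C : set (measurableTypeR R)) ->
  leb3 (A `*` B `*` C) = (leb A * leb B * leb C)%E.
Proof.
move=> mA mB mC; rewrite /lebesgue3 product_measure1E //; last exact: measurableX.
by congr (_ * _)%E; exact: product_measure1E.
Qed.

Definition cube (n : nat) : set R := `[- n%:R, n%:R]%classic.

Lemma measurable_cube n : measurable (cube n : set (measurableTypeR R)).
Proof. exact: measurable_itv. Qed.

Lemma lebesgue_cube n : leb (cube n) = (n%:R + n%:R)%:E.
Proof.
rewrite /cube lebesgue_measure_itv /= lte_fin.
case: ltP => [_|h]; first by rewrite -EFinB opprK.
have n0 : (0 <= n%:R :> R) by [].
by congr (_%:E); lra.
Qed.

Lemma cube_cover (x : R) : exists n, forall m, (n <= m)%N -> cube m x.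
Proof.
exists (Num.bound `|x|) => m nm; rewrite /cube /= in_itv /= -ler_norml.
apply: le_trans (ltW (archi_boundP (normr_ge0 x))) _.
by rewrite ler_nat.
Qed.

Lemma lebesgue3_sigma_finite : sigma_finite [set: R * R * R] leb3.
Proof.
exists (fun n => cube n `*` cube n `*` cube n).
  apply/seteqP; split => // -[[x y] z] _.
  have [a ha] := cube_cover x; have [b hb] := cube_cover y.
  have [c hc] := cube_cover z.
  exists (maxn (maxn a b) c) => //; split; first split => /=.
  - by apply: ha; rewrite !leq_max leqnn.
  - by apply: hb; rewrite !leq_max leqnn orbT.
  - by apply: hc; rewrite !leq_max leqnn orbT.
move=> n; split; first by do 2?apply: measurableX; exact: measurable_cube.
by rewrite lebesgue3E ?lebesgue_cube -?EFinM ?ltry //; exact: measurable_cube.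
Qed.

HB.instance Definition _ := Measure.on leb3.
HB.instance Definition _ :=
  Measure_isSigmaFinite.Build _ _ _ leb3 lebesgue3_sigma_finite.

(** This is [graph_pt] over a constant function: Fubini's theorem and the charts thus order the
    three remaining coordinates in the same way. *)
Definition ins (i : 'I_4) (p : (R * R * R) * R) : borel4 R :=
  graph_pt i (fun=> p.2) (vec3 p.1).

Lemma ins_i i y t : (ins i (y, t) : 'rV[R]_4) 0 i = t.
Proof. by rewrite mxE unlift_none. Qed.

Lemma ins_lift i y t l : (ins i (y, t) : 'rV[R]_4) 0 (lift i l) = vec3 y 0 l.
Proof. by rewrite mxE liftK. Qed.

Lemma ord3P (P : 'I_3 -> Prop) : P 0 -> P 1 -> P 2 -> forall k, P k.
Proof.
move=> P0 P1 P2 [[|[|[|//]]] lti].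
- by rewrite (_ : Ordinal lti = 0) //; exact/val_inj.
- by rewrite (_ : Ordinal lti = 1) //; exact/val_inj.
- by rewrite (_ : Ordinal lti = 2) //; exact/val_inj.
Qed.

Lemma measurable_vec3 k : measurable_fun setT
  (fun y : measurableTypeR R * measurableTypeR R * measurableTypeR R => vec3 y 0 k).
Proof.
move: k; apply: ord3P; under eq_fun do rewrite mxE /=.
- exact: (measurableT_comp measurable_fst measurable_fst).
- exact: (measurableT_comp measurable_snd measurable_fst).
- exact: measurable_snd.
Qed.

Lemma measurable_ins i : measurable_fun setT
  (ins i : (measurableTypeR R * measurableTypeR R * measurableTypeR R) *
     measurableTypeR R -> borel4 R).
Proof.
apply: measurable_fun_borel4 => // k.
have [l ->|->] := unliftP i k.
  rewrite (_ : (fun t => _) = fun p => vec3 p.1 0 l); last first.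
    by apply/funext => -[y t]; exact: ins_lift.
  exact: (measurableT_comp (measurable_vec3 l) measurable_fst).
rewrite (_ : (fun t => _) = fun p => p.2); last first.
  by apply/funext => -[y t]; exact: ins_i.
exact: measurable_snd.
Qed.

(** Lebesgue measure on the Borel sets of four-space. The coordinate 3 that is split off is an
    arbitrary choice, undone by [lam4E]. *)
Definition lam4 : set (borel4 R) -> \bar R :=
  pushforward (leb3 \x leb)%E (ins 3).

Let lam40 : lam4 set0 = 0%E.
Proof. by rewrite /lam4 /pushforward preimage_set0 measure0. Qed.

Let lam4_ge0 A : (0 <= lam4 A)%E.
Proof. by rewrite /lam4 /pushforward; exact: measure_ge0. Qed.

Let lam4_sigma_additive : semi_sigma_additive lam4.
Proof.
move=> F mF tF mUF; rewrite /lam4 /pushforward preimage_bigcup.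
have mi n : measurable (ins 3 @^-1` F n).
  by rewrite -[X in measurable X]setTI; exact: measurable_ins.
apply: measure_semi_sigma_additive => //.
- apply/trivIsetP => /= i j _ _ ij; rewrite -preimage_setI.
  by move/trivIsetP : tF => /(_ _ _ _ _ ij) ->//; rewrite preimage_set0.
- by apply: bigcupT_measurable => n; exact: mi.
Qed.

HB.instance Definition _ := isMeasure.Build _ _ _ lam4
  lam40 lam4_ge0 lam4_sigma_additive.

Definition rect4 (B : 'I_4 -> set R) : set (borel4 R) :=
  [set x : 'rV[R]_4 | forall k, B k (x 0 k)].

Lemma ins_rect4 i (B : 'I_4 -> set R) : ins i @^-1` rect4 B =
  B (lift i 0) `*` B (lift i 1) `*` B (lift i 2) `*` B i.
Proof.
apply/seteqP; split => [[[[x y] z] t] H|[[[x y] z] t] [[[Bx By] Bz] Bt] k].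
  split; last by have := H i; rewrite ins_i.
  split; first split.
  - by have := H (lift i 0); rewrite ins_lift mxE.
  - by have := H (lift i 1); rewrite ins_lift mxE.
  - by have := H (lift i 2); rewrite ins_lift mxE.
have [l ->|->] := unliftP i k; last by rewrite ins_i.
rewrite ins_lift; move: l; apply: ord3P; by rewrite mxE.
Qed.

Lemma rect4_volume i (B : 'I_4 -> set R) :
  (forall k, measurable (B k : set (measurableTypeR R))) ->
  (leb3 \x leb)%E (ins i @^-1` rect4 B) = (\prod_k leb (B k))%E.
Proof.
move=> mB; rewrite ins_rect4 product_measure1E //; last first.
  by do 2?apply: measurableX.
rewrite (bigD1_ord i) //= muleC; congr (_ * _)%E.
apply: etrans (lebesgue3E _ _ _) _ => //.
rewrite !big_ord_recr big_ord0 /= mul1e.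
by congr (_ * _ * _)%E; congr (leb (B (lift i _))); exact/val_inj.
Qed.

Lemma measurable_rect4 (B : 'I_4 -> set R) :
  (forall k, measurable (B k : set (measurableTypeR R))) -> measurable (rect4 B).
Proof.
move=> mB; rewrite (_ : rect4 B = \bigcap_(k in [set: 'I_4])
    (setT `&` (fun x : borel4 R => (x : 'rV[R]_4) 0 k) @^-1` B k)).
  apply: fin_bigcap_measurable; first exact: finite_finset.
  move=> k _; exact: (measurable_coord_borel4 k measurableT (mB k)).
apply/seteqP; split => [x Bx k _|x Bx k]; first by split => //; exact: Bx.
by have [] := Bx k I.
Qed.

(** Boxes are stable under intersection, generate the Borel sets and are exhausted by cubes of
    finite measure, so the uniqueness theorem for measures applies. *)
Lemma measure_unique_rect4 (m1 m2 : {measure set (borel4 R) -> \bar R}) :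
  (forall B : 'I_4 -> set R,
    (forall k, measurable (B k : set (measurableTypeR R))) ->
    m1 (rect4 B) = m2 (rect4 B)) ->
  (forall n, m1 (rect4 (fun=> cube n)) < +oo)%E ->
  forall A, measurable A -> m1 A = m2 A.
Proof.
move=> m12 m1oo A mA.
pose G := [set A | exists2 B : 'I_4 -> set R,
  (forall k, measurable (B k : set (measurableTypeR R))) & A = rect4 B].
apply: (measure_unique G (fun n => rect4 (fun=> cube n))) => //.
- apply/seteqP; split; last first.
    apply: smallest_sub; first exact: sigma_algebra_measurable.
    by move=> _ [B mB ->]; exact: measurable_rect4.
  apply: smallest_sub; first exact: smallest_sigma_algebra.
  move=> V oV.
  (* Applied to the identity, with the sigma-algebra generated by boxes on the source, this places
     every open set in that sigma-algebra. *)
  have := @measurable_comp_rV R _ (g_sigma_algebraType G) 4 setT id V.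
  rewrite setTI; apply => // k _ Y mY; rewrite setTI.
  apply: sub_sigma_algebra; exists (fun l => if l == k then Y else setT).
    by move=> l; case: ifP.
  apply/seteqP; split => [x Yx l|x /(_ k)]; first by case: eqP => // ->.
  by rewrite /= eqxx.
- move=> _ _ [B mB ->] [C mC ->]; exists (fun k => B k `&` C k).
    by move=> k; exact: measurableI.
  apply/seteqP; split => [x [Bx Cx] k|x BCx]; first by split; [exact: Bx|exact: Cx].
  by split=> k; have [] := BCx k.
- by move=> n; exists (fun=> cube n) => // _; exact: measurable_cube.
- apply/seteqP; split => // x _.
  have /choice[N hN] : forall k : 'I_4, exists n, forall m, (n <= m)%N ->
      cube m ((x : 'rV[R]_4) 0 k) by move=> k; exact: cube_cover.
  exists (\max_k N k) => // k; apply: hN; exact: leq_bigmax.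
- by move=> _ [B mB ->]; exact: m12.
Qed.

Lemma lam4_rect4 (B : 'I_4 -> set R) :
  (forall k, measurable (B k : set (measurableTypeR R))) ->
  lam4 (rect4 B) = (\prod_k leb (B k))%E.
Proof. exact: rect4_volume. Qed.

Lemma lam4_cube n : lam4 (rect4 (fun=> cube n)) = ((n%:R + n%:R) ^+ 4)%:E.
Proof.
rewrite lam4_rect4 => [|k]; last exact: measurable_cube.
under eq_bigr do rewrite lebesgue_cube.
by rewrite prodEFin prodr_const card_ord.
Qed.

(** Both sides give a box the product of the measures of its four sides, in whatever order. Hence
    any coordinate may serve as the inner variable. *)
Lemma lam4E i A : measurable A -> lam4 A = (leb3 \x leb)%E (ins i @^-1` A).
Proof.
pose m2 : {measure set (borel4 R) -> \bar R} :=
  measure_function_pushforward__canonical__measure_function_Measure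
    (leb3 \x leb)%E (measurable_ins i).
apply: (@measure_unique_rect4 lam4 m2) => [B mB|n].
  exact: etrans (lam4_rect4 mB) (esym (rect4_volume i mB)).
apply: le_lt_trans (ltry ((n%:R + n%:R) ^+ 4)).
by rewrite -lam4_cube lexx.
Qed.

End Volume.

(** * Volume integrals of functions with bounded support *)

Section VolumeIntegral.
Variable R : realType.
Local Notation leb := (@lebesgue_measure R).
Local Notation leb3 := (@lebesgue3 R).
Local Notation E4 := 'rV[R]_4.
Local Notation T1 := (measurableTypeR R).
Local Notation T4 := (T1 * T1 * T1 * T1)%type.
Implicit Types (h u : E4 -> R) (M C : R).

Lemma finite_support_integrable d (T : measurableType d)
    (mu : {measure set T -> \bar R}) (f : T -> R) (B : set T) (C : R) :
  measurable B -> (mu B < +oo)%E -> measurable_fun setT f ->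
  (forall x, `|f x| <= C * \1_B x) -> mu.-integrable setT (EFin \o f).
Proof.
move=> mB muB mf fC.
have iB : mu.-integrable setT (EFin \o (fun x => C * \1_B x)).
  have -> : EFin \o (fun x => C * \1_B x) = (fun x => C%:E * (\1_B x)%:E)%E.
    by apply/funext => x; rewrite /= EFinM.
  apply: integrableZl => //; apply/integrableP; split.
    by apply/measurable_EFinP; exact: measurable_indic.
  under eq_integral do rewrite /= ger0_norm //.
  by rewrite integral_indic // setIT.
apply: le_integrable iB => //; first exact/measurable_EFinP.
by move=> x _ /=; rewrite lee_fin; apply: le_trans (ler_norm _).
Qed.

Lemma lebesgue_cube_lty n : (leb (@cube R n) < +oo)%E.
Proof. by rewrite lebesgue_cube ltry. Qed.

Lemma lam4_cube_lty n : (@lam4 R (rect4 (fun=> @cube R n)) < +oo)%E.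
Proof. by rewrite lam4_cube ltry. Qed.

Definition vanishes_out (M : R) h := forall x : E4, M < `|x| -> h x = 0.

Lemma continuous_vanishes_bounded M h : continuous h -> vanishes_out M h ->
  exists2 C, 0 <= C & forall x, `|h x| <= C.
Proof.
move=> ch hM.
have cK : compact [set x : E4 | `|x| <= M].
  apply: bounded_closed_compact.
    exists M; split; first exact: num_real.
    move=> e Me x /= xM; apply: le_trans xM (ltW Me).
  have := @closed_comp _ _ (fun x : E4 => `|x|) [set t : R | t <= M].
  by apply; [move=> x _; exact: norm_continuous|exact: closed_le].
have chn : {within [set x : E4 | `|x| <= M], continuous (fun x => `|h x|)}.
  apply: continuous_subspaceT => x; apply: cat_norm; exact: ch.
case: (pselect ([set x : E4 | `|x| <= M] !=set0)) => [ne|ne0].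
  have [c cM hc] := compact_EVT_max ne cK chn.
  exists `|h c| => // x; have [xM|xM] := leP `|x| M.
    by apply: hc; rewrite inE.
  by rewrite hM // normr0.
exists 0 => // x; rewrite hM ?normr0 // ltNge; apply/negP => xM; apply: ne0.
by exists x.
Qed.

Lemma rect4_cubeP (M : R) : exists n, forall x : E4, `|x| <= M ->
  rect4 (fun=> @cube R n) x.
Proof.
exists (Num.bound `|M|) => x xM k; rewrite /cube /= in_itv /= -ler_norml.
apply: le_trans (le_coord_norm x k) (le_trans xM _).
exact: le_trans (ler_norm M) (ltW (archi_boundP (normr_ge0 M))).
Qed.

Lemma bounded_integrable_vol M C h : measurable_fun setT (h : borel4 R -> R) ->
  (forall x, `|h x| <= C) -> vanishes_out M h ->
  (@lam4 R).-integrable setT (EFin \o (h : borel4 R -> R)) /\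
  forall i, (leb3 \x leb)%E.-integrable setT (EFin \o (fun p => h (ins i p))).
Proof.
move=> mh hC hM; have [n hn] := rect4_cubeP M.
have C0 : 0 <= C by apply: le_trans (hC 0).
have mB : measurable (rect4 (fun=> @cube R n)).
  by apply: measurable_rect4 => k; exact: measurable_cube.
have hB x : `|h x| <= C * \1_(rect4 (fun=> @cube R n)) (x : borel4 R).
  rewrite indicE; case: (boolP (x \in _)) => /= xB; first by rewrite mulr1.
  rewrite mulr0 hM ?normr0 // ltNge; apply/negP => /hn xB'.
  by move: xB; rewrite notin_setE; exact.
split.
  by apply: (finite_support_integrable mB) => //; exact: lam4_cube_lty.
move=> i; have mBi : measurable (@ins R i @^-1` rect4 (fun=> @cube R n) : set T4).
  by rewrite -[X in measurable X]setTI; apply: measurable_ins.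
apply: (finite_support_integrable mBi (C := C)).
- rewrite (_ : _ (ins i @^-1` _) = @lam4 R (rect4 (fun=> @cube R n))).
    exact: lam4_cube_lty.
  by rewrite (lam4E i).
- exact: (measurableT_comp mh (measurable_ins i)).
- move=> p; exact: hB.
Qed.

Definition vol h : R := Rintegral (@lam4 R) setT (h : borel4 R -> R).

Lemma vol_ins i M C h : measurable_fun setT (h : borel4 R -> R) ->
  (forall x, `|h x| <= C) -> vanishes_out M h ->
  vol h = Rintegral (leb3 \x leb)%E setT (fun p => h (ins i p)).
Proof.
move=> mh hC hM; have [_ /(_ i) hi] := bounded_integrable_vol mh hC hM.
rewrite /vol /Rintegral; congr fine.
rewrite (@eq_measure_integral _ _ _ _
    (measure_function_pushforward__canonical__measure_function_Measure
    (leb3 \x leb)%E (@measurable_ins R i))); last first.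
  by move=> A mA _; exact: lam4E.
rewrite integral_pushforward //; first exact: measurable_ins.
exact/measurable_EFinP.
Qed.

(** Coordinate [i] is the inner variable: [vol_partial] puts the direction of differentiation there,
    [chart_vol_limit] the vertical direction of a chart. *)
Lemma vol_fubini i M C h : measurable_fun setT (h : borel4 R -> R) ->
  (forall x, `|h x| <= C) -> vanishes_out M h ->
  vol h = Rintegral leb3 setT
    (fun y => Rintegral leb setT (fun t => h (ins i (y, t)))).
Proof.
move=> mh hC hM; rewrite (vol_ins i mh hC hM) /Rintegral; congr fine.
have [_ /(_ i) hi] := bounded_integrable_vol mh hC hM.
rewrite -integral12_prod_meas1 //.
apply: eq_integral => y _; rewrite /fubini_F /=.
rewrite fineK //.
have mhi : measurable_fun setT (fun t => h (ins i (y, t))).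
  exact: (measurableT_comp (measurableT_comp mh (measurable_ins i))
    (measurable_pair1 y)).
pose n := Num.bound `|M|.
have mc : measurable (@cube R n : set (measurableTypeR R)) by exact: measurable_cube.
have : leb.-integrable setT (EFin \o (fun t => h (ins i (y, t)))).
  apply: (finite_support_integrable mc (C := C)) => //.
    exact: lebesgue_cube_lty.
  move=> t; rewrite indicE; case: (boolP (t \in _)) => /= tc.
    by rewrite mulr1.
  rewrite mulr0 hM ?normr0 // ltNge; apply/negP => xM.
  move: tc; rewrite notin_setE; apply; rewrite /cube /= in_itv /= -ler_norml.
  have := le_coord_norm (ins i (y, t) : E4) i; rewrite ins_i => /le_trans; apply.
  apply: le_trans xM _.
  exact: le_trans (ler_norm M) (ltW (archi_boundP (normr_ge0 M))).
exact: integrable_fin_num.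
Qed.

Lemma csupp_measurable h : continuous h -> measurable_fun setT (h : borel4 R -> R).
Proof. exact: continuous_measurable_borel4. Qed.

Lemma csupp_integrable M h : continuous h -> vanishes_out M h ->
  (@lam4 R).-integrable setT (EFin \o (h : borel4 R -> R)).
Proof.
move=> ch hM; have [C _ hC] := continuous_vanishes_bounded ch hM.
by have [] := bounded_integrable_vol (csupp_measurable ch) hC hM.
Qed.

Lemma volD M h u : continuous h -> vanishes_out M h ->
  continuous u -> vanishes_out M u -> vol (fun x => h x + u x) = vol h + vol u.
Proof.
by move=> ch hM cu uM; rewrite /vol RintegralD //; exact: (@csupp_integrable M).
Qed.

Lemma volZ M (c : R) h : continuous h -> vanishes_out M h ->
  vol (fun x => c * h x) = c * vol h.
Proof.
by move=> ch hM; rewrite /vol RintegralZl //; exact: (@csupp_integrable M).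
Qed.

Lemma vol0 : vol (fun=> 0) = 0.
Proof. by rewrite /vol Rintegral_cst // mul0r. Qed.

Lemma vol_sum M (I : Type) (r : seq I) (F : I -> E4 -> R) :
  (forall i, continuous (F i)) -> (forall i, vanishes_out M (F i)) ->
  vol (fun x => \sum_(i <- r) F i x) = \sum_(i <- r) vol (F i).
Proof.
move=> cF FM; elim: r => [|i r IH].
  by under [X in vol X]eq_fun do rewrite big_nil; rewrite big_nil vol0.
under [X in vol X]eq_fun do rewrite big_cons.
rewrite big_cons -IH (@volD M) // => [x|x xM]; first by apply: cat_sum => j; exact: cF.
by apply: big1 => j _; exact: FM.
Qed.

Lemma Rintegral_FTC2 (F f : R -> R) (a b : R) : a < b ->
  (forall t : R, is_derive t (1 : R) F (f t)) -> continuous f ->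
  Rintegral leb `[a, b] f = F b - F a.
Proof.
move=> ab dF cf.
have dF1 t : derivable F t 1 by have [] := dF t.
have cF : continuous F.
  by move=> t; apply/differentiable_continuous/derivable1_diffP.
rewrite /Rintegral (@continuous_FTC2 _ f F) //.
- exact: continuous_subspaceT.
- split => //; [exact/cvg_at_right_filter/cF|exact/cvg_at_left_filter/cF].
- by move=> t _; rewrite derive1E; have [_ ->] := dF t.
Qed.

Lemma Rintegral_support (f : R -> R) (a b : R) :
  (forall t, ~~ (a <= t <= b) -> f t = 0) ->
  Rintegral leb setT f = Rintegral leb `[a, b] f.
Proof.
move=> f0; rewrite [RHS]Rintegral_mkcond; apply: eq_Rintegral => t _.
rewrite /patch; case: ifPn => // tab; apply: f0.
by move: tab; rewrite notin_setE /= in_itv /= => /negP.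
Qed.

Lemma ins_line k y t :
  (ins k (y, t) : E4) = (ins k (y, 0) : E4) + t *: delta_mx 0 k.
Proof.
apply/rowP => l; have [m ->|->] := unliftP k l.
  by rewrite [RHS]mxE !ins_lift !mxE eqxx eq_sym (negbTE (neq_lift _ _)) mulr0 addr0.
by rewrite [RHS]mxE !ins_i !mxE !eqxx add0r mulr1.
Qed.

Lemma continuous_ins_t k y : continuous (fun t : R => ins k (y, t) : E4).
Proof.
move=> t; apply: continuous_rV => l; have [m ->|->] := unliftP k l.
  under [X in continuous_at _ X]eq_fun do rewrite ins_lift.
  exact: cat_cst.
under [X in continuous_at _ X]eq_fun do rewrite ins_i.
exact: cvg_id.
Qed.

(** The strict inequality in [vanishes_out] makes the outer region open, so [u] agrees with zero
    near each of its points and its derivatives vanish there too. *)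
Lemma C1d_vanishes_out M u du k : C1d setT u du -> vanishes_out M u ->
  vanishes_out M (du k).
Proof.
move=> Hu uM x Mx.
have oD : open [set x : E4 | M < `|x|].
  have := @open_comp _ _ (fun x : E4 => `|x|) [set t : R | M < t].
  by apply; [move=> y _; exact: norm_continuous|exact: open_gt].
have H : C1d [set x : E4 | M < `|x|] (fun=> 0) du.
  apply: C1d_eq oD _ _ (C1d_sub _ Hu) => // y; rewrite inE => /uM //.
have [_ dE _] := H x Mx; have [_ dE' _] := @C1d_cst R 3 setT 0 x I.
by rewrite -dE dE'.
Qed.

(** With direction [k] innermost, each inner integral is a difference of values of [u] at two points
    beyond its support. *)
Lemma vol_partial M u du k : C1d setT u du -> vanishes_out M u ->
  vol (du k) = 0.
Proof.
move=> Hu uM.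
have cdu : continuous (du k) by move=> x; have [_ _] := Hu x I; exact.
have duM := C1d_vanishes_out k Hu uM.
have [C _ hC] := continuous_vanishes_bounded cdu duM.
rewrite (vol_fubini k (csupp_measurable cdu) hC duM).
rewrite (@eq_Rintegral _ _ _ _ _ (fun=> 0)) ?Rintegral_cst ?mul0r //.
move=> y _; pose N := `|M| + 1.
have N0 : 0 < N by rewrite ltr_wpDl.
have big t : N <= `|t| -> M < `|ins k (y, t) : E4|.
  move=> Nt; apply: (@lt_le_trans _ _ N).
    by apply: le_lt_trans (ler_norm M) _; rewrite ltrDl.
  by apply: le_trans Nt _; have := le_coord_norm (ins k (y, t) : E4) k; rewrite ins_i.
rewrite (@Rintegral_support _ (- N) N) => [|t]; last first.
  rewrite -ler_norml -ltNge => /ltW Nt; apply: duM; exact: big.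
have dF (t : R) : is_derive t (1 : R) (fun t : R => u (ins k (y, t)))
    (du k (ins k (y, t))).
  under [X in is_derive _ _ X]eq_fun do rewrite ins_line.
  have [du0 duE _] := Hu (ins k (y, 0) + t *: delta_mx 0 k : E4) I.
  have := is_derive_line du0; rewrite dlin_delta duE.
  by rewrite -ins_line.
have cf : continuous (fun t : R => du k (ins k (y, t))).
  move=> t; apply: (@cat_comp _ t _ _ (fun t => ins k (y, t) : E4) (du k)).
    exact: continuous_ins_t.
  exact: cdu.
have NN : - N < N by rewrite gtrN.
rewrite (Rintegral_FTC2 NN dF cf).
by rewrite !uM ?subrr //; apply: big; rewrite ?normrN; exact: ler_norm.
Qed.

Lemma lebesgue_shift (a : R) (A : set R) : measurable (A : set T1) ->
  leb [set t | A (t + a)] = leb A.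
Proof.
move=> mA; have ms : measurable_fun setT (fun t : T1 => t + a : T1).
  exact: measurable_funD.
pose m := (measure_function_pushforward__canonical__measure_function_Measure
    leb ms).
apply/esym; apply: (@lebesgue_measure_unique R m) => // _ [[x y] _ <-] /=.
rewrite /m /= /pushforward /=.
rewrite (_ : _ @^-1` _ = `]x - a, y - a]%classic); last first.
  by apply/seteqP; split => t /=; rewrite !in_itv /= ltrBlDr lerBrDr.
rewrite !lebesgue_measure_itv /= !lte_fin ltrD2r; case: ifP => // _.
by rewrite -!EFinB; congr (_%:E); ring.
Qed.

(** Translation invariance is checked on boxes, one side at a time, and reaches all Borel sets by
    [measure_unique_rect4]. *)
Lemma vol_shift M (a : E4) h : continuous h -> vanishes_out M h ->
  vol (fun x => h (x + a)) = vol h.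
Proof.
move=> ch hM.
have ms : measurable_fun setT (fun x : borel4 R => (x : E4) + a : borel4 R).
  apply: measurable_fun_borel4 => // k; apply: continuous_measurable_borel4.
  move=> x; under [X in continuous_at _ X]eq_fun do rewrite mxE.
  by apply: catD; [exact: coord_continuous|exact: cat_cst].
pose m : {measure set (borel4 R) -> \bar R} :=
  measure_function_pushforward__canonical__measure_function_Measure (@lam4 R) ms.
have mE A : measurable A -> @lam4 R A = m A.
  apply: measure_unique_rect4 => [B mB|n]; last exact: lam4_cube_lty.
  rewrite /m /= /pushforward /=.
  rewrite (_ : _ @^-1` _ = rect4 (fun k => [set t | B k (t + a 0 k)])).
    rewrite !lam4_rect4 // => [|k].
      by apply: eq_bigr => k _; rewrite lebesgue_shift.
    rewrite (_ : mkset _ = setT `&` (fun t : T1 => t + a 0 k : T1) @^-1` B k).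
      by apply: measurable_funD => //; exact: mB.
    by rewrite setTI.
  apply/seteqP; split => x Bx k; first by have := Bx k; rewrite mxE.
  by have := Bx k; rewrite /= mxE.
rewrite /vol /Rintegral; congr fine.
rewrite [RHS](eq_measure_integral m) => [|A mA _]; last exact: mE.
apply: esym; apply: etrans (@integral_pushforward _ _ (borel4 R) (borel4 R) R _ ms
  (@lam4 R) setT (fun y => (h y)%:E) _ _ _) _ => //.
  by apply/measurable_EFinP; apply: csupp_measurable; exact: ch.
have cs : continuous (fun x : E4 => h (x + a)).
  move=> x; apply: (@cat_comp _ x _ _ (fun x : E4 => x + a) h).
    apply: continuous_rV => k; under [X in continuous_at _ X]eq_fun do rewrite mxE.
    by apply: catD; [exact: coord_continuous|exact: cat_cst].
  exact: ch.
apply: (@csupp_integrable (M + `|a|)) => // x; rewrite -ltrBrDr => xM.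
apply: hM; apply: lt_le_trans xM _.
by rewrite lerBlDr -[X in `|X| <= _](addrK a) -[X in _ <= _ + X]normrN ler_normD.
Qed.

(** Continuity keeps [h] above half of [h x0] on a small open cube around [x0], whose volume is
    positive. *)
Lemma vol_gt0 M h x0 : continuous h -> vanishes_out M h ->
  (forall x, 0 <= h x) -> 0 < h x0 -> 0 < vol h.
Proof.
move=> ch hM h0 hx0; have h20 : 0 < h x0 / 2 by rewrite divr_gt0.
have /cvgrPdist_lt/(_ _ h20)/nbhs_ballP[d /= d0 hd] := ch x0.
pose B (k : 'I_4) : set R := `]x0 0 k - d, x0 0 k + d[%classic.
have mB k : measurable (B k : set T1) by exact: measurable_itv.
have mr := measurable_rect4 mB.
have rE : @lam4 R (rect4 B) = ((d + d) ^+ 4)%:E.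
  rewrite lam4_rect4 //.
  rewrite (eq_bigr (fun=> (d + d)%:E)) => [|k _].
    by rewrite prodEFin prodr_const card_ord.
  rewrite /B lebesgue_measure_itv /= lte_fin ifT; last by lra.
  by rewrite -EFinB; congr (_%:E); ring.
have hB x : h x0 / 2 * \1_(rect4 B) (x : borel4 R) <= h x.
  rewrite indicE; case: (boolP (x \in _)) => /= xB; last by rewrite mulr0.
  have : ball x0 d x.
    rewrite -ball_normE /ball_ /=; apply/(rV_norm_ltP _ d0) => k; rewrite !mxE.
    move: xB; rewrite inE => /(_ k); rewrite /B /= in_itv /= => /andP[k1 k2].
    by rewrite ltr_distlC; apply/andP; split.
  by move=> /hd; rewrite ltr_norml mulr1 => /andP[_]; lra.
have iB : (@lam4 R).-integrable setT
    (EFin \o (fun x : borel4 R => h x0 / 2 * \1_(rect4 B) x)).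
  apply: (@finite_support_integrable _ _ _ _ (rect4 B) (h x0 / 2)) => //.
  - by apply: (@le_lt_trans _ _ (((d + d) ^+ 4)%:E)); rewrite ?ltry // -rE lexx.
  - by apply: measurable_funM => //; exact: measurable_indic.
  - by move=> x; rewrite ger0_norm // mulr_ge0 // ltW.
apply: (@lt_le_trans _ _ (Rintegral (@lam4 R) setT
    (fun x : borel4 R => h x0 / 2 * \1_(rect4 B) x))); last first.
  by apply: le_Rintegral => //; exact: csupp_integrable ch hM.
rewrite RintegralZl //; last first.
  apply: (@finite_support_integrable _ _ _ _ (rect4 B) 1) => //.
  - by apply: (@le_lt_trans _ _ (((d + d) ^+ 4)%:E)); rewrite ?ltry // -rE lexx.
  - by move=> x; rewrite ger0_norm // mul1r.
rewrite mulr_gt0 // /Rintegral integral_indic // setIT.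
rewrite (_ : fine _ = (d + d) ^+ 4); last exact: (congr1 fine rE).
by rewrite exprn_gt0 // addr_gt0.
Qed.

End VolumeIntegral.

(** * Charts of a C^1 hypersurface *)

Section Insertion.
Variable R : realType.
Local Notation E4 := 'rV[R]_4.
Local Notation E3 := 'rV[R]_3.

Definition ptc (i : 'I_4) (y : E3) (t : R) : E4 := graph_pt i (fun=> t) y.
Definition prj (i : 'I_4) (x : E4) : E3 := \row_l x 0 (lift i l).

Lemma ptc_i i y t : ptc i y t 0 i = t.
Proof. by rewrite mxE unlift_none. Qed.

Lemma ptc_lift i y t l : ptc i y t 0 (lift i l) = y 0 l.
Proof. by rewrite mxE liftK. Qed.

Lemma prjK i x : ptc i (prj i x) (x 0 i) = x.
Proof.
apply/rowP => k; have [l ->|->] := unliftP i k; last by rewrite ptc_i.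
by rewrite ptc_lift mxE.
Qed.

Lemma prj_ptc i y t : prj i (ptc i y t) = y.
Proof. by apply/rowP => l; rewrite mxE ptc_lift. Qed.

Lemma ptcB i y t y' t' : ptc i y t - ptc i y' t' = ptc i (y - y') (t - t').
Proof.
apply/rowP => k; have [l ->|->] := unliftP i k.
  by rewrite ptc_lift [LHS]mxE [X in _ + X]mxE !ptc_lift !mxE.
by rewrite ptc_i [LHS]mxE [X in _ + X]mxE !ptc_i.
Qed.

Lemma ptcD i y t y' t' : ptc i y t + ptc i y' t' = ptc i (y + y') (t + t').
Proof.
apply/rowP => k; have [l ->|->] := unliftP i k.
  by rewrite ptc_lift [LHS]mxE !ptc_lift !mxE.
by rewrite ptc_i [LHS]mxE !ptc_i.
Qed.

Lemma ptc_line i y t t' : ptc i y t' = ptc i y t + (t' - t) *: delta_mx 0 i.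
Proof.
apply/rowP => k; have [l ->|->] := unliftP i k.
  by rewrite [RHS]mxE !ptc_lift !mxE eqxx eq_sym (negbTE (neq_lift _ _)) mulr0 addr0.
by rewrite [RHS]mxE !ptc_i !mxE !eqxx mulr1; ring.
Qed.

Lemma ptc_norm_le i y t e : `|y| <= e -> `|t| <= e -> `|ptc i y t| <= e.
Proof.
move=> ye te; have e0 : 0 <= e by apply: le_trans ye.
apply/(rV_norm_leP _ e0) => k; have [l ->|->] := unliftP i k.
  by rewrite ptc_lift; apply: le_trans (le_coord_norm y l) ye.
by rewrite ptc_i.
Qed.

Lemma prj_norm_le i x : `|prj i x| <= `|x|.
Proof. by apply/rV_norm_leP => // l; rewrite mxE; exact: le_coord_norm. Qed.

Lemma prjB i x x' : prj i (x - x') = prj i x - prj i x'.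
Proof. by apply/rowP => l; rewrite !mxE. Qed.

Lemma ptc_norm_le_prj i (z : E4) y t e : `|y - prj i z| <= e -> `|t - z 0 i| <= e ->
  `|ptc i y t - z| <= e.
Proof. by move=> ye te; rewrite -(prjK i z) ptcB; exact: ptc_norm_le. Qed.

Lemma dlin_ptc i (b : 'I_4 -> R) y t :
  dlin b (ptc i y t) = b i * t + dlin (fun l => b (lift i l)) y.
Proof.
rewrite /dlin (bigD1_ord i) //= ptc_i; congr (_ + _).
by apply: eq_bigr => l _; rewrite ptc_lift.
Qed.

Lemma continuous_ptc (T : topologicalType) i (y : T -> E3) (t : T -> R) x :
  continuous_at x y -> continuous_at x t ->
  continuous_at x (fun a => ptc i (y a) (t a)).
Proof.
move=> cy ct; apply: continuous_rV => k; have [l ->|->] := unliftP i k.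
  under [X in continuous_at _ X]eq_fun do rewrite ptc_lift.
  apply: (@cat_comp _ x _ _ y (fun y : E3 => y 0 l)) => //.
  exact: coord_continuous.
by under [X in continuous_at _ X]eq_fun do rewrite ptc_i.
Qed.

Lemma continuous_prj i : continuous (prj i : E4 -> E3).
Proof.
move=> x; apply: continuous_rV => l.
under [X in continuous_at _ X]eq_fun do rewrite mxE.
exact: coord_continuous.
Qed.
End Insertion.

Section Chart.
Variables (R : realType) (rho : 'rV[R]_4 -> R).
Local Notation E4 := 'rV[R]_4.
Local Notation E3 := 'rV[R]_3.
Hypothesis rho_C1 : C1_on setT rho.

(** The ball is convex, so the segment stays where the bound [M] holds; the factor 4 counts
    coordinates, because the norm is the sup norm. *)
Lemma lipschitz_ball (z : E4) (h M : R) :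
  (forall x, `|x - z| <= h -> forall k, `|partial k rho x| <= M) ->
  forall x x', `|x - z| <= h -> `|x' - z| <= h ->
  `|rho x' - rho x| <= 4 * M * `|x' - x|.
Proof.
move=> hM x x' xz x'z.
have [t _|t t01] := @mean_value R 3 rho x (x' - x).
  by have [] := @rho_C1 (x + t *: (x' - x)) I.
rewrite subrKC => ->; apply: dlin_le => k; apply: hM.
have -> : x + t *: (x' - x) - z = (1 - t) *: (x - z) + t *: (x' - z).
  by apply/rowP => l; rewrite !mxE; ring.
move: t01 => /andP[t0 t1]; apply: le_trans (ler_normD _ _) _.
rewrite !normrZ ger0_norm ?subr_ge0 // ger0_norm //.
apply: (@le_trans _ _ ((1 - t) * h + t * h)).
  by apply: lerD; apply: ler_wpM2l => //; rewrite subr_ge0.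
by rewrite -mulrDl subrK mul1r.
Qed.

(* The hypersurface [rho = 0] near [z], seen as a graph over the hyperplane
   orthogonal to the [i]-th axis; [s] is the sign of the [i]-th partial
   derivative of [rho]. *)
Record chart (z : E4) (i : 'I_4) (s c M h r : R) (g : E3 -> R) : Prop := Chart {
  chart_s : s = 1 \/ s = -1;
  chart_c : 0 < c;
  chart_M : 0 < M;
  chart_r : 0 < r;
  chart_rh : r <= h;
  chart_di : forall x, `|x - z| <= h -> c <= s * partial i rho x;
  chart_d : forall x, `|x - z| <= h -> forall k, `|partial k rho x| <= M;
  chart_top : forall y, `|y - prj i z| < r -> 0 < s * rho (ptc i y (z 0 i + h));
  chart_bot : forall y, `|y - prj i z| < r -> s * rho (ptc i y (z 0 i - h)) < 0;
  chart_g : forall y, `|y - prj i z| < r ->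
    `|g y - z 0 i| < h /\ rho (graph_pt i g y) = 0 }.

Section ChartTheory.
Variables (z : E4) (i : 'I_4) (s c M h r : R) (g : E3 -> R).
Hypothesis ch : chart z i s c M h r g.

Lemma chart_mono y t t' : `|y - prj i z| <= h -> `|t - z 0 i| <= h ->
  `|t' - z 0 i| <= h -> t <= t' ->
  c * (t' - t) <= s * (rho (ptc i y t') - rho (ptc i y t)).
Proof.
move=> yr th t'h tt'; have [c0 di] := (chart_c ch, chart_di ch).
have [a a01|a a01] := @mean_value_coord R 3 rho (ptc i y t) i (t' - t).
  by have [] := @rho_C1 (ptc i y t + (a * (t' - t)) *: delta_mx 0 i) I.
rewrite -ptc_line => ->; rewrite mulrCA [leLHS]mulrC.
apply: ler_wpM2l; first by rewrite subr_ge0.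
apply: di.
have -> : ptc i y t + (a * (t' - t)) *: delta_mx 0 i = ptc i y (t + a * (t' - t)).
  by rewrite [RHS](ptc_line _ _ t) [t + _ - t]addrAC subrr add0r.
apply: ptc_norm_le_prj => //.
move: a01 => /andP[a0 a1].
have -> : t + a * (t' - t) - z 0 i = (1 - a) * (t - z 0 i) + a * (t' - z 0 i) by ring.
apply: le_trans (ler_normD _ _) _; rewrite !normrM [`|1 - a|]ger0_norm ?subr_ge0 // [`|a|]ger0_norm //.
apply: (@le_trans _ _ ((1 - a) * h + a * h)).
  by apply: lerD; apply: ler_wpM2l => //; rewrite subr_ge0.
by rewrite -mulrDl subrK mul1r.
Qed.

Lemma chart_dist y t t' : `|y - prj i z| <= h -> `|t - z 0 i| <= h ->
  `|t' - z 0 i| <= h ->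
  c * `|t' - t| <= `|rho (ptc i y t') - rho (ptc i y t)|.
Proof.
move=> yr th t'h; have s1 : `|s| = 1.
  by case: (chart_s ch) => ->; rewrite ?normrN normr1.
have [tt'|/ltW tt'] := leP t t'.
  rewrite ger0_norm ?subr_ge0 //; apply: le_trans (chart_mono yr th t'h tt') _.
  by apply: le_trans (ler_norm _) _; rewrite normrM s1 mul1r.
rewrite distrC ger0_norm ?subr_ge0 // distrC.
apply: le_trans (chart_mono yr t'h th tt') _.
by apply: le_trans (ler_norm _) _; rewrite normrM s1 mul1r.
Qed.

Lemma chart_unique y t : `|y - prj i z| < r -> `|t - z 0 i| <= h ->
  rho (ptc i y t) = 0 -> t = g y.
Proof.
move=> yr th rt; have [gh rg] := chart_g ch yr.
have yh : `|y - prj i z| <= h by apply: le_trans (ltW yr) (chart_rh ch).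
have := chart_dist yh (ltW gh) th; rewrite rt -[ptc i y (g y)]/(graph_pt i g y) rg.
rewrite subrr normr0 pmulr_rle0 ?(chart_c ch) // normr_le0 subr_eq0.
by move=> /eqP.
Qed.

Lemma chart_zero x : `|x - z| < r -> rho x = 0 -> x = graph_pt i g (prj i x).
Proof.
move=> xr rx; have yr : `|prj i x - prj i z| < r.
  by rewrite -prjB; apply: le_lt_trans (prj_norm_le _ _) xr.
rewrite -[RHS]/(ptc i (prj i x) (g (prj i x))) -(chart_unique yr (t := x 0 i)).
- by rewrite prjK.
- have := le_coord_norm (x - z) i; rewrite !mxE => /le_trans; apply.
  exact: le_trans (ltW xr) (chart_rh ch).
- by rewrite prjK.
Qed.

(** Moving the base point at fixed height changes [rho] by at most [4 * M] times the displacement,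
    while [rho] varies vertically at rate at least [c]; the zero cannot move faster than the
    quotient. *)
Lemma chart_lip y y' : `|y - prj i z| < r -> `|y' - prj i z| < r ->
  c * `|g y' - g y| <= 4 * M * `|y' - y|.
Proof.
move=> yr y'r; have [gh rg] := chart_g ch yr; have [g'h rg'] := chart_g ch y'r.
have yh : `|y - prj i z| <= h by apply: le_trans (ltW yr) (chart_rh ch).
have y'h : `|y' - prj i z| <= h by apply: le_trans (ltW y'r) (chart_rh ch).
apply: le_trans (chart_dist yh (ltW gh) (ltW g'h)) _.
have -> : rho (ptc i y (g y)) = rho (ptc i y' (g y')) by exact: etrans rg (esym rg').
rewrite distrC.
apply: le_trans (lipschitz_ball (chart_d ch) (x := ptc i y (g y')) _ _) _.
- exact: ptc_norm_le_prj (ltW g'h).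
- exact: ptc_norm_le_prj (ltW g'h).
rewrite ptcB subrr; apply: ler_wpM2l; first by rewrite mulr_ge0 // ltW // (chart_M ch).
by apply: ptc_norm_le; rewrite ?normr0.
Qed.

Definition chart_dg (l : 'I_3) (y : E3) : R :=
  - (partial (lift i l) rho (graph_pt i g y) / partial i rho (graph_pt i g y)).

Lemma chart_graph_ball y : `|y - prj i z| < r -> `|graph_pt i g y - z| <= h.
Proof.
move=> yr; have [gh _] := chart_g ch yr.
apply: (@ptc_norm_le_prj _ i z y (g y)); last exact: ltW.
exact: le_trans (ltW yr) (chart_rh ch).
Qed.

Lemma chart_di_norm x : `|x - z| <= h -> c <= `|partial i rho x|.
Proof.
move=> /(chart_di ch) H; apply: le_trans H _; apply: le_trans (ler_norm _) _.
by rewrite normrM; case: (chart_s ch) => ->; rewrite ?normrN normr1 mul1r.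
Qed.

Lemma chart_di_neq0 x : `|x - z| <= h -> partial i rho x != 0.
Proof.
by move=> /chart_di_norm H; rewrite -normr_gt0; apply: lt_le_trans H; exact: chart_c ch.
Qed.

(** By [chart_lip] the increment [D] of the graph is of the order of [k]. As [rho] vanishes at both
    ends, its first-order expansion, divided by the vertical derivative, is the expansion of [g]
    with the gradient given by implicit differentiation. *)
Lemma chart_C1d : C1d (ball (prj i z) r) g chart_dg.
Proof.
have bE y : ball (prj i z) r y -> `|y - prj i z| < r.
  by rewrite -ball_normE /ball_ /= distrC.
have [c0 M0] := (chart_c ch, chart_M ch).
have cg y : ball (prj i z) r y -> continuous_at y g.
  move=> yb; apply/continuous_at_eps => e e0.
  have : nbhs y (ball (prj i z) r) by apply: open_nbhs_nbhs; split => //; exact: ball_open.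
  move=> /nbhs_ballP[d /= d0 hd].
  exists (Num.min d (e * c / (4 * M))).
    by rewrite lt_min d0 divr_gt0 ?mulr_gt0.
  move=> k; rewrite lt_min => /andP[kd].
  have /bE ykr : ball (prj i z) r (y + k) by apply: hd; exact: ball_in.
  rewrite ltr_pdivlMr ?mulr_gt0 // => kd'.
  have := chart_lip (bE _ yb) ykr; rewrite [y + k - y]addrAC subrr add0r => H.
  rewrite -(ltr_pM2l c0) [ltRHS]mulrC; apply: le_lt_trans H _.
  by rewrite [4 * M * _]mulrC.
move=> y yb; have yr := bE _ yb; have yB := chart_graph_ball yr.
set p := graph_pt i g y in yB *.
have dip := chart_di_norm yB; have dip0 := chart_di_neq0 yB.
have [drho cdrho] := @rho_C1 p I.
have H : differentiable g y /\ forall l, partial l g y = chart_dg l y.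
  apply: differentiableP_eps => e e0.
  (* [K] bounds the displacement on the graph per unit of [k]; the tolerance [e * c / K] allows for
     it and for the final division by a derivative of size at least [c]. *)
  pose K := 1 + 4 * M / c.
  have K0 : 0 < K by rewrite addr_gt0 // divr_gt0 // mulr_gt0.
  have e10 : 0 < e * c / K by rewrite divr_gt0 // mulr_gt0.
  have [d1 d10 hd1] := differentiable_eps drho e10.
  have : nbhs y (ball (prj i z) r) by apply: open_nbhs_nbhs; split => //; exact: ball_open.
  move=> /nbhs_ballP[d /= d0 hd].
  exists (Num.min d (d1 / K)); first by rewrite lt_min d0 divr_gt0.
  move=> k; rewrite lt_min => /andP[kd kd1].
  have ykr : `|y + k - prj i z| < r by apply: bE; apply: hd; exact: ball_in.
  pose D := g (y + k) - g y.
  have DK : `|D| <= K * `|k|.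
    have := chart_lip yr ykr; rewrite -/D [y + k - y]addrAC subrr add0r.
    move=> H; rewrite /K mulrDl mul1r; apply: (@le_trans _ _ (4 * M / c * `|k|)).
      by rewrite mulrAC ler_pdivlMr // mulrC.
    by rewrite lerDr.
  have kK : `|k| <= K * `|k|.
    by rewrite ler_peMl // /K lerDl ltW // divr_gt0 // mulr_gt0.
  have HK : `|ptc i k D| <= K * `|k| by exact: ptc_norm_le.
  have Hd1 : `|ptc i k D| < d1.
    by apply: le_lt_trans HK _; rewrite mulrC -ltr_pdivlMr.
  have := hd1 _ Hd1; rewrite dlin_ptc.
  have -> : p + ptc i k D = graph_pt i g (y + k).
    rewrite -[p]/(ptc i y (g y)) ptcD /D -[RHS]/(ptc i (y + k) (g (y + k))).
    by congr ptc; rewrite addrC subrK.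
  have [_ ->] := chart_g ch ykr; have [_ ->] := chart_g ch yr.
  rewrite subrr sub0r normrN => H.
  have HH : `|partial i rho p * D + dlin (fun l => partial (lift i l) rho p) k| <=
      e * c * `|k|.
    apply: le_trans H _.
    have -> : e * c * `|k| = e * c / K * (K * `|k|).
      by rewrite [RHS]mulrA divfK // gt_eqF.
    by apply: ler_wpM2l => //; exact: ltW.
  have -> : dlin (chart_dg^~ y) k =
      - (dlin (fun l => partial (lift i l) rho p) k / partial i rho p).
    rewrite /dlin mulr_suml -sumrN; apply: eq_bigr => l _.
    by rewrite /chart_dg -/p mulNr mulrAC.
  rewrite opprK -/D.
  have -> : D + dlin (fun l => partial (lift i l) rho p) k / partial i rho p =
      (partial i rho p * D + dlin (fun l => partial (lift i l) rho p) k) /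
      partial i rho p.
    by rewrite mulrDl mulrAC divff // mul1r.
  rewrite normrM normfV ler_pdivrMr; last by apply: lt_le_trans dip.
  apply: le_trans HH _; rewrite mulrAC; apply: ler_wpM2l => //.
  by rewrite mulr_ge0 // ltW.
have cp : continuous_at y (graph_pt i g).
  by apply: (@continuous_ptc _ _ i id g y); [exact: cvg_id|exact: cg].
split; [exact: H.1|exact: H.2|move=> l].
apply: catN; apply: catM; first exact: (cat_comp cp (cdrho _)).
apply: catV => //; exact: (cat_comp cp (cdrho _)).
Qed.
End ChartTheory.

(** On the vertical line through [z], [s * rho] is at most [- c * h] at the bottom and at least
    [c * h] at the top. A horizontal move shorter than [r] changes [rho] by less than [c * h], so
    both signs persist and the intermediate value theorem yields the height [g y]. *)
Lemma chart_exists (z : E4) i : rho z = 0 -> partial i rho z != 0 ->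
  exists s c M h r g, chart z i s c M h r g.
Proof.
move=> rz diz; pose c := `|partial i rho z| / 2.
have c0 : 0 < c by rewrite divr_gt0 // normr_gt0.
pose s := Num.sg (partial i rho z).
(* The summand 1 absorbs the variation of the partial derivatives on the ball, kept below
   [Num.min c 1]; the bound by [c] keeps the vertical one above half its size at [z]. *)
pose M := \sum_k `|partial k rho z| + 1.
have M0 : 0 < M by rewrite ltr_wpDl // sumr_ge0.
have s1 : s = 1 \/ s = -1.
  by rewrite /s; case: sgrP diz => //; [left|right].
have [drho cdrho] := @rho_C1 z I.
have e0 : 0 < Num.min c 1 by rewrite lt_min c0 ltr01.
have : \forall x \near z, forall k, `|partial k rho z - partial k rho x| < Num.min c 1.
  by apply: near_forall => k; have /cvgrPdist_lt := cdrho k; exact.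
move=> /nbhs_ballP[h0 /= h00 hh0].
pose h := h0 / 2; have h_gt0 : 0 < h by rewrite divr_gt0.
have inB x : `|x - z| <= h -> forall k, `|partial k rho z - partial k rho x| < Num.min c 1.
  move=> xz; apply: hh0; rewrite -ball_normE /ball_ /= distrC.
  by apply: le_lt_trans xz _; rewrite /h ltr_pdivrMr // ltr_pMr // ltr1n.
have di x : `|x - z| <= h -> c <= s * partial i rho x.
  move=> /inB/(_ i); rewrite lt_min => /andP[H _].
  have E : s * partial i rho z = c + c.
    by rewrite /s /c -splitr -normrEsg.
  have : s * (partial i rho z - partial i rho x) <= c.
    apply: le_trans (ler_norm _) _; rewrite normrM.
    by apply: ltW; case: s1 => ->; rewrite ?normrN normr1 mul1r.
  by rewrite mulrBr E; lra.
have dk x : `|x - z| <= h -> forall k, `|partial k rho x| <= M.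
  move=> /inB H k; have := H k; rewrite lt_min => /andP[_ Hk].
  have -> : partial k rho x = partial k rho z - (partial k rho z - partial k rho x) by ring.
  apply: le_trans (ler_normB _ _) _; apply: lerD; last exact: ltW.
  by rewrite (bigD1 k) //= lerDl sumr_ge0.
pose r := Num.min h (c * h / (4 * M)).
have r0 : 0 < r.
  by rewrite lt_min h_gt0; apply: divr_gt0; apply: mulr_gt0.
have rh : r <= h by rewrite ge_min lexx.
have zz : ptc i (prj i z) (z 0 i) = z by exact: prjK.
have sg_le (a : R) : s * a <= `|a|.
  apply: le_trans (ler_norm _) _; rewrite normrM.
  by case: s1 => ->; rewrite ?normrN normr1 mul1r.
have mono (t t' : R) : `|t - z 0 i| <= h -> `|t' - z 0 i| <= h -> t <= t' ->
    c * (t' - t) <= s * (rho (ptc i (prj i z) t') - rho (ptc i (prj i z) t)).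
  move=> th t'h tt'.
  have [a a01|a a01] := @mean_value_coord R 3 rho (ptc i (prj i z) t) i (t' - t).
    by have [] := @rho_C1 (ptc i (prj i z) t + (a * (t' - t)) *: delta_mx 0 i) I.
  rewrite -ptc_line => ->; rewrite mulrCA [leLHS]mulrC.
  apply: ler_wpM2l; first by rewrite subr_ge0.
  apply: di.
  have -> : ptc i (prj i z) t + (a * (t' - t)) *: delta_mx 0 i =
      ptc i (prj i z) (t + a * (t' - t)).
    by rewrite [RHS](ptc_line _ _ t) [t + _ - t]addrAC subrr add0r.
  apply: ptc_norm_le_prj; first by rewrite subrr normr0 ltW.
  move: a01 => /andP[a0 a1].
  have -> : t + a * (t' - t) - z 0 i = (1 - a) * (t - z 0 i) + a * (t' - z 0 i) by ring.
  apply: le_trans (ler_normD _ _) _; rewrite !normrM [`|1 - a|]ger0_norm ?subr_ge0 // [`|a|]ger0_norm //.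
  apply: (@le_trans _ _ ((1 - a) * h + a * h)).
    by apply: lerD; apply: ler_wpM2l => //; rewrite subr_ge0.
  by rewrite -mulrDl subrK mul1r.
have move_y y (t : R) : `|y - prj i z| < r -> `|t - z 0 i| <= h ->
    `|rho (ptc i y t) - rho (ptc i (prj i z) t)| < c * h.
  move=> yr th; apply: le_lt_trans (lipschitz_ball dk _ _) _.
  - by apply: ptc_norm_le_prj th; rewrite subrr normr0 ltW.
  - by apply: ptc_norm_le_prj th; apply: le_trans (ltW yr) rh.
  rewrite ptcB subrr; apply: (@le_lt_trans _ _ (4 * M * `|y - prj i z|)).
    by apply: ler_wpM2l; rewrite ?mulr_ge0 ?(ltW M0) //; apply: ptc_norm_le; rewrite ?normr0.
  rewrite mulrC -ltr_pdivlMr ?mulr_gt0 //; apply: lt_le_trans yr _.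
  by rewrite ge_min lexx orbT.
have hh : `|h| <= h by rewrite ger0_norm // ltW.
have zph : `|z 0 i + h - z 0 i| <= h by rewrite addrAC subrr add0r.
have zmh : `|z 0 i - h - z 0 i| <= h by rewrite addrAC subrr add0r normrN.
have zh : `|z 0 i - z 0 i| <= h by rewrite subrr normr0 ltW.
have top y : `|y - prj i z| < r -> 0 < s * rho (ptc i y (z 0 i + h)).
  move=> yr; have H1 := mono _ _ zh zph; rewrite zz rz subr0 [_ + h - _]addrAC subrr add0r lerDl in H1.
  have := H1 (ltW h_gt0).
  have := sg_le (rho (ptc i (prj i z) (z 0 i + h)) - rho (ptc i y (z 0 i + h))).
  by have := move_y y _ yr zph; rewrite distrC mulrBr; lra.
have bot y : `|y - prj i z| < r -> s * rho (ptc i y (z 0 i - h)) < 0.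
  move=> yr; have : c * h <= s * (0 - rho (ptc i (prj i z) (z 0 i - h))).
    have := mono _ _ zmh zh; rewrite zz rz (_ : z 0 i - (z 0 i - h) = h); last by ring.
    by apply; rewrite gerBl ltW.
  have := sg_le (rho (ptc i y (z 0 i - h)) - rho (ptc i (prj i z) (z 0 i - h))).
  by have := move_y y _ yr zmh; rewrite !mulrBr mulr0; lra.
have /choice[g hg] : forall y, exists t : R, `|y - prj i z| < r ->
    `|t - z 0 i| < h /\ rho (ptc i y t) = 0.
  move=> y; case: (pselect (`|y - prj i z| < r)) => [yr|nyr]; last by exists 0.
  have cr : continuous (fun t : R => s * rho (ptc i y t)).
    move=> t; apply: catM; first exact: cat_cst.
    apply: (@cat_comp _ t _ _ (fun t : R => ptc i y t) rho).
      by apply: (@continuous_ptc _ _ i (fun=> y) id); [exact: cat_cst|exact: cvg_id].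
    by apply: differentiable_continuous; have [] := @rho_C1 (ptc i y t) I.
  have ab : z 0 i - h <= z 0 i + h by lra.
  have [|t tin rt] := @IVT R (fun t : R => s * rho (ptc i y t)) _ _ 0 ab
      (continuous_subspaceT cr).
    by rewrite ge_min le_max (ltW (bot _ yr)) (ltW (top _ yr)) orbT.
  exists t => _; split; last first.
    by move/eqP: rt; rewrite mulf_eq0; case: s1 => ->; rewrite ?oppr_eq0 oner_eq0 => /eqP.
  move: tin; rewrite in_itv /= !le_eqVlt => /andP[/orP[/eqP e1|lt1] /orP[/eqP e2|lt2]].
  - by have := bot _ yr; rewrite e1 rt ltxx.
  - by have := bot _ yr; rewrite e1 rt ltxx.
  - by have := top _ yr; rewrite -e2 rt ltxx.
  - by rewrite ltr_distl lt1 lt2.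
exists s, c, M, h, r, g; split => // y yr; exact: hg.
Qed.
End Chart.

(** * Surface measure in charts *)

Section DensityTransfer.
Local Open Scope ereal_scope.
Context d1 d2 (X : measurableType d1) (Y : measurableType d2) (R : realType).
Variables (mu : {measure set X -> \bar R}) (nu : {measure set Y -> \bar R}).
Variables (V : set X) (G : set Y) (phi : X -> Y) (J : X -> R).
Hypotheses (mV : measurable V) (mG : measurable G).
Hypotheses (mphi : measurable_fun V phi) (mJ : measurable_fun V J).
Hypothesis J0 : forall x, (0 <= J x)%R.
Hypothesis nuE : forall A, measurable A ->
  nu (A `&` G) = \int[mu]_(x in V `&` phi @^-1` A) (J x)%:E.

Import HBNNSimple.

(** The identity on sets extends to simple functions by additivity, then to nonnegative functions by
    monotone convergence on both sides. *)
Lemma ge0_integral_density_transfer (f : Y -> R) :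
  measurable_fun setT f -> (forall y, (0 <= f y)%R) ->
  \int[nu]_(y in G) (f y)%:E = \int[mu]_(x in V) (f (phi x) * J x)%:E.
Proof.
move=> mf f0; have mf' : measurable_fun setT (EFin \o f) by exact/measurable_EFinP.
pose f_ := nnsfun_approx measurableT mf'.
have f_cvg y : (EFin \o (f_^~ y)) n @[n --> \oo] --> (f y)%:E.
  by apply: (cvg_nnsfun_approx measurableT mf') => //; move=> z _; rewrite lee_fin.
have f_nd y : {homo (fun n => f_ n y) : m n / (m <= n)%N >-> (m <= n)%R}.
  by move=> m n mn; exact/lefP/nd_nnsfun_approx.
transitivity (limn (fun n => \int[nu]_(y in G) (f_ n y)%:E)).
  rewrite -monotone_convergence//.
  - by apply: eq_integral => y _; apply/esym/cvg_lim => //; exact: f_cvg.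
  - move=> n; apply/measurable_EFinP; exact: measurable_funTS.
  - by move=> n y _; rewrite lee_fin.
  - by move=> y _ m n mn; rewrite lee_fin; exact: f_nd.
have mfn n : measurable_fun V (fun x => f_ n (phi x)).
  by apply: (@measurable_comp _ _ _ _ _ _ setT).
transitivity (limn (fun n => \int[mu]_(x in V) (f_ n (phi x) * J x)%:E)); last first.
  rewrite -monotone_convergence//.
  - apply: eq_integral => x _; apply/cvg_lim => //.
    under eq_fun do rewrite EFinM.
    by rewrite EFinM; apply: cvgeZr => //; exact: f_cvg.
  - by move=> n; apply/measurable_EFinP; exact: measurable_funM.
  - by move=> n x _; rewrite lee_fin mulr_ge0.
  - by move=> x _ m n mn; rewrite lee_fin ler_wpM2r //; exact: f_nd.
congr (limn _); apply/funext => n.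
have mfk r : measurable (f_ n @^-1` [set r]) by exact: measurable_sfunP.
transitivity (\sum_(k \in range (f_ n)) \int[nu]_(y in G)
    (k * \1_(f_ n @^-1` [set k]) y)%:E).
  under eq_integral do rewrite fimfunE -fsumEFin//.
  rewrite ge0_integral_fsum//.
  - by move=> r; apply/measurable_EFinP/measurable_funM => //; exact: measurable_indic.
  - by move=> r y _; rewrite nnfun_muleindic_ge0.
transitivity (\sum_(k \in range (f_ n)) \int[mu]_(x in V)
    (k * (\1_(f_ n @^-1` [set k]) (phi x) * J x))%:E); last first.
  rewrite -ge0_integral_fsum//.
  - apply: eq_integral => x _; rewrite fsumEFin//; congr (_%:E).
    rewrite [in RHS]fimfunE mulrC mulr_fsumr//; apply: eq_fsbigr => r _.
    by rewrite mulrA mulrC.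
  - move=> r; apply/measurable_EFinP/measurable_funM => //.
    apply: measurable_funM => //.
    by apply: (@measurable_comp _ _ _ _ _ _ setT) => //; exact: measurable_indic.
  - move=> r x _; have := nnfun_muleindic_ge0 (f_ n) r (phi x).
    by rewrite -EFinM !lee_fin mulrA => H; rewrite mulr_ge0.
apply: eq_fsbigr => k _.
(* A negative value is never taken by the approximant: its level set is empty and both integrals
   vanish. *)
have [k0|k0] := ltP k 0%R.
  rewrite !integral0_eq // => x _; have := preimage_nnfun0 (f_ n) k0 => ->.
    by rewrite indic0 mul0r mulr0.
  by rewrite indic0 mulr0.
under eq_integral do rewrite EFinM.
rewrite ge0_integralZl//; last by apply/measurable_EFinP; exact: measurable_indic.
under [RHS]eq_integral do rewrite EFinM.
rewrite ge0_integralZl//; last 2 first.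
- apply/measurable_EFinP/measurable_funM => //.
  by apply: (@measurable_comp _ _ _ _ _ _ setT) => //; exact: measurable_indic.
- by move=> x _; rewrite lee_fin mulr_ge0.
congr (_ * _); rewrite integral_indic // nuE // [LHS]integral_mkcond [RHS]integral_mkcond.
apply: eq_integral => x _; rewrite /patch /= in_setI.
case: (x \in V) => //=; rewrite indicE.
have -> : (x \in phi @^-1` (f_ n @^-1` [set k])) = (phi x \in f_ n @^-1` [set k]).
  by apply/idP/idP; rewrite !in_setE.
by case: (_ \in _); rewrite ?mul1r ?mul0r.
Qed.

End DensityTransfer.

Section Rintegral_density.
Context d1 d2 (X : measurableType d1) (Y : measurableType d2) (R : realType).
Variables (mu : {measure set X -> \bar R}) (nu : {measure set Y -> \bar R}).
Variables (V : set X) (G : set Y) (phi : X -> Y) (J : X -> R) (B : R).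
Hypotheses (mV : measurable V) (mG : measurable G).
Hypotheses (mphi : measurable_fun V phi) (mJ : measurable_fun V J).
Hypothesis J0 : forall x, 0 <= J x.
Hypothesis JB : forall x, V x -> J x <= B.
Hypothesis muV : (mu V < +oo)%E.
Hypothesis phiG : forall x, V x -> G (phi x).
Hypothesis nuE : forall A, measurable A ->
  nu (A `&` G) = (\int[mu]_(x in V `&` phi @^-1` A) (J x)%:E)%E.

Lemma bounded_integrable d (T : measurableType d) (m : {measure set T -> \bar R})
    (D : set T) (f : T -> R) (C : R) : measurable D -> (m D < +oo)%E ->
  measurable_fun D f -> (forall x, D x -> `|f x| <= C) ->
  m.-integrable D (EFin \o f).
Proof.
move=> mD mDoo mf fC; apply: measurable_bounded_integrable => //.
exists C; split; first exact: num_real.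
by move=> M CM x Dx; apply: le_trans (fC x Dx) (ltW CM).
Qed.

Lemma density_finite : (nu G < +oo)%E.
Proof.
rewrite -(setTI G) nuE // preimage_setT setIT.
apply: le_lt_trans (_ : (B%:E * mu V < +oo)%E).
  rewrite -integral_cst //; apply: ge0_le_integral => //.
  - by move=> x _; rewrite lee_fin.
  - exact/measurable_EFinP.
have : (mu V \is a fin_num)%E by rewrite ge0_fin_numE.
by move=> /fineK <-; rewrite -EFinM ltry.
Qed.

(** Adding the absolute value of [C] makes [f] nonnegative; both measures are finite here, so the
    constant can be subtracted again. *)
Lemma Rintegral_density_transfer (f : Y -> R) (C : R) :
  measurable_fun G f -> (forall y, G y -> `|f y| <= C) ->
  Rintegral nu G f = Rintegral mu V (fun x => f (phi x) * J x).
Proof.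
move=> mf fC; pose f1 y := (f \_ G) y + `|C|.
have mfG : measurable_fun setT (f \_ G) by apply/measurable_restrict => //; rewrite setTI.
have f10 y : 0 <= f1 y.
  rewrite /f1 /patch; case: ifPn => [|_]; last by rewrite add0r.
  rewrite inE => /fC; rewrite ler_norml => /andP[H _].
  by have := ler_norm C; lra.
have mf1 : measurable_fun setT f1 by apply: measurable_funD.
have nuG := density_finite.
have ifG : nu.-integrable G (EFin \o f) by exact: (bounded_integrable mG nuG mf fC).
have iC : nu.-integrable G (EFin \o (fun=> `|C|)).
  by apply: (@bounded_integrable _ _ _ _ _ `|C|) => // y _; rewrite normr_id.
have mcomp (h : Y -> R) : measurable_fun setT h -> measurable_fun V (fun x => h (phi x) * J x).
  move=> mh; apply: measurable_funM => //.
  by apply: (@measurable_comp _ _ _ _ _ _ setT).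
have ib (h : Y -> R) D : measurable_fun setT h -> (forall y, G y -> `|h y| <= D) ->
    mu.-integrable V (EFin \o (fun x => h (phi x) * J x)).
  move=> mh hD; apply: (@bounded_integrable _ _ _ _ _ (D * B)) => //.
    exact: mcomp.
  move=> x Vx; rewrite normrM [`|J x|]ger0_norm //; apply: ler_pM => //.
    by apply: hD; exact: phiG.
  exact: JB.
have f1D y : G y -> f1 y = f y + `|C|.
  by move=> Gy; rewrite /f1 /patch mem_set.
have -> : Rintegral nu G f = Rintegral nu G f1 - Rintegral nu G (fun=> `|C|).
  rewrite -RintegralB //; last first.
    apply: (@bounded_integrable _ _ _ _ _ (C + `|C|)) => // [|y Gy].
      exact: measurable_funTS.
    by rewrite -/(f1 y) f1D //; apply: le_trans (ler_normD _ _) _; rewrite normr_id lerD2r fC.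
  by apply: eq_Rintegral => y; rewrite inE => Gy; rewrite -/(f1 y) f1D // addrK.
have -> : Rintegral mu V (fun x => f (phi x) * J x) =
   Rintegral mu V (fun x => f1 (phi x) * J x) - Rintegral mu V (fun x => `|C| * J x).
  rewrite -RintegralB //.
  - apply: eq_Rintegral => x; rewrite inE => Vx; rewrite -/(f1 (phi x)) f1D; last exact: phiG.
    by rewrite -mulrBl addrK.
  - apply: (@ib f1 (C + `|C|)) => // y Gy.
    by rewrite f1D //; apply: le_trans (ler_normD _ _) _; rewrite normr_id lerD2r fC.
  - by apply: (@ib (fun=> `|C|) `|C|) => // y Gy; rewrite normr_id.
congr (_ - _); rewrite /Rintegral; congr fine.
  exact: (ge0_integral_density_transfer mV mG mphi mJ J0 nuE).
exact: (@ge0_integral_density_transfer _ _ _ _ _ _ _ _ _ _ _ mV mG mphi mJ J0 nuE (fun=> `|C|)).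
Qed.
End Rintegral_density.

Section MeasurableCompositions.
Variable R : realType.

Lemma measurable_comp_open_continuous d (T : measurableType d) n
    (v : T -> 'rV[R]_n) (U : set 'rV[R]_n) (u : 'rV[R]_n -> R) :
  (forall k, measurable_fun setT (fun t => v t 0 k)) -> open U ->
  (forall y, U y -> continuous_at y u) ->
  measurable_fun (v @^-1` U) (fun t => u (v t)).
Proof.
move=> mv oU cu; apply: (measurability _ (RGenOpens.measurableE R)).
move=> _ [_ [a [b ->]] <-].
have oW : open (U `&` u @^-1` `]a, b[%classic).
  rewrite openE => y [Uy uy]; apply: filterI; first exact: open_nbhs_nbhs.
  by apply: cu => //; apply: open_nbhs_nbhs; split => //; exact: interval_open.
by have := measurable_comp_rV measurableT mv oW; rewrite setTI.
Qed.
End MeasurableCompositions.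

(** * The boundary of the domain and the surface measure of a chart *)

Section Boundary.
Variables (R : realType) (rho : 'rV[R]_4 -> R) (Omega : set 'rV[R]_4).
Local Notation E4 := 'rV[R]_4.
Local Notation E3 := 'rV[R]_3.
Hypothesis rho_C1 : C1_on setT rho.
Hypothesis OmegaE : Omega = [set q | rho q < 0].
Hypothesis Omega_open : open Omega.
Hypothesis Omega_bounded : bounded_set Omega.

Lemma rho_continuous : continuous rho.
Proof. by move=> x; have [dx _] := rho_C1 (x := x) I; exact: differentiable_continuous. Qed.

Lemma partial_rho_continuous k : continuous (partial k rho).
Proof. by move=> x; have [_] := rho_C1 (x := x) I; exact. Qed.

Lemma rho_closure_le0 x : closure Omega x -> rho x <= 0.
Proof.
have cl : closed [set x : E4 | rho x <= 0].
  have := @closed_comp _ _ rho [set t : R | t <= 0].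
  by apply; [move=> y _; exact: rho_continuous|exact: closed_le].
move=> xO; have : closure [set x : E4 | rho x <= 0] x.
  by apply: closureS xO; rewrite OmegaE => y /= /ltW.
by rewrite -(closure_id _).1.
Qed.

Lemma bdryE : bdry Omega = closure Omega `\` Omega.
Proof. by rewrite /bdry (_ : interior Omega = Omega) //; exact/interior_id. Qed.

Lemma bdryP x : bdry Omega x <-> closure Omega x /\ rho x = 0.
Proof.
rewrite bdryE; split => [[xO nxO]|[xO rx]]; split => //.
  apply/eqP; rewrite eq_le rho_closure_le0 //= leNgt; apply/negP => rx.
  by apply: nxO; rewrite OmegaE.
by rewrite OmegaE /= rx ltxx.
Qed.

Lemma closure_cases x : closure Omega x -> Omega x \/ bdry Omega x.
Proof.
move=> xO; case: (pselect (Omega x)) => Ox; [by left|right].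
by rewrite bdryE.
Qed.

Lemma bdry_closed : closed (bdry Omega).
Proof.
rewrite /bdry setDE; apply: closedI; first exact: closed_closure.
exact/open_closedC/open_interior.
Qed.

Lemma closure_bounded : bounded_set (closure Omega).
Proof.
have [M [Mr hM]] := Omega_bounded; exists M; split => // e Me x xO.
have cl : closed [set x : E4 | `|x| <= e].
  have := @closed_comp _ _ (fun x : E4 => `|x|) [set t : R | t <= e].
  by apply; [move=> y _; exact: norm_continuous|exact: closed_le].
have : closure [set x : E4 | `|x| <= e] x.
  by apply: closureS xO => y /= /hM; apply.
by rewrite -(closure_id _).1.
Qed.

Lemma closure_compact : compact (closure Omega).
Proof. exact: bounded_closed_compact closure_bounded (@closed_closure _ _). Qed.

Lemma bdry_compact : compact (bdry Omega).
Proof.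
apply: subclosed_compact bdry_closed closure_compact _.
by move=> x [].
Qed.

(** The sign [s] makes [- s] the vertical direction that points into the domain; [rho] then
    decreases at rate at least [c]. *)
Lemma chart_below z i s c M h r g y t : chart rho z i s c M h r g ->
  `|y - prj i z| < r -> 0 < t -> `|g y - s * t - z 0 i| <= h ->
  rho (ptc i y (g y - s * t)) <= - (c * t).
Proof.
move=> ch yr t0 th; have [gh rg] := chart_g ch yr.
have yh : `|y - prj i z| <= h by apply: le_trans (ltW yr) (chart_rh ch).
have rg' : rho (ptc i y (g y)) = 0 by exact: rg.
have mono := chart_mono rho_C1 ch yh; move: mono th.
case: (chart_s ch) => -> mono th.
  have := mono _ _ th (ltW gh); rewrite rg' !mul1r gerBl (ltW t0).
  by rewrite (_ : g y - (g y - t) = t) => [/(_ isT)|]; [lra|ring].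
have := mono _ _ (ltW gh) th; rewrite rg' mulN1r opprK lerDl (ltW t0).
by rewrite [g y + t - _]addrAC subrr add0r => /(_ isT); lra.
Qed.

(** Vanishing of [rho] alone does not put a point in the closure; [chart_below] provides points of
    the domain on the same vertical line, as close as wanted. *)
Lemma chart_bdry z i s c M h r g y : chart rho z i s c M h r g ->
  `|y - prj i z| < r -> bdry Omega (graph_pt i g y).
Proof.
move=> ch yr; have [gh rg] := chart_g ch yr.
apply/bdryP; split => // B /nbhs_ballP[d /= d0 hd].
(* The first bound keeps the new point in the given neighbourhood, the second keeps it in the height
   range of the chart. *)
pose t := Num.min (d / 2) (h - `|g y - z 0 i|).
have t0 : 0 < t by rewrite lt_min divr_gt0 //= subr_gt0.
have s1 : `|s| = 1 by case: (chart_s ch) => ->; rewrite ?normrN normr1.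
have nst : `|s * t| = t by rewrite normrM s1 mul1r ger0_norm // ltW.
exists (ptc i y (g y - s * t)); split.
  rewrite OmegaE /=; apply: (@le_lt_trans _ _ (- (c * t))).
    apply: (chart_below ch yr t0).
    rewrite addrAC; apply: le_trans (ler_normB _ _) _; rewrite nst -lerBrDl.
    by rewrite /t ge_min lexx orbT.
  by rewrite oppr_lt0 mulr_gt0 // (chart_c ch).
apply: hd; rewrite -ball_normE /ball_ /=.
rewrite -[graph_pt i g y]/(ptc i y (g y)) ptcB subrr opprB addrCA subrr addr0.
apply: (@le_lt_trans _ _ t); first by apply: ptc_norm_le; rewrite ?nst // normr0 ltW.
by apply: (@le_lt_trans _ _ (d / 2)); [rewrite /t ge_min lexx|lra].
Qed.

Definition gradnorm x := Num.sqrt (\sum_k (partial k rho x) ^+ 2).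

Lemma gradnorm_continuous : continuous gradnorm.
Proof.
move=> x; apply: (@cat_comp _ x _ _ (fun x => \sum_k (partial k rho x) ^+ 2) Num.sqrt).
  apply: cat_sum => k; apply: catX; exact: partial_rho_continuous.
exact: sqrt_continuous.
Qed.

Lemma gradnorm_ge k x : `|partial k rho x| <= gradnorm x.
Proof.
rewrite /gradnorm -sqrtr_sqr ler_sqrt; last by apply: sumr_ge0 => l _; exact: sqr_ge0.
by rewrite (bigD1 k) //= lerDl; apply: sumr_ge0 => l _; exact: sqr_ge0.
Qed.

Lemma gradnorm_le M x : (forall k, `|partial k rho x| <= M) -> gradnorm x <= 2 * M.
Proof.
move=> hM; have M0 : 0 <= M by apply: le_trans (hM 0).
rewrite -[leRHS]ger0_norm; last by rewrite mulr_ge0.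
rewrite -sqrtr_sqr ler_sqrt ?sqr_ge0 //.
have -> : (2 * M) ^+ 2 = \sum_(k < 4) M ^+ 2.
  by rewrite sumr_const card_ord -mulr_natl; ring.
apply: ler_sum => k _; rewrite -[leLHS]real_normK ?num_real //.
by rewrite lerXn2r ?nnegrE //.
Qed.

Variable sigma : {measure set (borel4 R) -> \bar R}.
Hypothesis sigma_surface : is_surface_measure (bdry Omega) sigma.
Local Notation T1 := (measurableTypeR R).
Local Notation T3 := (T1 * T1 * T1)%type.
Local Notation leb3 := (@lebesgue3 R).

Section ChartMeasure.
Variables (z : E4) (i : 'I_4) (s c M h r : R) (g : E3 -> R).
Hypothesis ch : chart rho z i s c M h r g.

Definition chart_base : set T3 := @vec3 R @^-1` ball (prj i z) r.
Definition chart_graph : set (borel4 R) := graph_pt i g @` ball (prj i z) r.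
(** The area element of the graph written through [rho]; its numerator cancels the division by
    [gradnorm] in the surface integrals. *)
Definition chart_J (y : T3) : R :=
  gradnorm (graph_pt i g (vec3 y)) / `|partial i rho (graph_pt i g (vec3 y))|.

Lemma chart_baseP y : ball (prj i z) r y <-> `|y - prj i z| < r.
Proof. by rewrite -ball_normE /ball_ /= distrC. Qed.

Lemma chart_base_box : chart_base =
  `](prj i z 0 0 - r), (prj i z 0 0 + r)[%classic `*`
  `](prj i z 0 1 - r), (prj i z 0 1 + r)[%classic `*`
  `](prj i z 0 2 - r), (prj i z 0 2 + r)[%classic.
Proof.
apply/seteqP; split => [[[a b] d] /= /chart_baseP/(rV_norm_ltP _ (chart_r ch)) H|].
  have := H 0; have := H 1; have := H 2.
  by rewrite !mxE /= !in_itv /= !ltr_distl => -> -> ->.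
move=> [[a b] d] /=; rewrite !in_itv /= -!ltr_distl => -[[Ha Hb] Hd].
apply/chart_baseP/(rV_norm_ltP _ (chart_r ch)); apply: ord3P.
- by move: Ha; rewrite !mxE.
- by move: Hb; rewrite !mxE.
- by move: Hd; rewrite !mxE.
Qed.

Lemma measurable_chart_base : measurable chart_base.
Proof.
by rewrite chart_base_box; apply: measurableX; [apply: measurableX|]; exact: measurable_itv.
Qed.

Lemma chart_base_lty : (leb3 chart_base < +oo)%E.
Proof.
have r0 := chart_r ch.
have E (a : R) : @lebesgue_measure R `](a - r), (a + r)[%classic = (r + r)%:E.
  rewrite lebesgue_measure_itv /= lte_fin ifT; last by lra.
  by rewrite -EFinB; congr (_%:E); ring.
by rewrite chart_base_box lebesgue3E ?E -?EFinM ?ltry //; exact: measurable_itv.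
Qed.

Lemma measurable_chart_comp (u : E3 -> R) :
  (forall y, `|y - prj i z| < r -> continuous_at y u) ->
  measurable_fun chart_base (fun y => u (vec3 y)).
Proof.
move=> cu; apply: measurable_comp_open_continuous => [k||y /chart_baseP]; last exact: cu.
  exact: measurable_vec3.
exact: ball_open.
Qed.

Lemma chart_g_continuous y : `|y - prj i z| < r -> continuous_at y g.
Proof. by move=> /chart_baseP yr; exact: C1d_continuous (chart_C1d rho_C1 ch) yr. Qed.

Lemma chart_graph_continuous y : `|y - prj i z| < r -> continuous_at y (graph_pt i g).
Proof.
move=> yr; apply: (@continuous_ptc _ _ i id g y); first exact: cvg_id.
exact: chart_g_continuous.
Qed.

Lemma measurable_graph_pt : measurable_fun chart_base
  (fun y : T3 => graph_pt i g (vec3 y) : borel4 R).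
Proof.
apply: measurable_fun_borel4 => [|k]; first exact: measurable_chart_base.
have [l ->|->] := unliftP i k.
  rewrite (_ : (fun t => _) = fun y => vec3 y 0 l); last first.
    by apply/funext => y; exact: (ptc_lift i (vec3 y) (g (vec3 y)) l).
  apply: measurable_funTS; exact: measurable_vec3.
rewrite (_ : (fun t => _) = fun y => g (vec3 y)); last first.
  by apply/funext => y; exact: (ptc_i i (vec3 y) (g (vec3 y))).
by apply: measurable_chart_comp => y; exact: chart_g_continuous.
Qed.

Lemma measurable_chart_J : measurable_fun chart_base chart_J.
Proof.
apply: (measurable_chart_comp (u := fun y =>
  gradnorm (graph_pt i g y) / `|partial i rho (graph_pt i g y)|)) => y yr.
have cgr := chart_graph_continuous yr.
apply: catM.
  by apply: (cat_comp (k := gradnorm)) => //; exact: gradnorm_continuous.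
apply: catV; first by rewrite normr_eq0; exact: (chart_di_neq0 ch (chart_graph_ball ch yr)).
apply: cat_norm; apply: (cat_comp (k := partial i rho)) => //.
exact: partial_rho_continuous.
Qed.

Lemma chart_J_ge0 y : 0 <= chart_J y.
Proof. by rewrite divr_ge0 // sqrtr_ge0. Qed.

Lemma chart_J_le y : chart_base y -> chart_J y <= 2 * M / c.
Proof.
move=> /chart_baseP yr; have yB := chart_graph_ball ch yr.
have dip := chart_di_norm ch yB; have c0 := chart_c ch.
rewrite /chart_J; apply: ler_pM; rewrite ?sqrtr_ge0 ?invr_ge0 //.
  exact: gradnorm_le (chart_d ch yB).
by rewrite lef_pV2 // posrE; apply: lt_le_trans dip.
Qed.

(** After division by the squared vertical derivative, the vertical term of the squared gradient of
    [rho] gives the 1 and the other three give the squares of [chart_dg]. *)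
Lemma chart_JE y : chart_base y ->
  Num.sqrt (1 + \sum_l (partial l g (vec3 y)) ^+ 2) = chart_J y.
Proof.
move=> yb; have /chart_baseP yr := yb; have yB := chart_graph_ball ch yr.
have di0 := chart_di_neq0 ch yB; rewrite /chart_J /gradnorm.
have [_ dE _] := chart_C1d rho_C1 ch yb.
set p := graph_pt i g (vec3 y) in yB di0 *.
have -> : 1 + \sum_l (partial l g (vec3 y)) ^+ 2 =
    (\sum_k (partial k rho p) ^+ 2) / (partial i rho p) ^+ 2.
  rewrite (bigD1_ord i) //= mulrDl divff ?expf_neq0 //; congr (_ + _).
  rewrite mulr_suml; apply: eq_bigr => l _; rewrite dE /chart_dg -/p sqrrN.
  by rewrite expr_div_n.
rewrite sqrtrM; last by apply: sumr_ge0 => k _; exact: sqr_ge0.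
by rewrite sqrtrV ?sqr_ge0 // sqrtr_sqr.
Qed.

(** Inside the open cylinder over the base, the complement of the graph is open by continuity of
    [g]; the graph is thus a difference of two open sets. *)
Lemma measurable_chart_graph : measurable chart_graph.
Proof.
have -> : chart_graph = (prj i @^-1` ball (prj i z) r) `&`
    [set x : E4 | `|x 0 i - g (prj i x)| <= 0].
  apply/seteqP; split => [_ [y yb <-]|x [xb /=]].
    have -> : graph_pt i g y = ptc i y (g y) by [].
    by split; rewrite /= prj_ptc ?ptc_i ?subrr ?normr0.
  rewrite normr_le0 subr_eq0 => /eqP xE; exists (prj i x) => //.
  by rewrite -[RHS](prjK i x) xE.
have o1 : open (prj i @^-1` ball (prj i z) r : set E4).
  by apply: open_comp; [move=> x _; exact: continuous_prj|exact: ball_open].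
have cgp x : ball (prj i z) r (prj i x) ->
    continuous_at x (fun x : E4 => `|x 0 i - g (prj i x)|).
  move=> /chart_baseP xr; apply: cat_norm; apply: catB; first exact: coord_continuous.
  by apply: (cat_comp (k := g)); [exact: continuous_prj|exact: chart_g_continuous].
have o2 : open ((prj i @^-1` ball (prj i z) r) `&`
    [set x : E4 | 0 < `|x 0 i - g (prj i x)|]).
  rewrite openE => x [xb x0]; apply: filterI; first exact: open_nbhs_nbhs.
  have H := cgp x xb; apply: (H [set t : R | 0 < t]).
  by apply: open_nbhs_nbhs; split => //; exact: open_gt.
rewrite (_ : _ `&` _ = (prj i @^-1` ball (prj i z) r) `\`
    ((prj i @^-1` ball (prj i z) r) `&` [set x : E4 | 0 < `|x 0 i - g (prj i x)|])).
  by apply: measurableD; exact: open_measurable_borel4.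
apply/seteqP; split => x /= [xb H]; split => //.
  by move=> [_]; rewrite ltNge H.
by rewrite leNgt; apply/negP => H'; apply: H.
Qed.

Lemma chart_sigma (A : set (borel4 R)) : measurable A ->
  sigma (A `&` chart_graph) =
  (\int[leb3]_(y in chart_base `&` (fun y => graph_pt i g (vec3 y) : borel4 R) @^-1` A)
     (chart_J y)%:E)%E.
Proof.
move=> mA; rewrite (sigma_surface (U := ball (prj i z) r) (g := g)) //.
- apply: eq_integral => y; rewrite inE => -[yb _].
  by rewrite chart_JE.
- exact: ball_open.
- exact: C1d_C1_on (ball_open _ _) (chart_C1d rho_C1 ch).
- by move=> y /chart_baseP yr; exact: chart_bdry ch yr.
Qed.

Lemma chart_graph_lty : (sigma chart_graph < +oo)%E.
Proof.
exact: (density_finite measurable_chart_base measurable_chart_J chart_J_ge0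
  chart_J_le chart_base_lty chart_sigma).
Qed.

Lemma chart_Rintegral (f : borel4 R -> R) (C : R) : measurable_fun chart_graph f ->
  (forall x, chart_graph x -> `|f x| <= C) ->
  Rintegral sigma chart_graph f =
  Rintegral leb3 chart_base (fun y => f (graph_pt i g (vec3 y)) * chart_J y).
Proof.
move=> mf fC.
apply: (Rintegral_density_transfer measurable_chart_base measurable_chart_graph
  measurable_graph_pt measurable_chart_J chart_J_ge0 chart_J_le chart_base_lty _
  chart_sigma mf fC).
by move=> y yb; exists (vec3 y).
Qed.

Lemma ball_bdry_chart_graph : bdry Omega `&` ball z r `<=` chart_graph.
Proof.
move=> x [/bdryP[_ rx]]; rewrite -ball_normE /ball_ /= distrC => xr.
exists (prj i x); first by apply/chart_baseP; rewrite -prjB; apply: le_lt_trans (prj_norm_le _ _) xr.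
by rewrite -(chart_zero rho_C1 ch xr rx).
Qed.

Lemma chart_graph_bdry : chart_graph `<=` bdry Omega.
Proof. by move=> _ [y /chart_baseP yr <-]; exact: chart_bdry ch yr. Qed.

(** The part of the graph near [x0] projects into a cube of side [2 * t], on which the area element
    is at most [2 * M / c]. This cubic growth is what makes the sum in [dyadic_bound_integral]
    converge. *)
Lemma chart_growth (x0 : E4) (t : R) : 0 < t ->
  (sigma ([set x : E4 | (`|x - x0| <= t)%R] `&` chart_graph) <=
   (2 * M / c * (t + t) ^+ 3)%:E)%E.
Proof.
move=> t0; have c0 := chart_c ch; have M0 := chart_M ch.
have mA : measurable ([set x : E4 | `|x - x0| <= t] : set (borel4 R)).
  apply: closed_measurable_borel4.
  have := @closed_comp _ _ (fun x : E4 => `|x - x0|) [set t' : R | t' <= t].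
  apply; last exact: closed_le.
  move=> x _; apply: (@cat_comp _ x _ _ (fun x : E4 => x - x0) (fun x : E4 => `|x|)).
    apply: continuous_rV => k; under [X in continuous_at _ X]eq_fun do rewrite !mxE.
    by apply: catB; [exact: coord_continuous|exact: cat_cst].
  exact: norm_continuous.
rewrite chart_sigma //.
pose Q : set T3 := `[(prj i x0 0 0 - t), (prj i x0 0 0 + t)]%classic `*`
  `[(prj i x0 0 1 - t), (prj i x0 0 1 + t)]%classic `*`
  `[(prj i x0 0 2 - t), (prj i x0 0 2 + t)]%classic.
have mQ : measurable Q by do 2?apply: measurableX; exact: measurable_itv.
have E (a : R) : @lebesgue_measure R `[(a - t), (a + t)]%classic = (t + t)%:E.
  rewrite lebesgue_measure_itv /= lte_fin ifT; last by lra.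
  by rewrite -EFinB; congr (_%:E); ring.
have QE : leb3 Q = ((t + t) ^+ 3)%:E.
  rewrite lebesgue3E ?E -?EFinM; try exact: measurable_itv.
  by congr (_%:E); ring.
set W := chart_base `&` _.
have mW : measurable W by apply: measurable_graph_pt => //; exact: measurable_chart_base.
have WQ : W `<=` Q.
  move=> [[a b] d] [_ /= H].
  have : `|vec3 (a, b, d) - prj i x0| <= t.
    rewrite -(prj_ptc i (vec3 (a, b, d)) (g (vec3 (a, b, d)))) -prjB.
    exact: le_trans (prj_norm_le _ _) H.
  move=> /(rV_norm_leP _ (ltW t0)) H'; have := H' 0; have := H' 1; have := H' 2.
  by rewrite /Q !mxE /= !in_itv /= !ler_distl => -> -> ->.
apply: (@le_trans _ _ (\int[leb3]_(y in W) (2 * M / c)%:E)%E).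
  apply: ge0_le_integral => //.
  - by move=> y _; rewrite lee_fin chart_J_ge0.
  - apply/measurable_EFinP; apply: measurable_funS measurable_chart_J => //.
      exact: measurable_chart_base.
    by move=> y [].
  - by move=> y [yb _]; rewrite lee_fin; exact: chart_J_le.
rewrite integral_cst // [leRHS]EFinM -QE; apply: lee_wpmul2l.
  by rewrite lee_fin divr_ge0 ?mulr_ge0 // ltW.
by apply: le_measure => //; rewrite inE.
Qed.
End ChartMeasure.
End Boundary.

(** * Cutoff functions and boundary layers *)

Section Cutoff.
Variable R : realType.
Implicit Types s u v : R.

Definition clip u : R := Num.max 0 (Num.min 1 u).

Lemma clip_itv u : 0 <= clip u <= 1.
Proof. by rewrite /clip le_max lexx /= ge_max ler01 ge_min lexx. Qed.

Lemma clip_cases u : [\/ u <= 0 /\ clip u = 0, 0 <= u <= 1 /\ clip u = u |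
  1 <= u /\ clip u = 1].
Proof.
rewrite /clip; have [u0|u0] := leP u 0.
  by apply: Or31; split => //; rewrite min_r ?max_l //; apply: le_trans u0 ler01.
have [u1|u1] := leP u 1.
  by apply: Or32; split; [rewrite (ltW u0)|rewrite max_r // ltW].
by apply: Or33; split; [exact: ltW|rewrite max_r].
Qed.

Lemma clip_continuous : continuous clip.
Proof.
move=> u; apply: continuous_max; first exact: cat_cst.
by apply: continuous_min; [exact: cat_cst|exact: cvg_id].
Qed.

(* A [C^1] cutoff: 1 on ]-oo, -2] and 0 on [-1, +oo[. *)
Definition theta s : R := 3 * clip (- s - 1) ^+ 2 - 2 * clip (- s - 1) ^+ 3.
Definition dtheta s : R := - (6 * (clip (- s - 1) * (1 - clip (- s - 1)))).

(** The Taylor remainder of the cubic step when the base point [x] is on the ramp and the other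
    point lies at distance [y] before its start. *)
Lemma cubic_bound_corner (x y : R) : 0 <= x <= 1 -> 0 <= y ->
  `|3 * x ^+ 2 - 4 * x ^+ 3 + 6 * (x * (1 - x)) * y| <= 3 * (x + y) ^+ 2.
Proof.
move=> /andP[x0 x1] y0; rewrite ler_norml.
have h1 : 0 <= x * (1 - x) * y by rewrite !mulr_ge0 // subr_ge0.
have h2 : 0 <= x * x * (1 - x) by rewrite !mulr_ge0 // subr_ge0.
have h3 : 0 <= x * x * x by rewrite !mulr_ge0.
have h4 : 0 <= x * x * y by rewrite !mulr_ge0.
have h5 : 0 <= x * y by rewrite mulr_ge0.
have h6 : 0 <= x * x by rewrite mulr_ge0.
have h7 : 0 <= y * y by rewrite mulr_ge0.
by apply/andP; split; rewrite !(exprS, expr0); lra.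
Qed.

Lemma cubic_bound (x d : R) : 0 <= x <= 1 -> x <= d ->
  `|3 * x ^+ 2 - 2 * x ^+ 3| <= 3 * d ^+ 2.
Proof.
move=> /andP[x0 x1] xd; rewrite ler_norml.
have h1 : 0 <= x * x * (1 - x) by rewrite !mulr_ge0 // subr_ge0.
have h2 : x * x <= d * d by rewrite ler_pM.
have h3 : 0 <= x * x * x by rewrite !mulr_ge0.
have h4 : 0 <= x * x by rewrite mulr_ge0.
by apply/andP; split; rewrite !(exprS, expr0); lra.
Qed.

(** Taylor's estimate, the second derivative being bounded by 6 on the ramp; the nine cases place
    [u] and [v] before, on or after it. A global quadratic remainder gives differentiability at the
    two corners without one-sided limits. *)
Lemma smoothstep_quad u v :
  `|(3 * clip v ^+ 2 - 2 * clip v ^+ 3) - (3 * clip u ^+ 2 - 2 * clip u ^+ 3)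
    - 6 * (clip u * (1 - clip u)) * (v - u)| <= 3 * (v - u) ^+ 2.
Proof.
have h0 : 0 <= 3 * (v - u) ^+ 2 by rewrite mulr_ge0 // sqr_ge0.
case: (clip_cases u) => -[hu ->]; case: (clip_cases v) => -[hv ->].
- by rewrite [X in `|X|](_ : _ = 0) ?normr0 //; ring.
- rewrite [X in `|X|](_ : _ = 3 * v ^+ 2 - 2 * v ^+ 3); last by ring.
  by apply: cubic_bound => //; lra.
- rewrite [X in `|X|](_ : _ = 3 * 1 ^+ 2 - 2 * 1 ^+ 3); last by ring.
  by apply: cubic_bound; [apply/andP; split|lra].
- rewrite [X in `|X|](_ : _ = 3 * u ^+ 2 - 4 * u ^+ 3 + 6 * (u * (1 - u)) * (- v)); last by ring.
  rewrite (_ : (v - u) ^+ 2 = (u + - v) ^+ 2); last by ring.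
  by apply: cubic_bound_corner => //; rewrite oppr_ge0.
- rewrite [X in `|X|](_ : _ = (v - u) ^+ 2 * (3 - 4 * u - 2 * v)); last by ring.
  rewrite normrM [`|_ ^+ 2|]ger0_norm ?sqr_ge0 // [leRHS]mulrC.
  apply: ler_wpM2l; first exact: sqr_ge0.
  by move: hu hv => /andP[u0 u1] /andP[v0 v1]; rewrite ler_norml; apply/andP; split; lra.
(* The symmetry $x \mapsto 1 - x$ of the step reduces the corner at 1 to the corner at 0. *)
- rewrite [X in `|X|](_ : _ = - (3 * (1 - u) ^+ 2 - 4 * (1 - u) ^+ 3 +
    6 * ((1 - u) * (1 - (1 - u))) * (v - 1))); last by ring.
  rewrite normrN (_ : (v - u) ^+ 2 = ((1 - u) + (v - 1)) ^+ 2); last by ring.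
  apply: cubic_bound_corner; last by rewrite subr_ge0.
  by move: hu => /andP[u0 u1]; apply/andP; split; lra.
- rewrite [X in `|X|](_ : _ = - (3 * 1 ^+ 2 - 2 * 1 ^+ 3)); last by ring.
  rewrite normrN (_ : (v - u) ^+ 2 = (u - v) ^+ 2); last by ring.
  by apply: cubic_bound; [apply/andP; split|lra].
- rewrite [X in `|X|](_ : _ = - (3 * (1 - v) ^+ 2 - 2 * (1 - v) ^+ 3)); last by ring.
  rewrite normrN (_ : (v - u) ^+ 2 = (u - v) ^+ 2); last by ring.
  move: hv => /andP[v0 v1]; apply: cubic_bound; last by lra.
  by apply/andP; split; lra.
- by rewrite [X in `|X|](_ : _ = 0) ?normr0 //; ring.
Qed.

Lemma theta_derive s : is_derive s (1 : R) theta (dtheta s).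
Proof.
have H : forall e, 0 < e -> exists2 d, 0 < d & forall h, `|h| < d ->
    `|theta (s + h) - theta s - dtheta s * h| <= e * `|h|.
  move=> e e0; exists (e / 3); first by rewrite divr_gt0.
  move=> h hd; have := smoothstep_quad (- s - 1) (- (s + h) - 1).
  rewrite (_ : - (s + h) - 1 - (- s - 1) = - h); last by ring.
  rewrite (_ : _ * - h = dtheta s * h); last by rewrite /dtheta; ring.
  move=> H; apply: le_trans H _; rewrite sqrrN -real_normK ?num_real //.
  rewrite expr2 mulrA; apply: ler_wpM2r => //.
  by rewrite mulrC -ler_pdivlMr // ltW.
have hder : h^-1 *: (theta (h *: (1 : R) + s) - theta s) @[h --> 0^'] --> dtheta s.
  apply/cvgrPdist_le => e e0; have [d d0 hd] := H e e0.
  exists d => // h /=; rewrite sub0r normrN => hdd h0.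
  have H' := hd h hdd; rewrite -[h *: 1]/(h * 1) mulr1 (addrC h).
  rewrite -[_ *: _]/(_ * _) distrC.
  rewrite (_ : h^-1 * _ - _ = h^-1 * (theta (s + h) - theta s - dtheta s * h)); last first.
    by rewrite [RHS]mulrBr [dtheta s * h]mulrC mulKf.
  rewrite normrM normfV -ler_pdivlMl ?invr_gt0 ?normr_gt0 // invrK.
  by rewrite [leRHS]mulrC.
apply: DeriveDef; first by apply/cvg_ex; exists (dtheta s).
exact/cvg_lim.
Qed.

Lemma dtheta_continuous : continuous dtheta.
Proof.
have cc (s : R) : continuous_at s (fun s => clip (- s - 1)).
  apply: (@cat_comp _ s _ _ (fun s => - s - 1) clip); last exact: clip_continuous.
  by apply: catB; [apply: catN; exact: cvg_id|exact: cat_cst].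
move=> s; apply: catN; apply: catM; first exact: cat_cst.
by apply: catM => //; apply: catB => //; exact: cat_cst.
Qed.

Lemma theta_itv s : 0 <= theta s <= 1.
Proof.
rewrite /theta; have := clip_itv (- s - 1); move: (clip _) => x /andP[x0 x1].
have h1 : 0 <= x * x * (1 - x) by rewrite !mulr_ge0 // subr_ge0.
have h2 : 0 <= x * x by rewrite mulr_ge0.
have h3 : 0 <= (1 - x) * (1 - x) * (1 + 2 * x).
  by rewrite !mulr_ge0 ?subr_ge0 // addr_ge0 // mulr_ge0.
by apply/andP; split; rewrite !(exprS, expr0); lra.
Qed.

Lemma dtheta_le0 s : dtheta s <= 0.
Proof.
rewrite /dtheta oppr_le0; have /andP[h0 h1] := clip_itv (- s - 1).
by rewrite !mulr_ge0 // subr_ge0.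
Qed.

Lemma theta1 s : s <= -2 -> theta s = 1.
Proof.
move=> s2; rewrite /theta; case: (clip_cases (- s - 1)) => -[h ->]; try lra.
have -> : - s - 1 = 1 by lra.
by rewrite !expr1n; lra.
Qed.

Lemma theta0 s : -1 <= s -> theta s = 0.
Proof.
move=> s1; rewrite /theta; case: (clip_cases (- s - 1)) => -[h ->].
- by rewrite !expr0n /=; lra.
- have -> : - s - 1 = 0 by lra.
  by rewrite !expr0n /=; lra.
- lra.
Qed.

Lemma dtheta_neq0 s : dtheta s != 0 -> -2 < s < -1.
Proof.
rewrite /dtheta; case: (clip_cases (- s - 1)) => -[h ->].
- by rewrite mul0r mulr0 oppr0 eqxx.
- move=> H; apply/andP; split; rewrite lt_neqAle; apply/andP; split; try lra.
    by apply: contraNneq H => <-; apply/eqP; ring.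
  by apply: contraNneq H => ->; apply/eqP; ring.
- by rewrite subrr !mulr0 oppr0 eqxx.
Qed.
End Cutoff.

(** * Boundary layers on a vertical line *)

Section LayerLimit.
Variable R : realType.
Local Notation leb := (@lebesgue_measure R).
(** [r] is [rho] along a vertical line of a chart, [dr] its derivative, [g] its zero, and [G0] the
    value of $w/|dr|$ at [g]. The hypotheses [wC] and [w_lim] speak only of points where [r] is
    negative, since the weight is controlled on the domain alone. *)
Variables (r dr w : R -> R) (a b g s c C G0 : R).
Hypotheses (ab : a < b) (c0 : 0 < c).
Hypothesis s1 : s = 1 \/ s = -1.
Hypothesis r_der : forall t : R, is_derive t (1 : R) r (dr t).
Hypothesis dr_cont : continuous dr.
Hypothesis dr_ge : forall t, a <= t <= b -> c <= s * dr t.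
Hypothesis ra : s * r a < 0.
Hypothesis rb : 0 < s * r b.
Hypothesis r_dist : forall t, a <= t <= b -> c * `|t - g| <= `|r t|.
Hypothesis wC : forall t, a <= t <= b -> r t < 0 -> `|w t| <= C.
Hypothesis w_cont : forall k, 0 < k -> continuous (fun t => w t * (- k * dtheta (k * r t))).
Hypothesis w_lim : forall e, 0 < e -> exists2 d, 0 < d &
  forall t, a <= t <= b -> `|t - g| < d -> r t < 0 -> `|w t / `|dr t| - G0| <= e.

Let layer k := Rintegral leb `[a, b] (fun t => w t * (- k * dtheta (k * r t))).
(** The derivative of [- s * theta (k * r t)], so its integral is explicit. On the segment it is
    nonnegative, of total mass at most 1, and acts as an approximate identity at [g]. *)
Let m k t := - k * dtheta (k * r t) * (s * dr t).

Let r_cont : continuous r.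
Proof.
by move=> t; apply/differentiable_continuous/derivable1_diffP; have [] := r_der t.
Qed.

Let dtheta_r_cont k : continuous (fun t => - k * dtheta (k * r t)).
Proof.
move=> t; apply: catM; first exact: cat_cst.
apply: (@cat_comp _ t _ _ (fun t => k * r t) (@dtheta R)); last exact: dtheta_continuous.
by apply: catM; [exact: cat_cst|exact: r_cont].
Qed.

Let m_cont k : continuous (m k).
Proof.
move=> t; apply: catM; first exact: dtheta_r_cont.
by apply: catM; [exact: cat_cst|exact: dr_cont].
Qed.

Let integrable_cont h : continuous h -> leb.-integrable `[a, b] (EFin \o h).
Proof.
move=> ch; apply: continuous_compact_integrable; first exact: segment_compact.
exact: continuous_subspaceT.
Qed.

(** The endpoint that lies in the domain: [a] if [r] increases, [b] if it decreases. *)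
Let q := if s == 1 then a else b.

Let rq : r q < 0.
Proof.
by rewrite /q; case: s1 ra rb => -> ; rewrite ?mul1r ?mulN1r ?eqxx //;
  rewrite ifF ?oppr_gt0 //; apply/negbTE; rewrite eq_sym -subr_eq0 opprK; apply: lt0r_neq0.
Qed.

Let int_m k : 0 < k -> Rintegral leb `[a, b] (m k) = theta (k * r q).
Proof.
move=> k0; have dF (t : R) : is_derive t (1 : R) (fun t => - s * theta (k * r t)) (m k t).
  have d1 : is_derive t (1 : R) (fun t => k * r t) (k * dr t).
    exact: (is_deriveZ k (r_der t)).
  have d2 := @is_derive1_comp R (@theta R) (fun t => k * r t) t _ _
    (theta_derive (k * r t)) d1.
  have d3 := is_deriveZ (- s) d2.
  by apply: (is_derive_eq d3); rewrite -[LHS]/(- s * (_ * _)) /m; ring.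
rewrite (Rintegral_FTC2 ab dF (@m_cont k)).
rewrite /q; case: s1 ra rb => ->; rewrite ?mul1r ?mulN1r => ra' rb'.
  rewrite eqxx (theta0 (s := k * r b)); first by ring.
  by apply: (@le_trans _ _ 0); [lra|rewrite mulr_ge0 // ltW].
rewrite ifF; last by apply/negbTE; rewrite eq_sym -subr_eq0 opprK; apply: lt0r_neq0.
rewrite (theta0 (s := k * r a)); first by ring.
by apply: (@le_trans _ _ 0); [lra|rewrite mulr_ge0 ?ltW // -oppr_lt0].
Qed.

Let m_ge0 k t : 0 < k -> a <= t <= b -> 0 <= m k t.
Proof.
move=> k0 tab; rewrite /m mulNr -mulrN mulr_ge0 //.
  by rewrite mulr_ge0 ?(ltW k0) // oppr_ge0 dtheta_le0.
by apply: le_trans (dr_ge tab); exact: ltW.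
Qed.

Let drE t : a <= t <= b -> `|dr t| = s * dr t.
Proof.
move=> tab; have h : 0 <= s * dr t by apply: le_trans (dr_ge tab); exact: ltW.
by rewrite -[RHS]ger0_norm // normrM; case: s1 => ->; rewrite ?normrN normr1 mul1r.
Qed.

Let dr_gt0 t : a <= t <= b -> 0 < s * dr t.
Proof. by move=> /dr_ge; exact: lt_le_trans. Qed.

Let supp k t : 0 < k -> dtheta (k * r t) != 0 -> r t < 0 /\ `|r t| <= 2 / k.
Proof.
move=> k0 /dtheta_neq0/andP[h1 h2].
have r0 : r t < 0 by rewrite -(pmulr_rlt0 _ k0); lra.
by split => //; rewrite ltr0_norm // ler_pdivlMr // mulNr mulrC; lra.
Qed.

(** The integrand is dominated by [C / c * m k], and [m k] has mass at most 1. The bound is uniform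
    in [k], as dominated convergence over the base of the chart requires. *)
Lemma layer_bound k : 0 < k -> `|layer k| <= C / c.
Proof.
move=> k0; have mi : measurable (`[a, b]%classic : set (measurableTypeR R)) by exact: measurable_itv.
  have H := le_normr_Rintegral mi (integrable_cont (w_cont k0)); rewrite /layer; apply: le_trans H _.
have C0 : 0 <= C by apply: le_trans (wC (t := q) _ rq) => //; rewrite /q; case: ifP; rewrite lexx ltW.
apply: (@le_trans _ _ (Rintegral leb `[a, b] (fun t => C / c * m k t))).
  apply: le_Rintegral => //.
  - by apply: integrable_cont => t; apply: cat_norm; exact: w_cont.
  - by apply: integrable_cont => t; apply: catM; [exact: cat_cst|exact: m_cont].
  move=> t; rewrite /= in_itv /= => tab.
  have [->|d0] := eqVneq (dtheta (k * r t)) 0.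
    by rewrite !mulr0 normr0 /m mulr_ge0 ?divr_ge0 // ?(ltW c0) // m_ge0.
  have [rt0 _] := supp k0 d0.
  rewrite normrM [`|- k * _|]ger0_norm; last first.
    by rewrite mulNr -mulrN mulr_ge0 ?(ltW k0) // oppr_ge0 dtheta_le0.
  have -> : C / c * m k t = C / c * (s * dr t) * (- k * dtheta (k * r t)).
    by rewrite -[RHS]mulrA; congr (_ * _); rewrite /m mulrC.
  apply: ler_wpM2r.
    by rewrite mulNr -mulrN mulr_ge0 ?(ltW k0) // oppr_ge0 dtheta_le0.
  apply: le_trans (wC tab rt0) _; rewrite mulrAC ler_pdivlMr //.
  by apply: ler_wpM2l => //; exact: dr_ge.
rewrite RintegralZl ?int_m //; last exact: integrable_cont.
rewrite ler_piMr ?divr_ge0 // ?(ltW c0) //.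
by have /andP[] := theta_itv (k * r q).
Qed.

(** Once [m k] has mass 1, the error is the integral of $w/|dr| - G0$ against it. On its support
    $|r| \le 2/k$, so [r_dist] makes the support shrink to [g]. *)
Lemma layer_limit e : 0 < e -> exists K, forall k, K <= k -> 0 < k /\ `|layer k - G0| <= e.
Proof.
move=> e0; have [d d0 hd] := w_lim e0.
(* The first threshold gives [k * r q <= -2], where [theta] is 1; the second puts the support of
   [m k] within [d] of [g]. *)
exists (Num.max (2 / - r q) (2 / (c * (d / 2)))) => k.
have rq' : 0 < - r q by rewrite oppr_gt0.
have cd0 : 0 < c * (d / 2) by rewrite mulr_gt0 // divr_gt0.
rewrite ge_max !ler_pdivrMr // => /andP[k1 k2].
have k0 : 0 < k by rewrite -(pmulr_lgt0 _ cd0); apply: lt_le_trans k2.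
split => //; have mi : measurable (`[a, b]%classic : set (measurableTypeR R)) by exact: measurable_itv.
have T1 : theta (k * r q) = 1 by apply: theta1; lra.
have im : leb.-integrable `[a, b] (EFin \o (fun t => G0 * m k t)).
  by apply: integrable_cont => t; apply: catM; [exact: cat_cst|exact: m_cont].
have -> : layer k - G0 = Rintegral leb `[a, b]
    (fun t => w t * (- k * dtheta (k * r t)) - G0 * m k t).
  rewrite RintegralB //; last exact/integrable_cont/w_cont.
  rewrite RintegralZl ?int_m ?T1 ?mulr1 //; exact: integrable_cont.
have H : leb.-integrable `[a, b] (EFin \o (fun t => w t * (- k * dtheta (k * r t)) - G0 * m k t)).
  by apply: integrable_cont => t; apply: catB; [exact: w_cont|apply: catM; [exact: cat_cst|exact: m_cont]].
have H2 := le_normr_Rintegral mi H; apply: le_trans H2 _.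
apply: (@le_trans _ _ (Rintegral leb `[a, b] (fun t => e * m k t))); last first.
  by rewrite RintegralZl ?int_m ?T1 ?mulr1 //; exact: integrable_cont.
apply: le_Rintegral => //.
- apply: integrable_cont => t; apply: cat_norm.
  by apply: catB; [exact: w_cont|apply: catM; [exact: cat_cst|exact: m_cont]].
- by apply: integrable_cont => t; apply: catM; [exact: cat_cst|exact: m_cont].
move=> t; rewrite /= in_itv /= => tab.
have [dt0|dt0] := eqVneq (dtheta (k * r t)) 0.
  by rewrite /m dt0 !(mulr0, mul0r) subr0 normr0.
have [rt0 rt2] := supp k0 dt0.
have td : `|t - g| < d.
  have H3 : c * `|t - g| <= 2 / k by apply: le_trans (r_dist tab) rt2.
  rewrite -(ltr_pM2l c0); apply: le_lt_trans H3 _.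
  by rewrite ltr_pdivrMr //; nra.
have drt := dr_gt0 tab.
have -> : w t * (- k * dtheta (k * r t)) - G0 * m k t = (w t / `|dr t| - G0) * m k t.
  rewrite drE // /m; move: (s * dr t) (- k * dtheta (k * r t)) drt => p X p0.
  by field; rewrite gt_eqF.
by rewrite normrM [`|m k t|]ger0_norm ?m_ge0 //; apply: ler_wpM2r; rewrite ?m_ge0 // hd.
Qed.
End LayerLimit.

(** * The divergence theorem *)

Section WithinEps.
Variables (R : realType) (n : nat) (A : set 'rV[R]_n.+1).
Local Notation E := 'rV[R]_n.+1.

Lemma within_epsP (w : E -> R) : {within A, continuous w} <->
  forall x, A x -> forall e, 0 < e -> exists2 d, 0 < d &
    forall x', A x' -> `|x' - x| < d -> `|w x' - w x| < e.
Proof.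
rewrite subspace_continuousP; split=> H x Ax.
  move=> e e0; have B : nbhs (w x) (ball (w x) e) by exact: nbhsx_ballx.
  have /nbhs_ballP[d /= d0 hd] := H x Ax _ B; exists d => // x' Ax' xx'.
  have : ball x d x' by rewrite -ball_normE /ball_ /= distrC.
  by move=> /hd/(_ Ax'); rewrite /ball /= distrC.
move=> W /nbhs_ballP[e /= e0 he]; have [d d0 hd] := H x Ax e e0.
apply/nbhs_ballP; exists d => // x'; rewrite -ball_normE /ball_ /= distrC => xx' Ax'.
by apply: he; rewrite /ball /= distrC; exact: hd.
Qed.

Lemma within_eps_at (w : E -> R) x : {within A, continuous w} -> open_nbhs x A ->
  continuous_at x w.
Proof.
move=> /within_epsP H [oA Ax]; apply/continuous_at_eps => e e0.
have [d d0 hd] := H x Ax e e0.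
have /nbhs_ballP[d' /= d'0 hd'] : nbhs x A by exact: open_nbhs_nbhs.
exists (Num.min d d'); first by rewrite lt_min d0 d'0.
move=> h; rewrite lt_min => /andP[h1 h2].
by apply: hd; [exact/hd'/ball_in|rewrite addrAC subrr add0r].
Qed.

Lemma within_continuous_bounded (w : E -> R) : compact A -> {within A, continuous w} ->
  exists2 C, 0 < C & forall x, A x -> `|w x| <= C.
Proof.
move=> cA cw; have cK : compact (w @` A) by exact: continuous_compact.
have [M [Mr hM]] := compact_bounded cK.
exists (`|M| + 1); first by rewrite ltr_pwDr.
move=> x Ax; apply: (hM (`|M| + 1)); last by exists x.
by apply: (@le_lt_trans _ _ `|M|); [exact: ler_norm|rewrite ltrDl].
Qed.
End WithinEps.

Lemma Rintegral_dominated d (T : measurableType d) (R : realType)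
    (mu : {measure set T -> \bar R}) (D : set T) (f_ : nat -> T -> R) (f : T -> R) (C : R) :
  measurable D -> (mu D < +oo)%E -> (forall n, measurable_fun D (f_ n)) ->
  (forall n x, D x -> `|f_ n x| <= C) ->
  (forall x, D x -> f_ ^~ x @ \oo --> f x) ->
  (fun n => Rintegral mu D (f_ n)) @ \oo --> Rintegral mu D f.
Proof.
move=> mD muD mf fC fcv.
have mf' : measurable_fun D f by exact: (measurable_fun_cvg mf fcv).
have fC' x : D x -> `|f x| <= C.
  move=> Dx; have := cvg_norm (fcv x Dx) => H.
  by apply: (cvgr_to_le (H _)); apply: nearW => n; exact: fC.
have fi := bounded_integrable mD muD mf' fC'.
rewrite /Rintegral; apply: fine_cvg; rewrite fineK; last exact: integrable_fin_num.
apply: (@dominated_cvg _ _ _ mu D mD (fun n => EFin \o f_ n) _ (cst C%:E)) => //.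
- by move=> n; apply/measurable_EFinP.
- by move=> x Dx; apply: cvg_EFin; [exact: nearW|exact: fcv].
- by apply: (bounded_integrable (C := `|C|)) => //; exact: measurable_cst.
Qed.

Lemma cat_max (R : realType) (T : topologicalType) (x : T) (f g : T -> R) :
  continuous_at x f -> continuous_at x g -> continuous_at x (fun y => Num.max (f y) (g y)).
Proof. by move=> cf cg; exact: (continuous_max cf cg). Qed.

Lemma continuous_dist (R : realType) n (z : 'rV[R]_n.+1) :
  continuous (fun x : 'rV[R]_n.+1 => `|x - z|).
Proof.
move=> x; apply/continuous_at_eps => e e0; exists e => // h he.
apply: le_lt_trans he; rewrite -[leRHS](_ : `|x + h - z - (x - z)| = _) ?ler_dist_dist //.
by congr (`|_|); rewrite opprB addrA subrK addrAC subrr add0r.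
Qed.

Section FiniteSums.
Context d (T : measurableType d) (R : realType).
Variables (mu : {measure set T -> \bar R}) (D : set T).

Lemma measure_bigsetU_lty (I : Type) (r : seq I) (A : I -> set T) :
  (forall i, measurable (A i)) -> (forall i, mu (A i) < +oo)%E ->
  measurable (\big[setU/set0]_(i <- r) A i) /\ (mu (\big[setU/set0]_(i <- r) A i) < +oo)%E.
Proof.
move=> mA muA; elim: r => [|i r [mr IH]]; first by rewrite big_nil measure0.
rewrite big_cons; split; first exact: measurableU.
have H := lte_add_pinfty (muA i) IH.
by apply: le_lt_trans H; exact: (measureU2 _ (mA i) mr).
Qed.

Lemma Rintegral_sum_fun (I : Type) (r : seq I) (F : I -> T -> R) : measurable D ->
  (forall i, mu.-integrable D (EFin \o F i)) ->
  mu.-integrable D (EFin \o (fun x => \sum_(i <- r) F i x)) /\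
  Rintegral mu D (fun x => \sum_(i <- r) F i x) = \sum_(i <- r) Rintegral mu D (F i).
Proof.
move=> mD iF; elim: r => [|i r [ir IH]].
  rewrite big_nil (_ : (fun x => \sum_(i <- [::]) F i x) = fun=> 0); last first.
    by apply/funext => x; rewrite big_nil.
  by split; [exact: integrable0|rewrite /Rintegral integral0].
rewrite big_cons (_ : (fun x => \sum_(i <- i :: r) F i x) =
  fun x => F i x + \sum_(i <- r) F i x); last first.
  by apply/funext => x; rewrite big_cons.
split; last by rewrite RintegralD // IH.
exact: (integrableD mD (iF i) ir).
Qed.
End FiniteSums.

(** * Concentration of volume integrals on the boundary, and the flux formula *)

Section SurfaceLayer.
Variables (R : realType) (rho : 'rV[R]_4 -> R) (Omega : set 'rV[R]_4).
Local Notation E4 := 'rV[R]_4.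
Local Notation E3 := 'rV[R]_3.
Hypothesis rho_C1 : C1_on setT rho.
Hypothesis OmegaE : Omega = [set q | rho q < 0].
Hypothesis Omega_open : open Omega.
Hypothesis Omega_bounded : bounded_set Omega.
Variable sigma : {measure set (borel4 R) -> \bar R}.
Hypothesis sigma_surface : is_surface_measure (bdry Omega) sigma.
Local Notation T1 := (measurableTypeR R).
Local Notation T3 := (T1 * T1 * T1)%type.
Local Notation leb := (@lebesgue_measure R).
Local Notation leb3 := (@lebesgue3 R).

(* As [k] grows, [layer_weight k 1] concentrates on the boundary. *)
Definition layer_weight (k : R) (w : E4 -> R) (x : E4) : R :=
  w x * (- k * dtheta (k * rho x)).

Lemma layer_weight_neq0 k w x : 0 < k -> layer_weight k w x != 0 ->
  - (2 / k) < rho x < 0.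
Proof.
move=> k0; rewrite /layer_weight !mulf_eq0 !negb_or => /andP[_ /andP[_ /dtheta_neq0/andP[h1 h2]]].
apply/andP; split; first by rewrite -mulNr ltr_pdivrMr // mulrC.
by rewrite -(pmulr_rlt0 _ k0); lra.
Qed.

Lemma layer_weight_out k w x : 0 < k -> 0 <= rho x -> layer_weight k w x = 0.
Proof.
move=> k0 rx; apply: contraTeq (rx) => /(layer_weight_neq0 k0)/andP[_].
by rewrite ltNge.
Qed.

(** [w] is arbitrary outside the closure, but the factor with [dtheta] vanishes on the open set
    where $k\rho > -1$; all remaining points lie in the open set [Omega]. *)
Lemma layer_weight_continuous k w : 0 < k -> {within closure Omega, continuous w} ->
  continuous (layer_weight k w).
Proof.
move=> k0 cw x; have crx : continuous_at x (fun x => k * rho x).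
  by apply: catM; [exact: cat_cst|exact: rho_continuous].
have [kx|kx] := ltP (- 1) (k * rho x).
  apply: (@near_continuous _ _ (fun=> 0)); first exact: cat_cst.
  have : \forall y \near x, -1 < k * rho y by exact: (cvgr_gt _ crx).
  apply: filterS => y ky; apply/esym/eqP; rewrite /layer_weight !mulf_eq0.
  apply/orP; right; apply/orP; right; apply: contraLR ky => /dtheta_neq0/andP[_ h].
  by rewrite -leNgt ltW.
have Ox : Omega x by rewrite OmegaE /= -(pmulr_rlt0 _ k0); lra.
apply: catM.
  apply: (within_eps_at (A := Omega)); last by split.
  by apply: continuous_subspaceW cw; exact: subset_closure.
apply: catM; first exact: cat_cst.
by apply: (@cat_comp _ x _ _ (fun x => k * rho x) (@dtheta R)) => //; exact: dtheta_continuous.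
Qed.

Lemma rho_far : exists M, forall x, M < `|x| -> 0 <= rho x.
Proof.
have [M [Mr hM]] := Omega_bounded; exists (`|M| + 1) => x Mx; rewrite leNgt.
apply: contraL Mx => rx; rewrite -leNgt; apply: (hM (`|M| + 1)); last by rewrite OmegaE.
by apply: (@le_lt_trans _ _ `|M|); [exact: ler_norm|rewrite ltrDl].
Qed.

Lemma layer_weight_support : exists M, forall k w, 0 < k -> vanishes_out M (layer_weight k w).
Proof.
by have [M hM] := rho_far; exists M => k w k0 x /hM; exact: layer_weight_out.
Qed.

Section InChart.
Variables (z : E4) (i : 'I_4) (s c M h r : R) (g : E3 -> R).
Hypothesis ch : chart rho z i s c M h r g.
Variable w : E4 -> R.
Hypothesis w_cont : {within closure Omega, continuous w}.
Hypothesis w_supp : forall x, r <= `|x - z| -> w x = 0.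

Let inner (k : R) (y : T3) : R :=
  Rintegral leb setT (fun t => layer_weight k w (ins i (y, t))).

Let inner_out k y : ~ chart_base z i r y -> inner k y = 0.
Proof.
move=> yb; transitivity (Rintegral leb setT (fun=> 0)); last by rewrite /Rintegral integral0.
apply: eq_Rintegral => t _; rewrite /layer_weight w_supp ?mul0r //.
rewrite leNgt; apply/negP => H; apply/yb/chart_baseP.
by apply: le_lt_trans H; rewrite -[vec3 y](prj_ptc i _ t) -prjB; exact: prj_norm_le.
Qed.

Let zi := z 0 i.

Let inner_in k y : chart_base z i r y ->
  inner k y = Rintegral leb `[zi - h, zi + h]
    (fun t => w (ptc i (vec3 y) t) * (- k * dtheta (k * rho (ptc i (vec3 y) t)))).
Proof.
move=> yb; rewrite /inner (Rintegral_support (a := zi - h) (b := zi + h)) // => t th.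
rewrite /layer_weight w_supp ?mul0r //.
have := le_coord_norm (ptc i (vec3 y) t - z) i; rewrite !mxE => /(le_trans _); apply.
have := ptc_i i (vec3 y) t; rewrite !mxE => ->.
rewrite leNgt; apply: contra th => th; have := chart_rh ch => rh.
have : `|t - zi| <= h by apply: le_trans rh; exact: ltW.
by rewrite ler_norml => /andP[? ?]; apply/andP; split; lra.
Qed.

Let w_bound : exists2 C, 0 < C & forall x, closure Omega x -> `|w x| <= C.
Proof. by apply: within_continuous_bounded => //; exact: closure_compact. Qed.

Let p (y : T3) : E4 := graph_pt i g (vec3 y).

(** The one-dimensional estimates on the vertical line over [y]: a bound uniform in [k], for
    domination, and the limit at the point of the graph. *)
Let chart_layer C y : (forall x, closure Omega x -> `|w x| <= C) -> chart_base z i r y ->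
  (forall k, 0 < k -> `|inner k y| <= C / c) /\
  (forall e, 0 < e -> exists K, forall k, K <= k -> 0 < k /\
     `|inner k y - w (p y) / `|partial i rho (p y)| | <= e).
Proof.
move=> wC yb; have /chart_baseP yr := yb.
have [gh rg] := chart_g ch yr; have c0 := chart_c ch.
have yh : `|vec3 y - prj i z| <= h by apply: le_trans (ltW yr) (chart_rh ch).
have inh t : zi - h <= t <= zi + h -> `|t - zi| <= h.
  by move=> /andP[? ?]; rewrite ler_norml; apply/andP; split; lra.
have inB t : zi - h <= t <= zi + h -> `|ptc i (vec3 y) t - z| <= h.
  by move=> /inh; exact: ptc_norm_le_prj.
have r_der (t : R) : is_derive t (1 : R) (fun t => rho (ptc i (vec3 y) t))
    (partial i rho (ptc i (vec3 y) t)).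
  have E u : ptc i (vec3 y) u = ptc i (vec3 y) 0 + u *: delta_mx 0 i.
    by rewrite (ptc_line i _ 0 u) subr0.
  have dr : differentiable rho (ptc i (vec3 y) 0 + t *: delta_mx 0 i).
    by have [] := rho_C1 (x := ptc i (vec3 y) 0 + t *: delta_mx 0 i) I.
  have := is_derive_line dr; rewrite dlin_delta -E.
  by rewrite (_ : (fun t => rho _) = fun u : R => rho (ptc i (vec3 y) 0 + u *: delta_mx 0 i)) //;
    apply/funext => u; rewrite -E.
have cpt : continuous (fun t : R => ptc i (vec3 y) t).
  by move=> t; apply: continuous_ptc; [exact: cat_cst|exact: cvg_id].
have dr_cont : continuous (fun t : R => partial i rho (ptc i (vec3 y) t)).
  move=> t; apply: (@cat_comp _ t _ _ (fun t => ptc i (vec3 y) t) (partial i rho)) => //.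
  exact: partial_rho_continuous.
have [gh1 gh2] : zi - h <= g (vec3 y) /\ g (vec3 y) <= zi + h.
  by move: gh; rewrite ltr_norml => /andP[? ?]; split; rewrite /zi; lra.
have hlt : zi - h < zi + h by have := chart_r ch; have := chart_rh ch; lra.
have pE : p y = ptc i (vec3 y) (g (vec3 y)) by [].
have pB : bdry Omega (p y) by exact: (chart_bdry rho_C1 OmegaE Omega_open ch yr).
have pC : closure Omega (p y) by have [] := pB.
have rdist (t : R) : zi - h <= t <= zi + h ->
    c * `|t - g (vec3 y)| <= `|rho (ptc i (vec3 y) t)|.
  move=> /inh th; have := chart_dist rho_C1 ch yh (ltW gh) th.
  by rewrite -pE rg subr0.
have wCt (t : R) : zi - h <= t <= zi + h -> rho (ptc i (vec3 y) t) < 0 ->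
    `|w (ptc i (vec3 y) t)| <= C.
  by move=> _ rt; apply/wC/subset_closure; rewrite OmegaE.
have wl e : 0 < e -> exists2 d, 0 < d & forall t : R, zi - h <= t <= zi + h ->
    `|t - g (vec3 y)| < d -> rho (ptc i (vec3 y) t) < 0 ->
    `|w (ptc i (vec3 y) t) / `|partial i rho (ptc i (vec3 y) t)| -
      w (p y) / `|partial i rho (p y)| | <= e.
  move=> e0.
  have cq : {within closure Omega `&` [set x | partial i rho x != 0],
      continuous (fun x => w x / `|partial i rho x|)}.
    move=> x; apply: (@catM _ (subspace _)); first exact: (continuous_subspaceW (@subIsetl _ _ _) w_cont).
    apply: (@continuous_in_subspaceT _ _ _ (fun x => `|partial i rho x|^-1)) => y'.
    rewrite inE => -[_ dy']; apply: catV; first by rewrite normr_eq0.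
    by apply: cat_norm; exact: partial_rho_continuous.
  have dp : partial i rho (p y) != 0 by exact: (chart_di_neq0 ch (chart_graph_ball ch yr)).
  have /within_epsP/(_ (p y) (conj pC dp) e e0)[d d0 hd] := cq.
  exists d => // t tI td rt; apply/ltW/hd.
    split; first by apply: subset_closure; rewrite OmegaE.
    exact: (chart_di_neq0 ch (inB t tI)).
  rewrite pE ptcB subrr; apply: le_lt_trans td; apply: ptc_norm_le => //.
  by rewrite normr0.
have lc k : 0 < k -> continuous (fun t : R => w (ptc i (vec3 y) t) *
    (- k * dtheta (k * rho (ptc i (vec3 y) t)))).
  move=> k0 t; have := layer_weight_continuous k0 w_cont => H.
  by apply: (@cat_comp _ t _ _ (fun t => ptc i (vec3 y) t) (layer_weight k w)); [exact: cpt|exact: H].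
have ge t : zi - h <= t <= zi + h -> c <= s * partial i rho (ptc i (vec3 y) t).
  by move=> /inB; exact: (chart_di ch).
split=> [k k0|e e0].
  rewrite inner_in //.
  exact: (layer_bound hlt c0 (chart_s ch) r_der dr_cont ge
    (chart_bot ch yr) (chart_top ch yr) wCt lc k0).
have [K hK] := layer_limit hlt c0 (chart_s ch) r_der dr_cont ge
  (chart_bot ch yr) (chart_top ch yr) rdist lc wl e0.
by exists K => k /hK[k0 H]; split => //; rewrite inner_in.
Qed.

Let inner_measurable k : 0 < k -> measurable_fun (chart_base z i r) (inner k).
Proof.
move=> k0; have [M' hM'] := layer_weight_support.
have cl := layer_weight_continuous k0 w_cont.
have [C C0 hC] := continuous_vanishes_bounded cl (hM' k w k0).
have [_ /(_ i) hi] := bounded_integrable_vol (csupp_measurable cl) hC (hM' k w k0).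
apply: measurable_funTS.
apply: (@measurableT_comp _ _ _ _ _ _ (@fine R) _ (fubini_F leb (EFin \o (fun q => layer_weight k w (ins i q))))).
  exact: fine_measurable.
exact: (measurable_fubini_F hi).
Qed.

(** The inner integrals tend to $w/|\partial_i\rho|$ on the graph, which is $w/|\nabla\rho|$ times
    the area element [chart_J]; dominated convergence over the bounded base concludes. *)
Lemma chart_vol_limit :
  (fun n => vol (layer_weight n.+1%:R w)) @ \oo -->
  Rintegral sigma (bdry Omega) (fun x => w x / gradnorm rho x).
Proof.
have [C C0 wC] := w_bound; have c0 := chart_c ch.
have volE n : vol (layer_weight n.+1%:R w) = Rintegral leb3 (chart_base z i r) (inner n.+1%:R).
  have k0 : 0 < n.+1%:R :> R by [].
  have [M' hM'] := layer_weight_support.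
  have cl := layer_weight_continuous k0 w_cont.
  have [C' C'0 hC] := continuous_vanishes_bounded cl (hM' _ w k0).
  rewrite (vol_fubini i (csupp_measurable cl) hC (hM' _ w k0)) [RHS]Rintegral_mkcond.
  apply: eq_Rintegral => y _; rewrite patchE; case: ifPn => // /negP yb.
  by apply: inner_out => /mem_set.
rewrite (_ : (fun n => _) = fun n => Rintegral leb3 (chart_base z i r) (inner n.+1%:R)); last first.
  by apply/funext => n; exact: volE.
have -> : Rintegral sigma (bdry Omega) (fun x => w x / gradnorm rho x) =
    Rintegral leb3 (chart_base z i r) (fun y => w (p y) / `|partial i rho (p y)|).
  transitivity (Rintegral sigma (chart_graph z i r g) (fun x => w x / gradnorm rho x)).
    rewrite Rintegral_mkcond [RHS]Rintegral_mkcond; apply: eq_Rintegral => x _.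
    rewrite !patchE; case: ifPn => [/set_mem xb|/negP xb]; case: ifPn => [/set_mem xg|/negP xg] //.
      rewrite w_supp ?mul0r // leNgt; apply/negP => xr; apply/xg/mem_set.
      apply: (ball_bdry_chart_graph rho_C1 OmegaE Omega_open ch); split => //.
      by rewrite -ball_normE /ball_ /= distrC.
    by case: xb; apply/mem_set/(chart_graph_bdry rho_C1 OmegaE Omega_open ch).
  have gB x : chart_graph z i r g x -> closure Omega x /\ c <= gradnorm rho x.
    move=> xg; have [xC _] := chart_graph_bdry rho_C1 OmegaE Omega_open ch xg.
    split=> //; apply: le_trans (gradnorm_ge rho i x); apply: (chart_di_norm ch).
    by case: xg => y /chart_baseP yr <-; exact: (chart_graph_ball ch yr).
  have mwg : measurable_fun (chart_graph z i r g) (fun x => w x / gradnorm rho x).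
    apply: within_continuous_measurable_borel4; first exact: (measurable_chart_graph rho_C1 ch).
    move=> x; apply: (@catM _ (subspace _)).
      by apply: (continuous_subspaceW _ w_cont) => y /gB[].
    apply: (@continuous_in_subspaceT _ _ _ (fun x => (gradnorm rho x)^-1)) => y'.
    rewrite inE => /gB[_ cg]; apply: catV; last exact: gradnorm_continuous.
    by rewrite gt_eqF // (lt_le_trans c0).
  rewrite (chart_Rintegral rho_C1 OmegaE Omega_open sigma_surface ch (C := C / c) mwg).
    apply: eq_Rintegral => y /set_mem yb; have /chart_baseP yr := yb.
    have [_ cg] := gB (p y) (ex_intro2 _ _ (vec3 y) yb erefl).
    rewrite /chart_J -/(p y) mulrA divfK // gt_eqF //; exact: lt_le_trans cg.
  move=> x /gB[xC cg]; rewrite normrM normfV ler_pM ?invr_ge0 //; first exact: wC.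
  rewrite lef_pV2 ?posrE // ?normr_gt0; last by rewrite gt_eqF // (lt_le_trans c0).
  exact: le_trans (ler_norm _).
apply: (Rintegral_dominated (C := C / c)).
- exact: (measurable_chart_base ch).
- exact: (chart_base_lty ch).
- by move=> n; exact: inner_measurable.
- by move=> n y yb; have [H _] := chart_layer wC yb; exact: H.
move=> y yb; have [_ H] := chart_layer wC yb.
apply/cvgrPdist_le => e /H[K hK]; have := nbhs_infty_ger K.
apply: filterS => n Kn; rewrite distrC; apply: (hK n.+1%:R _).2.
by apply: le_trans Kn _; rewrite ler_nat.
Qed.
End InChart.

Hypothesis drho_neq0 : forall q, bdry Omega q -> exists v, 'd rho q v != 0.

Lemma bdry_chart z : bdry Omega z ->
  exists i s c M h r g, chart rho z i s c M h r g.
Proof.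
move=> bz; have [_ rz] := (bdryP rho_C1 OmegaE Omega_open z).1 bz.
have [i di] : exists i, partial i rho z != 0.
  have [v dv] := drho_neq0 bz; apply: contrapT => H; case/negP: dv.
  have [dr _] := rho_C1 (x := z) I; rewrite diff_partialE // /dlin big1 // => k _.
  by apply/eqP; rewrite mulf_eq0; apply/orP; left; apply: contrapT => /negP h; apply: H; exists k.
by exists i; exact: chart_exists.
Qed.

Lemma gradnorm_bdry_gt0 x : bdry Omega x -> 0 < gradnorm rho x.
Proof.
move=> /bdry_chart[i [s [c [M [h [r [g ch]]]]]]].
apply: lt_le_trans (chart_c ch) _; apply: le_trans (gradnorm_ge rho i x).
by apply: (chart_di_norm ch); rewrite subrr normr0; apply: le_trans (ltW (chart_r ch)) (chart_rh ch).
Qed.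

Lemma bdry_cover : exists n (z : 'I_n -> E4) (r : 'I_n -> R),
  (forall j, bdry Omega (z j) /\ exists i s c M h g, chart rho (z j) i s c M h (r j) g) /\
  forall x, bdry Omega x -> exists j, `|x - z j| < r j.
Proof.
have /choice[rad radP] (z : E4) : exists r : R, bdry Omega z ->
    exists i s c M h g, chart rho z i s c M h r g.
  have [bz|nbz] := pselect (bdry Omega z); last by exists 0.
  have [i [s [c [M [h [r [g ch]]]]]]] := bdry_chart bz.
  by exists r => _; exists i, s, c, M, h, g.
have rad0 z : bdry Omega z -> 0 < rad z.
  by move=> /radP[i [s [c [M [h [g ch]]]]]]; exact: chart_r ch.
have := @bdry_compact _ _ Omega_bounded; rewrite compact_cover.
move=> /(_ E4 (bdry Omega) (fun z => ball z (rad z)))[].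
- by move=> z /rad0 z0; exact: ball_open.
- by move=> x bx; exists x => //; apply: ballxx; exact: rad0.
move=> D DS Dcov; pose e := finmap.enum_fset D.
exists (size e), (fun j => tnth (in_tuple e) j), (fun j => rad (tnth (in_tuple e) j)).
have eD j : bdry Omega (tnth (in_tuple e) j).
  by apply/set_mem/DS; exact: mem_tnth.
split=> [j|x /Dcov[z /= zD]]; first by split; [exact: eD|exact/radP/eD].
rewrite -ball_normE /ball_ /= distrC => xz.
have /tnthP[j jE] : z \in in_tuple e by [].
by exists j; rewrite -jE.
Qed.

Lemma measurable_bdry : measurable (bdry Omega : set (borel4 R)).
Proof. by apply: closed_measurable_borel4; exact: bdry_closed. Qed.

Lemma bdry_lty : (sigma (bdry Omega) < +oo)%E.
Proof.
have [n [z [r [zr cov]]]] := bdry_cover.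
have /choice[A HA] (j : 'I_n) : exists A : set (borel4 R),
    [/\ measurable A, (sigma A < +oo)%E & bdry Omega `&` ball (z j) (r j) `<=` A].
  have [_ [i [s [c [M [h [g ch]]]]]]] := zr j.
  exists (chart_graph (z j) i (r j) g); split.
  - exact: (measurable_chart_graph rho_C1 ch).
  - exact: (chart_graph_lty rho_C1 OmegaE Omega_open sigma_surface ch).
  - exact: (ball_bdry_chart_graph rho_C1 OmegaE Omega_open ch).
have [mA muA] := measure_bigsetU_lty (mu := sigma) (index_enum 'I_n)
  (fun j => let: And3 mA _ _ := HA j in mA) (fun j => let: And3 _ muA _ := HA j in muA).
apply: le_lt_trans muA; apply: le_measure; rewrite ?inE //; first exact: measurable_bdry.
move=> x xS; have [j xj] := cov x xS; have [_ _ sub] := HA j.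
rewrite (bigD1 j) //=; left; apply: sub; split => //.
by rewrite -ball_normE /ball_ /= distrC.
Qed.

Lemma bdry_integrable (w : E4 -> R) : {within bdry Omega, continuous w} ->
  sigma.-integrable (bdry Omega) (EFin \o (w : borel4 R -> R)).
Proof.
move=> cw; have [C C0 hC] := within_continuous_bounded (bdry_compact Omega_bounded) cw.
apply: (bounded_integrable measurable_bdry bdry_lty _ hC).
exact: within_continuous_measurable_borel4 measurable_bdry cw.
Qed.

Lemma within_bdry_grad (w : E4 -> R) : {within closure Omega, continuous w} ->
  {within bdry Omega, continuous (fun x => w x / gradnorm rho x)}.
Proof.
move=> cw x; apply: (@catM _ (subspace _)).
  by apply: (continuous_subspaceW _ cw) => y [].
apply: (@continuous_in_subspaceT _ _ _ (fun x => (gradnorm rho x)^-1)) => y.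
rewrite inE => bY; apply: catV; last exact: gradnorm_continuous.
by rewrite gt_eqF // gradnorm_bdry_gt0.
Qed.

(** Continuity is enough, because these functions only multiply the weight and are never
    differentiated. They sum to 1 on a whole collar of the boundary, so that a thin layer is the
    exact sum of its pieces. *)
Lemma partition_of_unity : exists n (chi : 'I_n -> E4 -> R) (e : R), [/\ 0 < e,
  forall j, continuous (chi j),
  forall j, exists z i s c M h r g, chart rho z i s c M h r g /\
    forall x, r <= `|x - z| -> chi j x = 0 &
  forall x, closure Omega x -> - e < rho x -> \sum_j chi j x = 1].
Proof.
have [n [z [r [zr cov]]]] := bdry_cover.
pose psi j x := Num.max 0 (r j - `|x - z j|).
have psi_cont j : continuous (psi j).
  move=> x; apply: cat_max; first exact: cat_cst.
  by apply: catB; [exact: cat_cst|exact: continuous_dist].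
have psi0 j x : 0 <= psi j x by rewrite le_max lexx.
pose Psi x := \sum_j psi j x.
have Psi_cont : continuous Psi by move=> x; apply: cat_sum => j; exact: psi_cont.
have Psi_gt0 x : bdry Omega x -> 0 < Psi x.
  move=> /cov[j xj]; rewrite /Psi (bigD1 j) //= ltr_pwDl ?sumr_ge0 //.
  by rewrite lt_max subr_gt0 xj orbT.
have [C C0 hC] : exists2 C, 0 < C & forall x, bdry Omega x -> `|(Psi x)^-1| <= C.
  apply: within_continuous_bounded; first exact: bdry_compact.
  apply: continuous_in_subspaceT => x; rewrite inE => /Psi_gt0 Px.
  by apply: catV; [rewrite gt_eqF|exact: Psi_cont].
(* On the boundary [Psi] is at least [C^-1], hence above [m]; the denominator [Num.max (Psi x) m] is
   then never zero and equals [Psi] near the boundary. *)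
pose m := C^-1 / 2.
have m0 : 0 < m by rewrite divr_gt0 ?invr_gt0.
have Psi_m x : bdry Omega x -> m < Psi x.
  move=> xS; have P0 := Psi_gt0 x xS; have := hC x xS.
  rewrite gtr0_norm ?invr_gt0 // => PC; apply: (@lt_le_trans _ _ C^-1).
    by rewrite /m ltr_pdivrMr // mulrDr mulr1 ltrDl invr_gt0.
  by rewrite -[leRHS]invrK lef_pV2 ?posrE // invr_gt0.
(* The compact part of the closure where [Psi] is small misses the boundary, so [rho] has a negative
   upper bound on it, whose size becomes the width [e] of the collar. *)
pose K := closure Omega `&` [set x | Psi x <= m].
have cK : compact K.
  apply: (@subclosed_compact _ _ (closure Omega)); last by move=> x [].
    apply: closedI; first exact: closed_closure.
    have := @closed_comp _ _ Psi [set t : R | t <= m].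
    by apply; [move=> y _; exact: Psi_cont|exact: closed_le].
  exact: closure_compact.
have K_lt0 x : K x -> rho x < 0.
  move=> [xC /= xm]; have [|xS] := closure_cases Omega_open xC; first by rewrite OmegaE.
  by have := Psi_m x xS; rewrite ltNge xm.
have [C' C'0 hC'] : exists2 C, 0 < C & forall x, K x -> `|(rho x)^-1| <= C.
  apply: within_continuous_bounded => //.
  apply: continuous_in_subspaceT => x; rewrite inE => /K_lt0 Px.
  by apply: catV; [rewrite lt_eqF|exact: rho_continuous].
exists n, (fun j x => psi j x / Num.max (Psi x) m), C'^-1; split.
- by rewrite invr_gt0.
- move=> j x; apply: catM; first exact: psi_cont.
  apply: catV; first by rewrite gt_eqF // lt_max m0 orbT.
  by apply: cat_max; [exact: Psi_cont|exact: cat_cst].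
- move=> j; have [_ [i [s [c [M [h [g ch]]]]]]] := zr j.
  exists (z j), i, s, c, M, h, (r j), g; split => // x rx.
  by rewrite /psi max_l ?mul0r // subr_le0.
move=> x xC rx; rewrite -mulr_suml -/(Psi x).
have Pm : m < Psi x.
  rewrite ltNge; apply/negP => Pm; have xK : K x by split.
  have r0 := K_lt0 x xK; have := hC' x xK.
  rewrite normfV ltr0_norm // => H; move: rx; rewrite ltNge => /negP; apply.
  by rewrite -lerN2 opprK -[leRHS]invrK lef_pV2 ?posrE ?invr_gt0 ?oppr_gt0.
by rewrite max_l ?divff // ?(gt_eqF (lt_trans m0 Pm)) // ltW.
Qed.

(** The partition localises [w] to charts, where [chart_vol_limit] applies; the pieces add up as
    soon as the layer fits into the collar. *)
Theorem layer_limit_surface (w : E4 -> R) : {within closure Omega, continuous w} ->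
  (fun n => vol (layer_weight n.+1%:R w)) @ \oo -->
  Rintegral sigma (bdry Omega) (fun x => w x / gradnorm rho x).
Proof.
move=> cw; have [n [chi [e [e0 chi_cont chi_chart chi1]]]] := partition_of_unity.
pose v j x := w x * chi j x.
have cv j : {within closure Omega, continuous (v j)}.
  move=> x; apply: (@catM _ (subspace _)); first exact: cw.
  by apply: continuous_subspaceT; exact: chi_cont.
have lim j : (fun n => vol (layer_weight n.+1%:R (v j))) @ \oo -->
    Rintegral sigma (bdry Omega) (fun x => v j x / gradnorm rho x).
  have [z [i [s [c [M [h [r [g [ch sj]]]]]]]]] := chi_chart j.
  by apply: (chart_vol_limit ch) => // x /sj; rewrite /v => ->; rewrite mulr0.
have [M hM] := layer_weight_support.
have -> : Rintegral sigma (bdry Omega) (fun x => w x / gradnorm rho x) =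
    \sum_j Rintegral sigma (bdry Omega) (fun x => v j x / gradnorm rho x).
  have [_ <-] := Rintegral_sum_fun (index_enum 'I_n) measurable_bdry
    (fun j => bdry_integrable (within_bdry_grad (cv j))).
  apply: eq_Rintegral => x /set_mem xS; rewrite -mulr_suml -mulr_sumr.
  have [xC rx] := (bdryP rho_C1 OmegaE Omega_open x).1 xS.
  by rewrite chi1 ?mulr1 // rx oppr_lt0.
have : (fun n => \sum_j vol (layer_weight n.+1%:R (v j))) @ \oo -->
   \sum_j Rintegral sigma (bdry Omega) (fun x => v j x / gradnorm rho x).
  by apply: cvg_big => [|j _]; [exact: add_continuous|exact: lim].
apply: cvg_trans; apply: near_eq_cvg.
(* The layer of index [k] lies where $\rho > -2/(k+1)$, inside the collar from this rank on. *)
have := nbhs_infty_ger (2 / e); apply: filterS => k ke.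
have k0 : 0 < k.+1%:R :> R by [].
rewrite -(vol_sum (M := M)); last 2 first.
- by move=> j; exact: layer_weight_continuous.
- by move=> j; exact: hM.
congr vol; apply/funext => x.
rewrite /layer_weight -mulr_suml -mulr_sumr.
have [->|d0] := eqVneq (dtheta (k.+1%:R * rho x)) 0; first by rewrite !mulr0.
have /andP[d1 d2] := dtheta_neq0 d0.
have r0 : rho x < 0 by rewrite -(pmulr_rlt0 _ k0); lra.
have xO : Omega x by rewrite OmegaE.
rewrite chi1 ?mulr1 //; first exact: subset_closure.
have ke' : 2 / e <= k.+1%:R by apply: le_trans ke _; rewrite ler_nat.
move: ke'; rewrite ler_pdivrMr // => ke'.
rewrite -(ltr_pM2l k0); lra.
Qed.

Lemma within_grad_rho (V : 'I_4 -> E4 -> R) :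
  (forall a, {within closure Omega, continuous (V a)}) ->
  {within closure Omega, continuous (fun x => \sum_a V a x * partial a rho x)}.
Proof.
move=> cV x; apply: (@cat_sum _ (subspace _)) => a; apply: (@catM _ (subspace _)).
  exact: cV.
by apply: continuous_subspaceT; exact: partial_rho_continuous.
Qed.

(** Near a point with $k\rho > -1$ the product is identically zero; every other point lies in
    [Omega], where the product rule applies. The truncated field is thus $C^1$ on the whole
    space. *)
Let cutoff_C1d k (v : E4 -> R) : 0 < k -> C1_on Omega v ->
  C1d setT (fun x => theta (k * rho x) * v x)
    (fun b x => theta (k * rho x) * partial b v x + k * dtheta (k * rho x) * partial b rho x * v x).
Proof.
move=> k0 vC1 x _; have crho : C1d setT rho (fun b => partial b rho) by exact: C1_on_C1d.
have ckr : continuous (fun x => k * rho x).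
  by move=> y; apply: catM; [exact: cat_cst|exact: rho_continuous].
have [kx|kx] := ltP (- 1) (k * rho x).
  pose D := [set y | -1 < k * rho y].
  have oD : open D.
    have := @open_comp _ _ (fun x : E4 => k * rho x) [set t : R | -1 < t].
    by apply; [move=> y _; exact: ckr|exact: open_gt].
  have dz y : D y -> dtheta (k * rho y) = 0.
    move=> Dy; apply/eqP; apply: contraT => /dtheta_neq0/andP[_ h].
    by have := lt_trans Dy h; rewrite ltxx.
  apply: (C1d_eq oD _ _ (@C1d_cst _ _ D 0)) => // [y|b y]; rewrite inE => Dy.
    by rewrite theta0 ?mul0r // ltW.
  by rewrite theta0 ?(ltW Dy) // dz // !mul0r mulr0 !mul0r addr0.
have Ox : Omega x by rewrite OmegaE /= -(pmulr_rlt0 _ k0); lra.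
have ct : C1d Omega (fun x => theta (k * rho x)) (fun b x => dtheta (k * rho x) * (k * partial b rho x)).
  apply: C1d_comp => [y _|y _|]; [exact: theta_derive|exact: dtheta_continuous|].
  by apply: C1dZ; apply: C1d_sub crho.
apply: (C1d_eq Omega_open _ _ (C1dM ct (C1_on_C1d vC1))) => // b y _.
by ring.
Qed.

(** Once [2 <= k * m] the cutoff equals 1 on the support of [h], so [h] is exactly the layer weight
    plus the divergence of the truncated field, which integrates to 0. The layer integrals are
    therefore eventually equal to [vol h]. A nonzero [h] serves in [flux_inside]. *)
Theorem divergence_surface (V : 'I_4 -> E4 -> R) (h : E4 -> R) m :
  (forall a, {within closure Omega, continuous (V a)}) ->
  (forall a, C1_on Omega (V a)) ->
  (forall x, Omega x -> \sum_a partial a (V a) x = h x) ->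
  continuous h -> 0 < m -> (forall x, - m < rho x -> h x = 0) ->
  Rintegral sigma (bdry Omega) (fun x => (\sum_a V a x * partial a rho x) / gradnorm rho x) = vol h.
Proof.
move=> cV VC1 divV ch m0 hm; have cw := within_grad_rho cV.
pose w := fun x => \sum_a V a x * partial a rho x.
have lim : (fun n => vol (layer_weight n.+1%:R w)) @ \oo --> vol h.
  have [M hM] := rho_far.
  have h_out : vanishes_out M h.
    by move=> x /hM rx; apply: hm; apply: lt_le_trans rx; rewrite oppr_lt0.
  apply: cvg_near_cst; have := nbhs_infty_ger (2 / m); apply: filterS => n mn.
  have k0 : 0 < n.+1%:R :> R by [].
  have kn : 2 <= n.+1%:R * m.
    by rewrite -ler_pdivrMr //; apply: le_trans mn _; rewrite ler_nat.
  move: k0 kn; move: (n.+1%:R : R) => k k0 km.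
  pose u a x := theta (k * rho x) * V a x.
  pose du a b x := theta (k * rho x) * partial b (V a) x +
    k * dtheta (k * rho x) * partial b rho x * V a x.
  have udu a : C1d setT (u a) (du a) by exact: cutoff_C1d.
  have u_out a : vanishes_out M (u a).
    move=> x /hM rx; rewrite /u theta0 ?mul0r //; apply: (@le_trans _ _ 0); first by lra.
    by rewrite mulr_ge0 // ltW.
  have duc a : continuous (du a a) by move=> x; have [_ _] := udu a x I; exact.
  have du_out a : vanishes_out M (du a a) by exact: (C1d_vanishes_out _ (udu a) (u_out a)).
  have du0 : vol (fun x => \sum_a du a a x) = 0.
    rewrite (vol_sum (M := M)) // big1 // => a _.
    exact: (vol_partial a (udu a) (u_out a)).
  have hE : h = fun x => layer_weight k w x + \sum_a du a a x.
    apply/funext => x; rewrite big_split /= -mulr_sumr.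
    have -> : \sum_a k * dtheta (k * rho x) * partial a rho x * V a x = k * dtheta (k * rho x) * w x.
      by rewrite mulr_sumr; apply: eq_bigr => a _; rewrite -!mulrA; congr (_ * (_ * _)); rewrite mulrC.
    rewrite /layer_weight mulNr mulrN [w x * _]mulrC addrCA addNr addr0.
    have [rx|rx] := ltP (rho x) 0.
      rewrite divV ?OmegaE //; have [hx|hx] := ltP (- m) (rho x); first by rewrite hm ?mulr0.
      by rewrite theta1 ?mul1r //; nra.
    rewrite hm ?theta0 ?mul0r //; last by apply: lt_le_trans rx; rewrite oppr_lt0.
    by apply: (@le_trans _ _ 0); [lra|rewrite mulr_ge0 // ltW].
  rewrite [in RHS]hE (volD (M := M)) ?du0 ?addr0 //.
  - exact: layer_weight_continuous.
  - by move=> x /hM; exact: layer_weight_out.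
  - by move=> x; apply: cat_sum => a; exact: duc.
  - by move=> x Mx; rewrite big1 // => a _; exact: du_out.
exact: (cvg_unique _ (layer_limit_surface cw) lim).
Qed.
End SurfaceLayer.

(** * Boundary operators in real coordinates *)

Section Trilinear.
Variable R : realType.
Local Notation E4 := 'rV[R]_4.
Implicit Types (f n p : 'I_4 -> R).

(* Component [k] of [|grad rho| conj f (dbar_n - j L) phi] for real [phi], with [n] and [p]
   the gradients of [rho] and [phi]. *)
Definition tri (k : 'I_4) f n p : R :=
  let b0 := n 0 * p 0 + n 1 * p 1 + n 2 * p 2 + n 3 * p 3 in
  let b1 := n 0 * p 1 - n 1 * p 0 + n 2 * p 3 - n 3 * p 2 in
  let b2 := n 0 * p 2 - n 2 * p 0 + n 3 * p 1 - n 1 * p 3 in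
  let b3 := n 2 * p 1 + n 3 * p 0 - n 0 * p 3 - n 1 * p 2 in
  2^-1 * [:: f 0 * b0 + f 1 * b1 + f 2 * b2 + f 3 * b3;
    f 0 * b1 - f 1 * b0 + f 3 * b2 - f 2 * b3;
    f 0 * b2 + f 1 * b3 - f 2 * b0 - f 3 * b1;
    f 0 * b3 - f 1 * b2 - f 3 * b0 + f 2 * b1]`_k.

(* Component [k] of the product [q i]; [tri] is used at complex [phi] through it. *)
Definition mul_i (k : 'I_4) (q : 'I_4 -> R) : R := [:: - q 1; q 0; q 3; - q 2]`_k.

Definition unit4 (a b : 'I_4) : R := (a == b)%:R.

(** Linearity in the normal shows the boundary integrand as the flux of the field with components
    [tri k f (unit4 a) p], the form in which [divergence_surface] applies. *)
Lemma tri_normal k f n p : tri k f n p = \sum_a n a * tri k f (unit4 a) p.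
Proof.
rewrite sum4E; move: k; apply: ord4P; rewrite /tri /unit4 /=; ring.
Qed.

Lemma tri_bilinear k f n p :
  tri k f n p = \sum_b \sum_c tri k (unit4 b) n (unit4 c) * (f b * p c).
Proof.
rewrite !sum4E; move: k; apply: ord4P; rewrite /tri /unit4 /=; ring.
Qed.

Lemma normc_sqr (x : R[i]) : Normc.normc x ^+ 2 = complex.Re x ^+ 2 + complex.Im x ^+ 2.
Proof. by case: x => a b /=; rewrite sqr_sqrtr // addr_ge0 ?sqr_ge0. Qed.

Lemma sum2E (V : nmodType) (E : 'I_2 -> V) : \sum_k E k = E 0 + E 1.
Proof.
by rewrite !big_ord_recl big_ord0 addr0; congr (_ + E _); exact/val_inj.
Qed.

Lemma half_complex (a b : R) : Complex a b / 2 = Complex (a / 2) (b / 2).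
Proof.
have -> : (2 : R[i])^-1 = real_complex R 2^-1 by rewrite fmorphV rmorph_nat.
by apply/eqP; rewrite eq_complex /= !mulr0 subr0 add0r !eqxx.
Qed.

Lemma dzE (u v : 'I_4 -> R) (d : 'I_4 -> R[i]) : (forall k, d k = Complex (u k) (v k)) ->
  (dz d 0 = Complex ((u 0 + v 1) / 2) ((v 0 - u 1) / 2)) *
  (dz d 1 = Complex ((u 2 + v 3) / 2) ((v 2 - u 3) / 2)) *
  (dzbar d 0 = Complex ((u 0 - v 1) / 2) ((v 0 + u 1) / 2)) *
  (dzbar d 1 = Complex ((u 2 - v 3) / 2) ((v 2 + u 3) / 2)).
Proof.
move=> dE; rewrite /dz /dzbar /= !dE -!half_complex; do !split; congr (_ / _);
  apply/eqP; rewrite eq_complex /=; apply/andP; split; apply/eqP; ring.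
Qed.

Lemma grad_realE (rho : E4 -> R) x k : grad_real rho x k = Complex (partial k rho x) 0.
Proof. by []. Qed.

Lemma norm_dbarE (rho : E4 -> R) x : norm_dbar rho x = gradnorm rho x / 2.
Proof.
rewrite /norm_dbar /gradnorm -[X in _ / X](ger0_norm (_ : 0 <= 2 :> R)) //.
rewrite -sqrtr_sqr -sqrtrV ?sqr_ge0 // -sqrtrM; last by apply: sumr_ge0 => k _; exact: sqr_ge0.
have E := dzE (grad_realE rho x).
congr Num.sqrt; rewrite sum2E [in RHS]sum4E (E.1.2) (E.2) {E}.
move: (partial 0 rho x) (partial 1 rho x) (partial 2 rho x) (partial 3 rho x) => a b c d.
by rewrite !normc_sqr [complex.Re _]/= [complex.Im _]/= [complex.Re _]/= [complex.Im _]/=; field.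
Qed.

Lemma qmul_conjE (f b : E4) :
  [/\ qmul (qconj f) b 0 0 = f 0 0 * b 0 0 + f 0 1 * b 0 1 + f 0 2 * b 0 2 + f 0 3 * b 0 3,
      qmul (qconj f) b 0 1 = f 0 0 * b 0 1 - f 0 1 * b 0 0 + f 0 3 * b 0 2 - f 0 2 * b 0 3,
      qmul (qconj f) b 0 2 = f 0 0 * b 0 2 + f 0 1 * b 0 3 - f 0 2 * b 0 0 - f 0 3 * b 0 1 &
      qmul (qconj f) b 0 3 = f 0 0 * b 0 3 - f 0 1 * b 0 2 - f 0 3 * b 0 0 + f 0 2 * b 0 1].
Proof.
rewrite /qmul /qconj /cquat; split; rewrite !mxE /= /z1 /z2 !mxE /=;
  move: (f 0 0) (f 0 1) (f 0 2) (f 0 3) (b 0 0) (b 0 1) (b 0 2) (b 0 3) => *; ring.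
Qed.

(* [G] stands for [|grad rho| = 2 |dbar rho|]. *)
Let complex_row (n u v : 'I_4 -> R) (G : R) : G != 0 ->
  let dn := Complex (2 / G) 0 *
    (Complex ((n 0 + 0) / 2) ((0 - n 1) / 2) * Complex ((u 0 - v 1) / 2) ((v 0 + u 1) / 2) +
     Complex ((n 2 + 0) / 2) ((0 - n 3) / 2) * Complex ((u 2 - v 3) / 2) ((v 2 + u 3) / 2)) in
  let L := Complex (2 / G) 0 *
    (Complex ((n 2 - 0) / 2) ((0 + n 3) / 2) * Complex ((u 0 - v 1) / 2) ((v 0 + u 1) / 2) -
     Complex ((n 0 - 0) / 2) ((0 + n 1) / 2) * Complex ((u 2 - v 3) / 2) ((v 2 + u 3) / 2)) in
  let r (p : 'I_4 -> R) : seq R :=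
    [:: n 0 * p 0 + n 1 * p 1 + n 2 * p 2 + n 3 * p 3;
        n 0 * p 1 - n 1 * p 0 + n 2 * p 3 - n 3 * p 2;
        n 0 * p 2 - n 2 * p 0 + n 3 * p 1 - n 1 * p 3;
        n 2 * p 1 + n 3 * p 0 - n 0 * p 3 - n 1 * p 2] in
  forall b, b = cquat dn 0 - qmul qj (cquat L 0) ->
  [/\ b 0 0 = ((r u)`_0 - (r v)`_1) / (2 * G), b 0 1 = ((r u)`_1 + (r v)`_0) / (2 * G),
      b 0 2 = ((r u)`_2 + (r v)`_3) / (2 * G) & b 0 3 = ((r u)`_3 - (r v)`_2) / (2 * G)].
Proof.
move=> G0 dn L r b bE.
have {}bE k : b 0 k = cquat dn 0 0 k - qmul qj (cquat L 0) 0 k by rewrite bE !mxE.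
rewrite !bE {bE b}.
rewrite /r /dn /L /qmul /qj /cquat; move: (n 0) (n 1) (n 2) (n 3) (u 0) (u 1) (u 2) (u 3)
  (v 0) (v 1) (v 2) (v 3) => *.
by split; rewrite !mxE /= /z1 /z2 !mxE /=; field.
Qed.

Let tri_row (f b : E4) (n u v : 'I_4 -> R) (G : R) k : G != 0 ->
  b = cquat (Complex (2 / G) 0 *
    (Complex ((n 0 + 0) / 2) ((0 - n 1) / 2) * Complex ((u 0 - v 1) / 2) ((v 0 + u 1) / 2) +
     Complex ((n 2 + 0) / 2) ((0 - n 3) / 2) * Complex ((u 2 - v 3) / 2) ((v 2 + u 3) / 2))) 0
   - qmul qj (cquat (Complex (2 / G) 0 *
    (Complex ((n 2 - 0) / 2) ((0 + n 3) / 2) * Complex ((u 0 - v 1) / 2) ((v 0 + u 1) / 2) -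
     Complex ((n 0 - 0) / 2) ((0 + n 1) / 2) * Complex ((u 2 - v 3) / 2) ((v 2 + u 3) / 2))) 0) ->
  qmul (qconj f) b 0 k = (tri k (f 0) n u + mul_i k (fun l => tri l (f 0) n v)) / G.
Proof.
move=> G0 bE; have [b0 b1 b2 b3] := complex_row G0 bE.
have [q0 q1 q2 q3] := qmul_conjE f b.
move: k; apply: ord4P; rewrite ?q0 ?q1 ?q2 ?q3 b0 b1 b2 b3 /tri /mul_i /=;
  move: (f 0 0) (f 0 1) (f 0 2) (f 0 3) (n 0) (n 1) (n 2) (n 3) (u 0) (u 1) (u 2) (u 3)
  (v 0) (v 1) (v 2) (v 3) => *; by field.
Qed.

(** Complex scalars can be moved to the right: for [phi] equal to u + vi the value is the one at u
    plus the one at v times i, which [mul_i] expresses in components. The halves of the two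
    Wirtinger derivatives and [norm_dbar], which is half of [gradnorm], leave the factor 1/2 of
    [tri]. *)
Lemma boundary_operator (Omega : set E4) (rho : E4 -> R) (phi : E4 -> R[i]) (f : E4) x k :
  0 < gradnorm rho x ->
  (qmul (qconj f) (dbar_n_sub_jL Omega rho phi x)) 0 k =
  (tri k (f 0) (fun a => partial a rho x)
     (fun a => partial_closure Omega a (fun y => complex.Re (phi y)) x) +
   mul_i k (fun l => tri l (f 0) (fun a => partial a rho x)
     (fun a => partial_closure Omega a (fun y => complex.Im (phi y)) x))) / gradnorm rho x.
Proof.
move=> g0; have G0 : gradnorm rho x != 0 by rewrite gt_eqF.
have nE : (real_complex R (norm_dbar rho x))^-1 = Complex (2 / gradnorm rho x) 0.
  by rewrite norm_dbarE -fmorphV /= invf_div.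
have E := dzE (grad_realE rho x).
have E' := dzE (fun k => erefl (grad_closure Omega phi x k)).
apply: tri_row => //.
by rewrite /dbar_n_sub_jL /dbar_n /L_op nE sum2E (E.1.1.1) (E.1.1.2) (E.1.2) (E.2) (E'.1.2) (E'.2).
Qed.

(** [d a b] stands for the derivative along [a] of component [b]; these are the four real components
    of twice $(\partial_{\bar z_1}+j\partial_{\bar z_2})F$. *)
Definition regular_eqs (d : 'I_4 -> 'I_4 -> R) :=
  [/\ d 0 0 - d 1 1 - d 2 2 + d 3 3 = 0, d 0 1 + d 1 0 + d 2 3 + d 3 2 = 0,
      d 0 2 - d 1 3 + d 2 0 - d 3 1 = 0 & d 0 3 + d 1 2 - d 2 1 - d 3 0 = 0].

Let regular_row (d : 'I_4 -> 'I_4 -> R) :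
  cquat (Complex ((d 0 0 - d 1 1) / 2) ((d 0 1 + d 1 0) / 2))
     (Complex ((d 0 2 - d 1 3) / 2) ((d 0 3 + d 1 2) / 2)) +
  qmul qj (cquat (Complex ((d 2 0 - d 3 1) / 2) ((d 2 1 + d 3 0) / 2))
     (Complex ((d 2 2 - d 3 3) / 2) ((d 2 3 + d 3 2) / 2))) = 0 <-> regular_eqs d.
Proof.
rewrite /regular_eqs; move: (d 0 0) (d 0 1) (d 0 2) (d 0 3) (d 1 0) (d 1 1) (d 1 2) (d 1 3)
  (d 2 0) (d 2 1) (d 2 2) (d 2 3) (d 3 0) (d 3 1) (d 3 2) (d 3 3) =>
  d00 d01 d02 d03 d10 d11 d12 d13 d20 d21 d22 d23 d30 d31 d32 d33.
split=> [H|[h0 h1 h2 h3]]; last first.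
  apply/rowP; apply: ord4P; rewrite /qmul /qj /cquat !mxE /= /z1 /z2 !mxE /=; lra.
have H' k := congr1 (fun r : 'rV[R]_4 => r 0 k) H.
move: (H' 0) (H' 1) (H' 2) (H' 3); rewrite /qmul /qj /cquat !mxE /= /z1 /z2 !mxE /=.
by move=> ? ? ? ?; split; lra.
Qed.

Lemma psi_regularP (D : set E4) (F : E4 -> E4) : psi_regular D F <->
  (forall m, C1_on D (fun q => F q 0 m)) /\
  forall q, D q -> regular_eqs (fun a b => partial a (fun y => F y 0 b) q).
Proof.
have key q : cquat (dzbar (grad (fun y => z1 (F y)) q) 0) (dzbar (grad (fun y => z2 (F y)) q) 0)
      + qmul qj (cquat (dzbar (grad (fun y => z1 (F y)) q) 1)
        (dzbar (grad (fun y => z2 (F y)) q) 1)) = 0 <->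
    regular_eqs (fun a b => partial a (fun y => F y 0 b) q).
  have E := dzE (fun k => erefl (grad (fun y => z1 (F y)) q k)).
  have E' := dzE (fun k => erefl (grad (fun y => z2 (F y)) q k)).
  rewrite (E.1.2) (E.2) (E'.1.2) (E'.2) {E E'}.
  exact: (regular_row (fun a b => partial a (fun y => F y 0 b) q)).
split=> -[FC1 H]; split=> // q Dq; [exact: (key q).1 (H q Dq)|exact: (key q).2 (H q Dq)].
Qed.

(** The two groups of terms vanish separately: the derivatives of [F] by the four regularity
    equations, the second derivatives of the potential by symmetry and zero trace. *)
Lemma tri_divergence k (F P : 'I_4 -> R) (dF dP : 'I_4 -> 'I_4 -> R) : regular_eqs dF ->
  (forall a b, dP a b = dP b a) -> \sum_a dP a a = 0 ->
  \sum_a (tri k (dF a) (unit4 a) P + tri k F (unit4 a) (dP a)) = 0.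
Proof.
move=> [r0 r1 r2 r3] sym; rewrite !sum4E => tr.
have e0 : dF 0 0 = dF 1 1 + dF 2 2 - dF 3 3 by lra.
have e1 : dF 0 1 = - dF 1 0 - dF 2 3 - dF 3 2 by lra.
have e2 : dF 0 2 = dF 1 3 - dF 2 0 + dF 3 1 by lra.
have e3 : dF 0 3 = - dF 1 2 + dF 2 1 + dF 3 0 by lra.
have e4 : dP 0 0 = - dP 1 1 - dP 2 2 - dP 3 3 by lra.
move: k; apply: ord4P; rewrite /tri /unit4 /= e0 e1 e2 e3 e4
  (sym 1 0) (sym 2 0) (sym 3 0) (sym 2 1) (sym 3 1) (sym 3 2); ring.
Qed.

Lemma tri_C1d k (D : set E4) (n : 'I_4 -> R) (F P : 'I_4 -> E4 -> R)
    (dF dP : 'I_4 -> 'I_4 -> E4 -> R) :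
  (forall b, C1d D (F b) (dF ^~ b)) -> (forall c, C1d D (P c) (dP ^~ c)) ->
  C1d D (fun x => tri k (F ^~ x) n (P ^~ x))
    (fun a x => tri k ((dF a) ^~ x) n (P ^~ x) + tri k (F ^~ x) n ((dP a) ^~ x)).
Proof.
move=> HF HP.
rewrite (_ : (fun x => tri k (F ^~ x) n (P ^~ x)) = fun x =>
  \sum_b \sum_c tri k (unit4 b) n (unit4 c) * (F b x * P c x)); last first.
  by apply/funext => x; exact: tri_bilinear.
rewrite (_ : (fun a x => _) = fun a x => \sum_b \sum_c tri k (unit4 b) n (unit4 c) *
  (dF a b x * P c x + F b x * dP a c x)); last first.
  apply/funext => a; apply/funext => x.
  rewrite (tri_bilinear k ((dF a) ^~ x)) (tri_bilinear k (F ^~ x)) -big_split.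
  apply: eq_bigr => b _; rewrite -big_split; apply: eq_bigr => c _.
  exact: esym (mulrDr _ _ _).
by apply: C1d_sum => b; apply: C1d_sum => c; apply: C1dZ; exact: C1dM.
Qed.

Lemma tri_continuous (T : topologicalType) (x : T) k (f n p : 'I_4 -> T -> R) :
  (forall a, continuous_at x (f a)) -> (forall a, continuous_at x (n a)) ->
  (forall a, continuous_at x (p a)) ->
  continuous_at x (fun y => tri k (f ^~ y) (n ^~ y) (p ^~ y)).
Proof.
move=> cf cn cp; rewrite (_ : (fun y => _) = fun y => \sum_a n a y *
  \sum_b \sum_c tri k (unit4 b) (unit4 a) (unit4 c) * (f b y * p c y)); last first.
  apply/funext => y; rewrite tri_normal; apply: eq_bigr => a _; congr (_ * _).
  exact: tri_bilinear.
apply: cat_sum => a; apply: catM => //; apply: cat_sum => b; apply: cat_sum => c.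
by apply: catM; [exact: cat_cst|exact: catM].
Qed.
End Trilinear.

(** * Orthogonality satisfied by boundary values of regular functions *)

Section Necessity.
Variables (R : realType) (rho : 'rV[R]_4 -> R) (Omega : set 'rV[R]_4).
Local Notation E4 := 'rV[R]_4.
Hypothesis rho_C1 : C1_on setT rho.
Hypothesis OmegaE : Omega = [set q | rho q < 0].
Hypothesis drho_neq0 : forall q, bdry Omega q -> exists v, 'd rho q v != 0.
Hypothesis Omega_bounded : bounded_set Omega.
Hypothesis Omega_open : open Omega.
Variable sigma : {measure set (borel4 R) -> \bar R}.
Hypothesis sigma_surface : is_surface_measure (bdry Omega) sigma.

(** At a point of the closure the filter of neighbourhoods within [Omega] is proper, so the limit is
    unique and any continuous extension computes it. *)
Lemma partial_closureE u v k x : (forall y, Omega y -> partial k u y = v y) ->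
  {within closure Omega, continuous v} -> closure Omega x ->
  partial_closure Omega k u x = v x.
Proof.
move=> uv cv xC; rewrite /partial_closure; apply: cvg_lim => //.
have PF : ProperFilter (within Omega (nbhs x)).
  apply: Build_ProperFilter => H; have [y [yO /(_ yO)]] := xC _ H.
  by [].
have /subspace_continuousP/(_ x xC) cvx := cv.
have H : v @ within Omega (nbhs x) --> v x.
  apply: cvg_trans cvx => W; rewrite /= !nbhs_filterE /fmap /=.
  exact: (@filterS _ (nbhs x) (nbhs_filter x) _ _ (fun y h yO => h (subset_closure yO))).
move=> W /H.
exact: (@filterS _ (nbhs x) (nbhs_filter x) _ _ (fun y h yO => eq_ind_r W (h yO) (uv y yO))).
Qed.

(** By [tri_divergence] the field [V a] is divergence-free in [Omega], so [divergence_surface]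
    applies with right-hand side 0. *)
Lemma flux_zero (F : E4 -> E4) u (P : 'I_4 -> E4 -> R) k :
  psi_regular Omega F -> (forall b, {within closure Omega, continuous (fun x => F x 0 b)}) ->
  harmonic_on Omega u -> (forall c, {within closure Omega, continuous (P c)}) ->
  (forall c x, Omega x -> partial c u x = P c x) ->
  Rintegral sigma (bdry Omega) (fun x =>
    tri k (F x 0) (fun a => partial a rho x) (P ^~ x) / gradnorm rho x) = 0.
Proof.
move=> /psi_regularP[FC1 Freg] cF [uC1 duC1 lap] cP PE.
pose V a x := tri k (F x 0) (unit4 R a) (P ^~ x).
have VC1d a : C1d Omega (V a) (fun b x =>
    tri k (fun m => partial b (fun y => F y 0 m) x) (unit4 R a) (P ^~ x) +
    tri k (F x 0) (unit4 R a) (fun c => partial b (partial c u) x)).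
  apply: (@tri_C1d R k Omega (unit4 R a) (fun b x => F x 0 b) P (fun b m => partial b (fun y => F y 0 m)) (fun b c => partial b (partial c u))); first by move=> b; exact: C1_on_C1d.
  move=> c; apply: (C1d_eq Omega_open _ _ (C1_on_C1d (duC1 c))) => // x; rewrite inE => xO.
  exact: PE.
rewrite -(vol0 R) -(divergence_surface rho_C1 OmegaE Omega_open Omega_bounded sigma_surface
  drho_neq0 (V := V) (m := 1)) //.
- by apply: eq_Rintegral => x _; rewrite tri_normal; congr (_ / _); apply: eq_bigr => a _; rewrite mulrC.
- move=> a x; apply: (@tri_continuous _ (subspace _) x k (fun b y => F y 0 b)); [by move=> b; exact: cF|by move=> b; exact: cat_cst|by move=> b; exact: cP].
- by move=> a; exact: C1d_C1_on.
- move=> x xO; under eq_bigr => a _ do (have [_ -> _] := VC1d a x xO).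
  apply: tri_divergence; first exact: Freg; last exact: lap.
  by move=> a b; exact: (partialC _ _ Omega_open uC1 duC1 xO).
- by move=> x; exact: cat_cst.
Qed.

Lemma C1_closureE u : C1_closure Omega u -> exists P : 'I_4 -> E4 -> R,
  [/\ forall c, {within closure Omega, continuous (P c)},
      forall c x, Omega x -> partial c u x = P c x &
      forall c x, closure Omega x -> partial_closure Omega c u x = P c x].
Proof.
move=> [_ _ H]; have /choice[P HP] c : exists v, {within closure Omega, continuous v} /\
    forall x, Omega x -> partial c u x = v x.
  by have [v cv uv] := H c; exists v.
have cP c : {within closure Omega, continuous (P c)} by have [] := HP c.
have PE c x : Omega x -> partial c u x = P c x by have [_] := HP c; exact.
exists P; split => // c x xC; apply: partial_closureE => // y; exact: PE.
Qed.

Lemma bdry_tri_integrable (f : E4 -> E4) (P : 'I_4 -> E4 -> R) k :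
  (forall b, {within bdry Omega, continuous (fun x => f x 0 b)}) ->
  (forall c, {within bdry Omega, continuous (P c)}) ->
  sigma.-integrable (bdry Omega) (EFin \o (fun x =>
    tri k (f x 0) (fun a => partial a rho x) (P ^~ x) / gradnorm rho x : R)).
Proof.
move=> cf cP; apply: (bdry_integrable rho_C1 OmegaE Omega_open Omega_bounded sigma_surface drho_neq0).
move=> x; apply: (@catM _ (subspace _)).
  apply: (@tri_continuous _ (subspace _) x k (fun b y => f y 0 b)) => [a|a|a]; [exact: cf| |exact: cP].
  by apply: continuous_subspaceT; exact: partial_rho_continuous.
apply: (@continuous_in_subspaceT _ _ _ (fun x => (gradnorm rho x)^-1)) => y.
rewrite inE => bY; apply: catV; last exact: gradnorm_continuous.
by rewrite gt_eqF // (gradnorm_bdry_gt0 rho_C1 OmegaE Omega_open drho_neq0).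
Qed.

Definition surface_tri k (f : E4 -> E4) (P : 'I_4 -> E4 -> R) : R :=
  Rintegral sigma (bdry Omega) (fun x =>
    tri k (f x 0) (fun a => partial a rho x) (P ^~ x) / gradnorm rho x).

(** Real and imaginary parts of [phi] are integrated separately, with the continuous extensions [P]
    and [Q] of their gradients; [mul_i] permutes components up to sign, so it commutes with the
    integral. *)
Lemma qintegral_tri (f : E4 -> E4) phi (P Q : 'I_4 -> E4 -> R) k :
  (forall b, {within bdry Omega, continuous (fun x => f x 0 b)}) ->
  (forall c, {within closure Omega, continuous (P c)}) ->
  (forall c, {within closure Omega, continuous (Q c)}) ->
  (forall c x, closure Omega x -> partial_closure Omega c (fun y => complex.Re (phi y)) x = P c x) ->
  (forall c x, closure Omega x -> partial_closure Omega c (fun y => complex.Im (phi y)) x = Q c x) ->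
  qintegral sigma (bdry Omega)
    (fun q => qmul (qconj (f q)) (dbar_n_sub_jL Omega rho phi q)) 0 k =
  surface_tri k f P + mul_i k (fun l => surface_tri l f Q).
Proof.
move=> cf cP cQ EP EQ; rewrite /qintegral mxE.
have sub : bdry Omega `<=` closure Omega by move=> x [].
have iP l := bdry_tri_integrable l cf (fun c => continuous_subspaceW sub (cP c)).
have iQ l := bdry_tri_integrable l cf (fun c => continuous_subspaceW sub (cQ c)).
have mS := measurable_bdry Omega.
transitivity (Rintegral sigma (bdry Omega) (fun x =>
    tri k (f x 0) (fun a => partial a rho x) (P ^~ x) / gradnorm rho x +
    mul_i k (fun l => tri l (f x 0) (fun a => partial a rho x) (Q ^~ x) / gradnorm rho x))).
  apply: eq_Rintegral => x /set_mem xS.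
  rewrite boundary_operator; last exact: (gradnorm_bdry_gt0 rho_C1 OmegaE Omega_open drho_neq0).
  have -> : (fun a => partial_closure Omega a (fun y => complex.Re (phi y)) x) = P ^~ x.
    by apply/funext => a; apply: EP; exact: sub.
  have -> : (fun a => partial_closure Omega a (fun y => complex.Im (phi y)) x) = Q ^~ x.
    by apply/funext => a; apply: EQ; exact: sub.
  rewrite mulrDl; congr (_ + _).
  by move: k; apply: ord4P; rewrite /mul_i /= ?mulNr.
have e l : forall c, Rintegral sigma (bdry Omega) (fun x => c * (tri l (f x 0)
    (fun a => partial a rho x) (Q ^~ x) / gradnorm rho x)) = c * surface_tri l f Q.
  by move=> c; rewrite RintegralZl.
have ie l c : sigma.-integrable (bdry Omega) (EFin \o (fun x => c * (tri l (f x 0)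
    (fun a => partial a rho x) (Q ^~ x) / gradnorm rho x) : R)).
  by have := integrableZl mS c (iQ l).
move: k (iP k); apply: ord4P => iPk; rewrite /mul_i /=.
- under eq_Rintegral do rewrite -mulN1r.
  by rewrite RintegralD // e mulN1r.
- by rewrite RintegralD.
- by rewrite RintegralD.
- under eq_Rintegral do rewrite -mulN1r.
  by rewrite RintegralD // e mulN1r.
Qed.

Theorem boundary_orthogonality (f F : E4 -> E4) phi :
  psi_regular Omega F -> {within closure Omega, continuous F} ->
  (forall q, bdry Omega q -> F q = f q) -> {within bdry Omega, continuous f} ->
  Harm1 Omega phi ->
  qintegral sigma (bdry Omega)
    (fun q => qmul (qconj (f q)) (dbar_n_sub_jL Omega rho phi q)) = 0.
Proof.
move=> Freg cF Ff cf [hu hv Cu Cv].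
have [P [cP PE PE']] := C1_closureE Cu; have [Q [cQ QE QE']] := C1_closureE Cv.
have cf' b : {within bdry Omega, continuous (fun x => f x 0 b)}.
  move=> x; apply: (@cat_comp (subspace _) x _ _ f (fun y => y 0 b)); first exact: cf.
  exact: coord_continuous.
have cF' b : {within closure Omega, continuous (fun x => F x 0 b)}.
  move=> x; apply: (@cat_comp (subspace _) x _ _ F (fun y => y 0 b)); first exact: cF.
  exact: coord_continuous.
have z u (U : 'I_4 -> E4 -> R) l : harmonic_on Omega u ->
   (forall c, {within closure Omega, continuous (U c)}) ->
   (forall c x, Omega x -> partial c u x = U c x) -> surface_tri l f U = 0.
  move=> hu' cU UE; rewrite -(flux_zero l Freg cF' hu' cU UE).
  by apply: eq_Rintegral => x /set_mem xS; rewrite Ff.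
apply/rowP => k; rewrite (qintegral_tri k cf' cP cQ PE' QE') mxE.
rewrite (z _ P k hu cP PE) add0r.
by move: k; apply: ord4P; rewrite /mul_i /= (z _ Q _ hv cQ QE) ?oppr0.
Qed.
End Necessity.

(** * The Newton kernel *)

Section NewtonKernel.
Variable R : realType.
Local Notation E4 := 'rV[R]_4.
Implicit Types x : E4.

Definition nsq x : R := \sum_k x 0 k ^+ 2.
Definition newton x : R := (nsq x)^-1.
Definition newton_grad (c : 'I_4) x : R := - 2 * x 0 c * (nsq x)^-1 ^+ 2.
Definition newton_hess (a c : 'I_4) x : R :=
  - 2 * (a == c)%:R * (nsq x)^-1 ^+ 2 + 8 * x 0 a * x 0 c * (nsq x)^-1 ^+ 3.

(** Links the Euclidean square inside the kernel to the sup norm in which all distances are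
    estimated. *)
Lemma nsq_ge x : `|x| ^+ 2 <= nsq x.
Proof.
have s0 : 0 <= nsq x by apply: sumr_ge0 => k _; exact: sqr_ge0.
rewrite -(sqr_sqrtr s0) ler_sqr ?nnegrE ?sqrtr_ge0 //.
apply/rV_norm_leP => [|k]; first exact: sqrtr_ge0.
rewrite -sqrtr_sqr ler_sqrt // /nsq (bigD1 k) //= lerDl.
by apply: sumr_ge0 => l _; exact: sqr_ge0.
Qed.

Lemma nsq_gt0 x : x != 0 -> 0 < nsq x.
Proof.
by move=> x0; apply: lt_le_trans (nsq_ge x); rewrite exprn_gt0 // normr_gt0.
Qed.

Lemma nsqN x : nsq (- x) = nsq x.
Proof. by apply: eq_bigr => k _; rewrite mxE sqrrN. Qed.

Lemma nsq_C1d D : C1d D nsq (fun k x => 2 * x 0 k).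
Proof.
move=> x Dx.
have H : C1d D (fun x : E4 => \sum_(k < 4) x 0 k * x 0 k)
   (fun a x => \sum_(k < 4) ((k == a)%:R * x 0 k + x 0 k * (k == a)%:R)).
  by apply: C1d_sum => k; apply: C1dM; exact: C1d_coord.
move: x Dx; rewrite -/(C1d D nsq (fun k x => 2 * x 0 k)).
rewrite (_ : nsq = fun x : E4 => \sum_(k < 4) x 0 k * x 0 k) //.
rewrite (_ : (fun k x => 2 * x 0 k) = fun a x =>
  \sum_(k < 4) ((k == a)%:R * x 0 k + x 0 k * (k == a)%:R)) //.
apply/funext => a; apply/funext => x; rewrite (bigD1 a) //= big1 ?addr0 ?eqxx.
  by rewrite mul1r mulr1 mulr_natl mulr2n.
by move=> k /negPf ->; rewrite mul0r mulr0 addr0.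
Qed.

Local Notation pt := [set x : E4 | x != 0].

Lemma newton_C1d : C1d pt newton newton_grad.
Proof.
have H := C1dV (fun x (x0 : pt x) => lt0r_neq0 (nsq_gt0 x0)) (@nsq_C1d pt).
rewrite (_ : newton_grad = fun k x => - nsq x ^- 2 * (2 * x 0 k)) //.
apply/funext => k; apply/funext => x; rewrite /newton_grad exprVn; ring.
Qed.

Lemma open_pt : open pt.
Proof.
rewrite (_ : pt = [set x : E4 | 0 < `|x|]); last first.
  by apply/seteqP; split=> x /=; rewrite normr_gt0.
have := @open_comp _ _ (fun x : E4 => `|x|) [set t : R | 0 < t].
by apply; [move=> y _; exact: norm_continuous|exact: open_gt].
Qed.

Lemma newton_grad_C1d c : C1d pt (newton_grad c) (newton_hess ^~ c).
Proof.
have N := C1dV (fun x (x0 : pt x) => lt0r_neq0 (nsq_gt0 x0)) (@nsq_C1d pt).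
have H := C1dZ (- 2) (C1dM (C1d_coord (D := pt) c) (C1dM N N)).
apply: (C1d_eq open_pt _ _ H) => [x _|a x]; first by rewrite /newton_grad; ring.
rewrite inE => /nsq_gt0 x0; rewrite /newton_hess eq_sym.
by field; rewrite gt_eqF.
Qed.

Lemma newton_hess_continuous a c x : x != 0 -> continuous_at x (newton_hess a c).
Proof.
move=> x0; have cx k : continuous_at x (fun x : E4 => x 0 k) by exact: coord_continuous.
have cN : continuous_at x (fun x => (nsq x)^-1).
  by apply: catV; [rewrite gt_eqF // nsq_gt0|exact: (C1d_continuous (@nsq_C1d setT))].
apply: catD; apply: catM.
- by apply: catM; exact: cat_cst.
- exact: catX.
- by apply: catM => //; apply: catM => //; exact: cat_cst.
- exact: catX.
Qed.

Lemma newton_hess_sym a c x : newton_hess a c x = newton_hess c a x.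
Proof. by rewrite /newton_hess eq_sym; ring. Qed.

(** With N the squared length, the trace is $-8N^{-2} + 8N \cdot N^{-3}$; the cancellation is
    special to dimension four. *)
Lemma newton_hess_trace x : x != 0 -> \sum_a newton_hess a a x = 0.
Proof.
move=> /nsq_gt0 x0; have : nsq x != 0 by rewrite gt_eqF.
rewrite sum4E /newton_hess !eqxx; have := sum4E (fun k => x 0 k ^+ 2); rewrite -/(nsq x).
have -> : true%:R = 1 :> R by [].
move: (nsq x) (x 0 0) (x 0 1) (x 0 2) (x 0 3) => N a b c d NE N0.
have -> : forall i : R, -2 * 1 * i ^+ 2 + 8 * a * a * i ^+ 3 + (-2 * 1 * i ^+ 2 + 8 * b * b * i ^+ 3) +
  (-2 * 1 * i ^+ 2 + 8 * c * c * i ^+ 3) + (-2 * 1 * i ^+ 2 + 8 * d * d * i ^+ 3) =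
  8 * i ^+ 2 * ((a ^+ 2 + b ^+ 2 + c ^+ 2 + d ^+ 2) * i - 1) by move=> i; ring.
by rewrite -NE divff // subrr mulr0.
Qed.

Lemma newton_grad_le c x : x != 0 -> `|newton_grad c x| <= 2 / `|x| ^+ 3.
Proof.
move=> x0; have n0 : 0 < `|x| by rewrite normr_gt0.
have Ni : 0 <= (nsq x)^-1 by rewrite invr_ge0 ltW // nsq_gt0.
rewrite /newton_grad normrM [X in X * _]normrM normrN (ger0_norm (ler0n _ 2)).
rewrite (ger0_norm (exprn_ge0 2 Ni)) -mulrA; apply: ler_wpM2l => //.
apply: (@le_trans _ _ (`|x| * (`|x| ^+ 2)^-1 ^+ 2)).
  apply: ler_pM => //; first by rewrite exprn_ge0 // invr_ge0 ltW // nsq_gt0.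
    exact: le_coord_norm.
  have H : (nsq x)^-1 <= (`|x| ^+ 2)^-1.
    by rewrite lef_pV2 ?posrE ?nsq_gt0 ?exprn_gt0 // nsq_ge.
  by rewrite lerXn2r ?nnegrE // invr_ge0 exprn_ge0.
by rewrite le_eqVlt; apply/orP; left; apply/eqP; field; rewrite gt_eqF.
Qed.

Lemma newton_hess_le a c x : x != 0 -> `|newton_hess a c x| <= 10 / `|x| ^+ 4.
Proof.
move=> x0; have n0 : 0 < `|x| by rewrite normr_gt0.
have N0 := nsq_gt0 x0.
have H : (nsq x)^-1 <= (`|x| ^+ 2)^-1 by rewrite lef_pV2 ?posrE ?exprn_gt0 // nsq_ge.
have Ni : 0 <= (nsq x)^-1 by rewrite invr_ge0 ltW.
apply: le_trans (ler_normD _ _) _.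
have -> : 10 / `|x| ^+ 4 = 2 * (`|x| ^+ 2)^-1 ^+ 2 + 8 * `|x| * `|x| * (`|x| ^+ 2)^-1 ^+ 3.
  by field; rewrite gt_eqF.
apply: lerD.
  rewrite normrM [X in X * _]normrM normrN (ger0_norm (ler0n _ 2)) (ger0_norm (exprn_ge0 2 Ni)).
  rewrite -mulrA; apply: ler_wpM2l => //; rewrite mulrC -[leRHS]mulr1.
  apply: ler_pM; rewrite ?exprn_ge0 //; last by case: (a == c); rewrite ?normr1 ?normr0.
  by rewrite lerXn2r ?nnegrE // invr_ge0 exprn_ge0.
rewrite normrM [X in X * _]normrM [X in X * _ * _]normrM (ger0_norm (ler0n _ 8)).
rewrite (ger0_norm (exprn_ge0 3 Ni)).
apply: ler_pM; rewrite ?mulr_ge0 ?exprn_ge0 //.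
  apply: ler_pM; rewrite ?mulr_ge0 //; last exact: le_coord_norm.
  by apply: ler_wpM2l => //; exact: le_coord_norm.
by rewrite lerXn2r ?nnegrE // invr_ge0 exprn_ge0.
Qed.

Lemma C1d_shift D (z : E4) u du :
  C1d D u du -> C1d [set x | D (x - z)] (fun x => u (x - z)) (fun k x => du k (x - z)).
Proof.
move=> H x Dx; have [d0 dE dc] := H _ Dx.
have [e1 e2] : differentiable (fun x => u (x - z)) x /\
    forall k, partial k (fun x => u (x - z)) x = du k (x - z).
  apply: differentiableP_eps => e e0; have [d dd hd] := differentiable_eps d0 e0.
  exists d => // h /hd; rewrite (_ : x + h - z = x - z + h); last by rewrite addrAC.
  by rewrite (_ : (fun k => partial k u (x - z)) = fun k => du k (x - z)) //; apply/funext.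
split => // k; apply/continuous_at_eps => e e0.
have /continuous_at_eps/(_ e e0)[d dd hd] := dc k; exists d => // h /hd.
by rewrite (_ : x + h - z = x - z + h) // addrAC.
Qed.

Variable dl : R.
Hypothesis dl0 : 0 < dl.

(** Zero for [nsq x < dl] and one from [2 * dl] on: the shift by 3 puts the ramp of [theta] between.
    Multiplication by it removes the pole of the kernel. *)
Definition bump x : R := 1 - theta (nsq x / dl - 3).
Definition bump_grad (k : 'I_4) x : R := - (dtheta (nsq x / dl - 3) * (2 * x 0 k / dl)).
(** Half the scalar product of the gradients of [bump] and [newton], a radial function. *)
Definition bump_flux x : R := 2 * dtheta (nsq x / dl - 3) / (dl * nsq x).

Lemma bump_C1d D : C1d D bump bump_grad.
Proof.
have H1 : C1d D (fun x => dl^-1 * nsq x + -3) (fun k x => dl^-1 * (2 * x 0 k) + 0).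
  by apply: C1dD; [apply: C1dZ; exact: nsq_C1d|exact: C1d_cst].
have H2 : C1d D (fun x => theta (dl^-1 * nsq x + -3))
    (fun k x => dtheta (dl^-1 * nsq x + -3) * (dl^-1 * (2 * x 0 k) + 0)).
  by apply: C1d_comp H1 => y _; [exact: theta_derive|exact: dtheta_continuous].
have H3 := C1dD (@C1d_cst _ _ D 1) (C1dZ (- 1) H2).
rewrite (_ : bump = fun x => 1 + -1 * theta (dl^-1 * nsq x + -3)); last first.
  by apply/funext => x; rewrite /bump mulN1r mulrC.
rewrite (_ : bump_grad = fun k x =>
  0 + -1 * (dtheta (dl^-1 * nsq x + -3) * (dl^-1 * (2 * x 0 k) + 0))) //.
by apply/funext => k; apply/funext => x; rewrite /bump_grad (mulrC dl^-1) add0r addr0 mulN1r (mulrC (dl^-1)).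
Qed.

Lemma bump0 x : nsq x < dl -> bump x = 0 /\ forall k, bump_grad k x = 0.
Proof.
move=> xd; have h : nsq x / dl < 1 by rewrite ltr_pdivrMr // mul1r.
split=> [|k]; first by rewrite /bump theta1 ?subrr //; lra.
rewrite /bump_grad (_ : dtheta _ = 0) ?mul0r ?oppr0 //; apply/eqP; apply: contraT => /dtheta_neq0/andP[].
lra.
Qed.

Lemma bump1 x : 2 * dl <= nsq x -> bump x = 1 /\ forall k, bump_grad k x = 0.
Proof.
move=> xd; have h : 2 <= nsq x / dl by rewrite ler_pdivlMr.
split=> [|k]; first by rewrite /bump theta0 ?subr0 //; lra.
rewrite /bump_grad (_ : dtheta _ = 0) ?mul0r ?oppr0 //; apply/eqP; apply: contraT => /dtheta_neq0/andP[].
lra.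
Qed.

Lemma bump_flux_neq0 x : bump_flux x != 0 -> dl < nsq x < 2 * dl.
Proof.
rewrite /bump_flux !mulf_eq0 !negb_or => /andP[/andP[_ /dtheta_neq0/andP[h1 h2]] _].
have d1 : 1 < nsq x / dl by lra.
have d2 : nsq x / dl < 2 by lra.
by move: d1 d2; rewrite ltr_pdivlMr // ltr_pdivrMr // mul1r => -> ->.
Qed.

Lemma open_nsq_lt : open [set x : E4 | nsq x < dl].
Proof.
have := @open_comp _ _ nsq [set t : R | t < dl].
by apply; [move=> y _; exact: (C1d_continuous (@nsq_C1d setT))|exact: open_lt].
Qed.

Lemma bump_flux_continuous : continuous bump_flux.
Proof.
move=> x; have [xd|xd] := ltP (nsq x) dl.
  apply: (@near_continuous _ _ (fun=> 0)); first exact: cat_cst.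
  have : \forall y \near x, nsq y < dl by exact: (open_nbhs_nbhs (conj open_nsq_lt xd)).
  apply: filterS => y yd; apply/esym/eqP; apply: contraT => /bump_flux_neq0/andP[h _].
  by have := lt_trans yd h; rewrite ltxx.
have cN : continuous_at x nsq by exact: (C1d_continuous (@nsq_C1d setT)).
have N0 : 0 < nsq x by apply: lt_le_trans xd.
apply: catM.
  apply: catM; first exact: cat_cst.
  apply: (@cat_comp _ x _ _ (fun x => nsq x / dl - 3) (@dtheta R)); last exact: dtheta_continuous.
  by apply: catB; [apply: catM => //; exact: cat_cst|exact: cat_cst].
apply: catV; first by rewrite gt_eqF // mulr_gt0.
by apply: catM => //; exact: cat_cst.
Qed.

Lemma bump_flux_out : vanishes_out (1 + 2 * dl) bump_flux.
Proof.
move=> x xd; apply/eqP; apply: contraT => /bump_flux_neq0/andP[_ h].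
have H : `|x| ^+ 2 < 2 * dl by apply: le_lt_trans h; exact: nsq_ge.
by exfalso; move: H xd dl0; move: `|x| => a; nra.
Qed.

Lemma bump_flux_le0 x : bump_flux x <= 0.
Proof.
rewrite /bump_flux mulr_le0_ge0 ?invr_ge0 ?mulr_ge0 ?(ltW dl0) //.
  by rewrite mulr_ge0_le0 // dtheta_le0.
by apply: le_trans (nsq_ge x); rewrite exprn_ge0.
Qed.

(** Only the sign matters: the flux is continuous, nowhere positive, and negative at one point. *)
Lemma vol_bump_flux : vol bump_flux < 0.
Proof.
(* Its squared length [3 / 2 * dl] is the middle of the ramp, where [dtheta] takes the value
   -3/2. *)
pose x0 : E4 := Num.sqrt (3 / 2 * dl) *: delta_mx 0 0.
have N0 : nsq x0 = 3 / 2 * dl.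
  rewrite /nsq (bigD1 0) //= big1 => [|k k0].
    by rewrite !mxE !eqxx mulr1 addr0 sqr_sqrtr // mulr_ge0 // ltW.
  by rewrite !mxE (negPf k0) andbF mulr0 expr0n.
have H : bump_flux x0 < 0.
  rewrite /bump_flux N0 (_ : 3 / 2 * dl / dl - 3 = - (3 / 2)); last by field; rewrite gt_eqF.
  rewrite /dtheta /clip (_ : - - (3 / 2) - 1 = 1 / 2 :> R); last by field.
  rewrite min_r; last by lra.
  rewrite max_r; last by lra.
  rewrite pmulr_llt0 ?invr_gt0 ?mulr_gt0 // ?divr_gt0 //; lra.
have H' : 0 < vol (fun x => -1 * bump_flux x).
  apply: (@vol_gt0 _ (1 + 2 * dl) _ x0).
  - move=> x; apply: catM; [exact: cat_cst|exact: bump_flux_continuous].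
  - by move=> x /bump_flux_out ->; rewrite mulr0.
  - by move=> x; rewrite mulN1r oppr_ge0 bump_flux_le0.
  - by rewrite mulN1r oppr_gt0.
move: H'; rewrite (volZ _ bump_flux_continuous bump_flux_out) mulN1r oppr_gt0.
by [].
Qed.

(** Around the origin the product is identically zero, whatever value the kernel has at its pole. *)
Lemma bump_newton_C1d c : C1d setT (fun x => bump x * newton_grad c x)
  (fun a x => bump_grad a x * newton_grad c x + bump x * newton_hess a c x).
Proof.
move=> x _; have [->|x0] := eqVneq x 0; last exact: (C1dM (@bump_C1d pt) (newton_grad_C1d c)).
have z0 : nsq (0 : E4) < dl by rewrite /nsq big1 // => k _; rewrite mxE expr0n.
apply: (C1d_eq open_nsq_lt _ _ (@C1d_cst _ _ _ 0)) => // [y|a y]; rewrite inE => /bump0[b0 b1].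
  by rewrite b0 mul0r.
by rewrite b1 b0 !mul0r addr0.
Qed.

Definition conj4 (k : 'I_4) (f : 'I_4 -> R) : R := [:: f 0; - f 1; - f 2; - f 3]`_k.

(** For parallel normal and gradient the antisymmetric parts [b1], [b2], [b3] of [tri] vanish; the
    conjugate of [f] times the scalar product remains. *)
Lemma tri_radial k (f : 'I_4 -> R) x : tri k f (x 0) (x 0) = 2^-1 * conj4 k f * nsq x.
Proof.
have := sum4E (fun k => x 0 k ^+ 2); rewrite -/(nsq x) => ->.
by move: k; apply: ord4P; rewrite /tri /conj4 /=; move: (x 0 0) (x 0 1) (x 0 2) (x 0 3) => *; ring.
Qed.

Lemma triZZ k (f n p : 'I_4 -> R) a b :
  tri k f (fun c => a * n c) (fun c => b * p c) = a * b * tri k f n p.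
Proof. by rewrite /tri; move: k; apply: ord4P => /=; ring. Qed.

(* Both gradients are radial, so the components of [tri] that would mix coordinates vanish. *)
Lemma bump_newton_divergence k (f : 'I_4 -> R) x :
  \sum_a tri k f (unit4 R a) (fun c =>
    bump_grad a x * newton_grad c x + bump x * newton_hess a c x) = conj4 k f * bump_flux x.
Proof.
have triD (n p q : 'I_4 -> R) (a b : R) :
    tri k f n (fun c => a * p c + b * q c) = a * tri k f n p + b * tri k f n q.
  by rewrite /tri; move: k; apply: ord4P => /=; ring.
under eq_bigr => a _ do rewrite triD.
rewrite big_split /= -mulr_sumr -(tri_normal k f (fun a => bump_grad a x)).
have -> : bump x * \sum_a tri k f (unit4 R a) (newton_hess a ^~ x) = 0.
  have [->|x0] := eqVneq x 0.
    have z0 : nsq (0 : E4) < dl by rewrite /nsq big1 // => l _; rewrite mxE expr0n.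
    by have [-> _] := bump0 z0; rewrite mul0r.
  have := @tri_divergence R k f (newton_grad ^~ x) (fun _ _ => 0) (fun a c => newton_hess a c x).
  move=> H; rewrite -[RHS](mulr0 (bump x)) -[in RHS]H.
  - congr (_ * _); apply: eq_bigr => a _; rewrite [X in X + _](_ : _ = 0) ?add0r //.
    by rewrite /tri; move: k {H triD}; apply: ord4P => /=; ring.
  - by split; rewrite !(subr0, addr0).
  - by move=> a b; exact: newton_hess_sym.
  - exact: newton_hess_trace.
rewrite addr0 (_ : (fun a => bump_grad a x) =
  fun a => - (dtheta (nsq x / dl - 3) * 2 / dl) * x 0 a); last first.
  by apply/funext => a; rewrite /bump_grad; ring.
rewrite (_ : newton_grad ^~ x = fun c => (- 2 * (nsq x)^-1 ^+ 2) * x 0 c); last first.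
  by apply/funext => a; rewrite /newton_grad; ring.
rewrite triZZ tri_radial /bump_flux.
have [->|x0] := eqVneq x 0; last first.
  by have := nsq_gt0 x0 => N0; field; rewrite !gt_eqF.
have z0 : nsq (0 : E4) = 0 by rewrite /nsq big1 // => l _; rewrite mxE expr0n.
by rewrite z0 !mulr0 invr0 !mulr0.
Qed.
End NewtonKernel.

(** * Integrals depending on a parameter *)

(** The smallness [d] is a parameter tending to 0, and compactness turns its local choices into one.
    The increment may leave [A], so continuity is required in the whole space. *)
Lemma compact_equicontinuous (R : realType) n (A : set 'rV[R]_n.+1) (g : 'rV[R]_n.+1 -> R) e :
  compact A -> (forall x, A x -> continuous_at x g) -> 0 < e ->
  exists2 d, 0 < d & forall x h, A x -> `|h| < d -> `|g (x + h) - g x| < e.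
Proof.
move=> /compact_near_coveringP cA cg e0.
pose P (d : R) x := forall h, `|h| < d -> `|g (x + h) - g x| < e.
have [x Ax|d /= d0 hd] := cA R (0^'+) P _ _.
  have e20 : 0 < e / 2 by rewrite divr_gt0.
  have /continuous_at_eps/(_ _ e20)[d d0 hd] := cg x Ax.
  have d20 : 0 < d / 2 by rewrite divr_gt0.
  exists (ball x (d / 2), [set t | t < d / 2]) => /=.
    split; first exact: nbhsx_ballx.
    exact: nbhs_right_lt.
  move=> [x' t] /= [xx' td] h ht.
  have x'd : `|x' - x| < d / 2 by move: xx'; rewrite -ball_normE /ball_ /= distrC.
  have h1 : `|x' - x| < d by apply: lt_trans x'd _; rewrite ltr_pdivrMr // ltr_pMr // ltr1n.
  have h2 : `|x' - x + h| < d.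
    by apply: le_lt_trans (ler_normD _ _) _; rewrite [ltRHS]splitr ltrD // (lt_trans ht).
  have H1 := hd _ h1; have H2 := hd _ h2.
  rewrite addrA !subrKC in H2; rewrite subrKC in H1.
  rewrite (_ : g (x' + h) - g x' = (g (x' + h) - g x) - (g x' - g x)); last by ring.
  apply: le_lt_trans (ler_normB _ _) _; lra.
exists (d / 2); first by rewrite divr_gt0.
move=> x h Ax hd2; apply: (hd (d / 2)) => //=.
- by rewrite sub0r normrN ger0_norm ?divr_ge0 ?ltW // ltr_pdivrMr // ltr_pMr // ltr1n.
- by rewrite divr_gt0.
Qed.

Lemma continuous_shift (R : realType) n (g : 'rV[R]_n.+1 -> R) (z : 'rV[R]_n.+1) :
  continuous g -> continuous (fun x : 'rV[R]_n.+1 => g (x - z)).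
Proof.
move=> cg x; apply/continuous_at_eps => e e0.
have cz : continuous_at (x - z) g by exact: cg.
have /continuous_at_eps/(_ e e0)[d dd hd] := cz; exists d => // h /hd.
by rewrite [x + h - z]addrAC.
Qed.

Section ParametricIntegral.
Context d (T : measurableType d) (R : realType).
Variables (mu : {measure set T -> \bar R}) (S : set T).
Hypotheses (mS : measurable S) (muS : (mu S < +oo)%E).

Lemma Rintegral_bound (f : T -> R) C : mu.-integrable S (EFin \o f) ->
  (forall w, S w -> `|f w| <= C) -> `|Rintegral mu S f| <= C * fine (mu S).
Proof.
move=> fi fC; apply: le_trans (le_normr_Rintegral mS fi) _.
rewrite -Rintegral_cst //; apply: le_Rintegral => //.
  exact: integrable_norm.
by apply: (bounded_integrable (C := `|C|)) => //; exact: measurable_cst.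
Qed.

Lemma Rintegral_linear0 (s : 'I_4 -> R) (g : 'I_4 -> T -> R) :
  (forall j, mu.-integrable S (EFin \o g j)) ->
  (forall w, S w -> \sum_j s j * g j w = 0) ->
  \sum_j s j * Rintegral mu S (g j) = 0.
Proof.
move=> gi g0.
have gi' j : mu.-integrable S (EFin \o (fun w => s j * g j w)).
  by have := integrableZl mS (s j) (gi j).
have [_] := Rintegral_sum_fun (index_enum 'I_4) mS gi'.
under [in RHS]eq_bigr => j _ do rewrite RintegralZl //.
move=> <-; transitivity (Rintegral mu S (fun=> 0)); last by rewrite /Rintegral integral0.
by apply: eq_Rintegral => w /set_mem; exact: g0.
Qed.

Variables (n : nat) (D : set 'rV[R]_n.+1).
Variables (G : T -> 'rV[R]_n.+1 -> R) (dG : 'I_n.+1 -> T -> 'rV[R]_n.+1 -> R).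
Hypothesis oD : open D.
Hypothesis Gi : forall x, D x -> mu.-integrable S (EFin \o (G ^~ x)).
Hypothesis dGi : forall a x, D x -> mu.-integrable S (EFin \o ((dG a) ^~ x)).
Hypothesis GC1 : forall w, S w -> C1d D (G w) (fun a => dG a w).
Hypothesis dG_unif : forall x e, D x -> 0 < e -> exists2 t, 0 < t &
  forall a w h, S w -> `|h| < t -> `|dG a w (x + h) - dG a w x| <= e.

(** Adding 1 keeps the divisor positive even when [S] has measure zero. *)
Let M := fine (mu S) + 1.
Let M_gt0 : 0 < M.
Proof. by rewrite ltr_wpDl // fine_ge0. Qed.

(** By the mean value theorem, the modulus of continuity [dG_unif], uniform in [w], bounds the
    first-order error of the integrand by a small multiple of |h|; integration over a set of finite
    measure preserves this. *)
Lemma Rintegral_C1d : C1d D (fun x => Rintegral mu S (G ^~ x))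
  (fun a x => Rintegral mu S ((dG a) ^~ x)).
Proof.
move=> x Dx.
have nD : nbhs x D by exact: open_nbhs_nbhs.
have /nbhs_ballP[t0 /= t00 ht0] := nD.
have shrink e : 0 < e -> exists2 t, 0 < t & forall h, `|h| < t -> D (x + h) /\
    forall a w, S w -> `|dG a w (x + h) - dG a w x| <= e.
  move=> e0; have [t tp ht] := dG_unif Dx e0.
  exists (Num.min t t0); first by rewrite lt_min tp.
  by move=> h; rewrite lt_min => /andP[h1 h2]; split; [exact/ht0/ball_in|move=> a w; move/ht; exact].
have [d0 dE] : differentiable (fun x => Rintegral mu S (G ^~ x)) x /\ forall a,
    partial a (fun x => Rintegral mu S (G ^~ x)) x = Rintegral mu S ((dG a) ^~ x).
  apply: differentiableP_eps => e e0.
  have e'0 : 0 < e / (n.+1%:R * M) by rewrite divr_gt0 // mulr_gt0.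
  have [t tp ht] := shrink _ e'0; exists t => // h hlt.
  have [Dxh _] := ht h hlt.
  have di a : mu.-integrable S (EFin \o (fun w => h 0 a * dG a w x)).
    by have := integrableZl mS (h 0 a) (dGi a Dx).
  have [li lE] := Rintegral_sum_fun (index_enum 'I_n.+1) mS di.
  have -> : dlin (fun a => Rintegral mu S ((dG a) ^~ x)) h =
      Rintegral mu S (fun w => \sum_a h 0 a * dG a w x).
    rewrite lE; apply: eq_bigr => a _; rewrite mulrC.
    exact: esym (RintegralZl (h 0 a) mS (dGi a Dx)).
  have i1 : mu.-integrable S (EFin \o (fun w => G w (x + h) - G w x)).
    by have := integrableB mS (Gi Dxh) (Gi Dx).
  have i2 : mu.-integrable S (EFin \o (fun w => G w (x + h) - G w x - \sum_a h 0 a * dG a w x)).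
    by have := integrableB mS i1 li.
  rewrite -RintegralB //; [|exact: Gi|exact: Gi].
  rewrite -RintegralB //.
  have B w : S w -> `|G w (x + h) - G w x - \sum_a h 0 a * dG a w x| <= e / M * `|h|.
    move=> Sw; have [|r r01 ->] := @mean_value _ _ (G w) x h.
      move=> r /andP[r0 r1]; have rh : `|r *: h| < t.
        by apply: le_lt_trans hlt; rewrite normrZ ger0_norm // ler_piMl.
      by have [Drh _] := ht _ rh; have [] := GC1 Sw Drh.
    have rh : `|r *: h| < t.
      move: r01 => /andP[r0 r1].
      by apply: le_lt_trans hlt; rewrite normrZ ger0_norm // ler_piMl.
    have [Drh unif] := ht _ rh; have [_ pE _] := GC1 Sw Drh.
    rewrite (_ : _ - _ = dlin (fun a => dG a w (x + r *: h) - dG a w x) h); last first.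
      rewrite /dlin -sumrB; apply: eq_bigr => a _.
      by rewrite pE mulrBl [h 0 a * _]mulrC.
    have -> : e / M = n.+1%:R * (e / (n.+1%:R * M)).
      by field; rewrite gt_eqF //= pnatr_eq0.
    by apply: dlin_le => a; exact: unif.
  apply: le_trans (Rintegral_bound i2 B) _.
  rewrite mulrAC; apply: ler_wpM2r => //.
  rewrite mulrAC ler_pdivrMr //; apply: ler_wpM2l; first exact: ltW.
  by rewrite lerDl.
split => // a; apply/continuous_at_eps => e e0.
have e'0 : 0 < e / 2 / M by rewrite divr_gt0 // divr_gt0.
have [t tp ht] := shrink _ e'0; exists t => // h hlt; have [Dxh unif] := ht h hlt.
rewrite -RintegralB //; [|exact: dGi|exact: dGi].
have i1 : mu.-integrable S (EFin \o (fun w => dG a w (x + h) - dG a w x)).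
  by have := integrableB mS (dGi a Dxh) (dGi a Dx).
apply: le_lt_trans (Rintegral_bound i1 (unif a)) _.
rewrite mulrAC ltr_pdivrMr //; apply: (@le_lt_trans _ _ (e / 2 * M)).
  by apply: ler_wpM2l; [rewrite divr_ge0 // ltW|rewrite lerDl].
by rewrite ltr_pM2r // ltr_pdivrMr // ltr_pMr // ltr1n.
Qed.
End ParametricIntegral.

(** * Bounds and regularity identities for the boundary form *)

Section TriBounds.
Variable R : realType.
Implicit Types (f n p q : 'I_4 -> R).

(** Each bracket of [tri] has four products, each component four such terms, and the prefactor is
    one half, which makes 8. *)
Lemma tri_le k f n p (A N B : R) : (forall b, `|f b| <= A) -> (forall a, `|n a| <= N) ->
  (forall c, `|p c| <= B) -> `|tri k f n p| <= 8 * A * N * B.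
Proof.
move=> hf hn hp.
have A0 : 0 <= A by apply: le_trans (hf 0).
have N0 : 0 <= N by apply: le_trans (hn 0).
have B0 : 0 <= B by apply: le_trans (hp 0).
have H a c : - (N * B) <= n a * p c <= N * B.
  by rewrite -ler_norml normrM; apply: ler_pM.
have C0 : 0 <= N * B by rewrite mulr_ge0.
have B0' : `|n 0 * p 0 + n 1 * p 1 + n 2 * p 2 + n 3 * p 3| <= 4 * (N * B).
  by rewrite ler_norml; have := H 0 0; have := H 1 1; have := H 2 2; have := H 3 3; lra.
have B1' : `|n 0 * p 1 - n 1 * p 0 + n 2 * p 3 - n 3 * p 2| <= 4 * (N * B).
  by rewrite ler_norml; have := H 0 1; have := H 1 0; have := H 2 3; have := H 3 2; lra.
have B2' : `|n 0 * p 2 - n 2 * p 0 + n 3 * p 1 - n 1 * p 3| <= 4 * (N * B).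
  by rewrite ler_norml; have := H 0 2; have := H 2 0; have := H 3 1; have := H 1 3; lra.
have B3' : `|n 2 * p 1 + n 3 * p 0 - n 0 * p 3 - n 1 * p 2| <= 4 * (N * B).
  by rewrite ler_norml; have := H 2 1; have := H 3 0; have := H 0 3; have := H 1 2; lra.
have F b (y : R) : `|y| <= 4 * (N * B) -> - (4 * (A * N * B)) <= f b * y <= 4 * (A * N * B).
  move=> hy; rewrite -ler_norml normrM (_ : 4 * _ = A * (4 * (N * B))); last by ring.
  exact: ler_pM.
rewrite /tri; move: (n 0 * p 0 + _ + _ + _) B0' => b0 /(F _) F0.
move: (n 0 * p 1 - _ + _ - _) B1' => b1 /(F _) F1.
move: (n 0 * p 2 - _ + _ - _) B2' => b2 /(F _) F2.
move: (n 2 * p 1 + _ - _ - _) B3' => b3 /(F _) F3.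
rewrite (_ : 8 * A * N * B = 2 * (4 * (A * N * B))); last by ring.
move: k; apply: ord4P; rewrite /= ler_norml.
- by have := F0 0; have := F1 1; have := F2 2; have := F3 3; lra.
- by have := F1 0; have := F0 1; have := F2 3; have := F3 2; lra.
- by have := F2 0; have := F3 1; have := F0 2; have := F1 3; lra.
- by have := F3 0; have := F2 1; have := F0 3; have := F1 2; lra.
Qed.

Lemma triB k f n p q : tri k f n p - tri k f n q = tri k f n (fun c => p c - q c).
Proof. by move: k; apply: ord4P; rewrite /tri /=; ring. Qed.

Lemma triBB k f f' n p q : tri k f n p - tri k f' n p - (tri k f n q - tri k f' n q) =
  tri k (fun b => f b - f' b) n (fun c => p c - q c).
Proof. by move: k; apply: ord4P; rewrite /tri /=; ring. Qed.

Lemma tri0r k f n : tri k f n (fun=> 0) = 0.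
Proof. by move: k; apply: ord4P; rewrite /tri /=; ring. Qed.

Lemma tri0l k n p : tri k (fun=> 0) n p = 0.
Proof. by move: k; apply: ord4P; rewrite /tri /=; ring. Qed.

(** With [H] the Hessian of a harmonic kernel, this is the regularity of the conjugated boundary
    form in the position of the pole. *)
Lemma conj4_regular f n (H : 'I_4 -> 'I_4 -> R) :
  (forall a c, H a c = H c a) -> \sum_a H a a = 0 ->
  regular_eqs (fun a b => conj4 b (fun l => tri l f n (H a))).
Proof.
move=> sym; rewrite sum4E => tr.
have e : H 0 0 = - H 1 1 - H 2 2 - H 3 3 by lra.
by split; rewrite /conj4 /tri /= e (sym 1 0) (sym 2 0) (sym 3 0) (sym 2 1) (sym 3 1) (sym 3 2); ring.
Qed.

Lemma conj4Z b (q : 'I_4 -> R) c : conj4 b (fun l => q l * c) = conj4 b q * c.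
Proof. by move: b; apply: ord4P; rewrite /conj4 /= ?mulNr. Qed.

Lemma regular_eqsZ (d : 'I_4 -> 'I_4 -> R) c :
  regular_eqs d -> regular_eqs (fun a b => d a b * c).
Proof.
move=> [h0 h1 h2 h3]; split; rewrite -[RHS](mul0r c).
- by rewrite -[in RHS]h0; ring.
- by rewrite -[in RHS]h1; ring.
- by rewrite -[in RHS]h2; ring.
- by rewrite -[in RHS]h3; ring.
Qed.

(** Each equation takes one entry from every row [d j]; written as a signed sum of four terms, it
    passes under the integral sign by [Rintegral_linear0]. *)
Lemma conj4_regularE (d : 'I_4 -> 'I_4 -> R) :
  regular_eqs (fun a b => conj4 b (d a)) <->
  [/\ \sum_(j < 4) [:: 1; 1; 1; -1]`_j * d j (nth ord0 [:: 0; 1; 2; 3] j) = 0,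
      \sum_(j < 4) [:: -1; 1; -1; -1]`_j * d j (nth ord0 [:: 1; 0; 3; 2] j) = 0,
      \sum_(j < 4) [:: -1; 1; 1; 1]`_j * d j (nth ord0 [:: 2; 3; 0; 1] j) = 0 &
      \sum_(j < 4) [:: -1; -1; 1; -1]`_j * d j (nth ord0 [:: 3; 2; 1; 0] j) = 0].
Proof.
rewrite /regular_eqs !sum4E /conj4 /=.
move: (d 0 0) (d 0 1) (d 0 2) (d 0 3) (d 1 0) (d 1 1) (d 1 2) (d 1 3)
  (d 2 0) (d 2 1) (d 2 2) (d 2 3) (d 3 0) (d 3 1) (d 3 2) (d 3 3) => *.
by split=> -[h0 h1 h2 h3]; split; lra.
Qed.
End TriBounds.

(** * The Cauchy integral *)

Section CauchyIntegral.
Variables (R : realType) (rho : 'rV[R]_4 -> R) (Omega : set 'rV[R]_4).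
Local Notation E4 := 'rV[R]_4.
Hypothesis rho_C1 : C1_on setT rho.
Hypothesis OmegaE : Omega = [set q | rho q < 0].
Hypothesis drho_neq0 : forall q, bdry Omega q -> exists v, 'd rho q v != 0.
Hypothesis Omega_bounded : bounded_set Omega.
Hypothesis Omega_open : open Omega.
Variable sigma : {measure set (borel4 R) -> \bar R}.
Hypothesis sigma_surface : is_surface_measure (bdry Omega) sigma.

Local Notation kernel z := (fun c w => newton_grad c (w - z)).
Local Notation cauchy := (fun f k z => surface_tri rho Omega sigma k f (kernel z)).

Lemma ball_inside (z : E4) : Omega z -> exists d m, [/\ 0 < d, 0 < m &
  forall x, `|x - z| < d -> rho x <= - m].
Proof.
rewrite OmegaE /= => rz; have rz2 : 0 < - rho z / 2 by rewrite divr_gt0 // oppr_gt0.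
have /continuous_at_eps/(_ _ rz2)[d d0 hd] := rho_continuous rho_C1 (x := z).
exists d, (- rho z / 2); split => // x /hd; rewrite subrKC ltr_norml => /andP[_ h].
by lra.
Qed.

(** On the boundary the kernel may be multiplied by [bump], which is 1 there. The new field is $C^1$
    across the pole, and its divergence is a multiple of the bump flux translated to [z], supported
    inside the domain. *)
Lemma flux_inside (z : E4) : Omega z -> exists2 d0, 0 < d0 & forall dl, 0 < dl -> dl <= d0 ->
  forall k (f0 : E4), cauchy (fun=> f0) k z = conj4 k (f0 0) * vol (bump_flux dl).
Proof.
move=> Oz; have [d [m [dp m0 hd]]] := ball_inside Oz.
have d20 : 0 < d ^+ 2 / 4 by rewrite divr_gt0 // exprn_gt0.
(* Then [nsq (x - z) < 2 * dl] forces [x] into the ball on which [rho] is at most [- m]. *)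
exists (d ^+ 2 / 4) => // dl dl0 dle k f0.
have near x : nsq (x - z) < 2 * dl -> rho x <= - m.
  move=> xz; apply: hd; rewrite -(ltr_pXn2r (n := 2)) ?nnegrE // ?(ltW dp) //.
  by apply: le_lt_trans (nsq_ge _) _; apply: lt_le_trans xz _; have := sqr_ge0 d; lra.
pose V a x := tri k (f0 0) (unit4 R a) (fun c => bump dl (x - z) * newton_grad c (x - z)).
pose h x := conj4 k (f0 0) * bump_flux dl (x - z).
have cshift : continuous (fun x : E4 => bump_flux dl (x - z)).
  by apply: continuous_shift; exact: bump_flux_continuous.
have VC1d a : C1d setT (V a) (fun b x => tri k (fun _ => 0) (unit4 R a)
     (fun c => bump dl (x - z) * newton_grad c (x - z)) +
   tri k (f0 0) (unit4 R a) (fun c => bump_grad dl b (x - z) * newton_grad c (x - z) +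
     bump dl (x - z) * newton_hess b c (x - z))).
  apply: (@tri_C1d R k setT (unit4 R a) (fun b _ => f0 0 b) (fun c x => bump dl (x - z) * newton_grad c (x - z)) (fun _ _ _ => 0)
    (fun b c x => bump_grad dl b (x - z) * newton_grad c (x - z) + bump dl (x - z) * newton_hess b c (x - z))).
    by move=> b; exact: C1d_cst.
  by move=> c; exact: (C1d_shift (D := setT) (bump_newton_C1d dl0 c)).
have -> : conj4 k (f0 0) * vol (bump_flux dl) = vol h.
  rewrite /h (volZ (M := 1 + 2 * dl + `|z|)) //; last first.
    move=> x xz; apply: (bump_flux_out dl0); rewrite -ltrBrDr in xz.
    by apply: lt_le_trans xz _; exact: lerB_dist.
  congr (_ * _); exact: esym (vol_shift (- z) (bump_flux_continuous dl0) (bump_flux_out dl0)).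
rewrite -(divergence_surface rho_C1 OmegaE Omega_open Omega_bounded sigma_surface
  drho_neq0 (V := V) (m := m)) //.
- apply: eq_Rintegral => x /set_mem xS; rewrite tri_normal; congr (_ / _); apply: eq_bigr => a _.
  rewrite mulrC /V; congr (tri _ _ _ _ * _); apply/funext => c.
  have nx : 2 * dl <= nsq (x - z).
    rewrite leNgt; apply/negP => /near; have [_ ->] := (bdryP rho_C1 OmegaE Omega_open x).1 xS.
    by lra.
  by have [-> _] := bump1 dl0 nx; rewrite mul1r.
- by move=> a; apply: continuous_subspaceT => x; exact: (C1d_continuous (VC1d a)).
- by move=> a; apply: C1d_C1_on Omega_open (C1d_sub _ (VC1d a)).
- move=> x _; rewrite /h -(bump_newton_divergence dl0); apply: eq_bigr => a _.
  have [_ -> _] := VC1d a x I; rewrite [X in X + _](_ : _ = 0) ?add0r //.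
  exact: tri0l.
- by move=> x; apply: catM; [exact: cat_cst|exact: cshift].
- move=> x rx; rewrite /h; have [->|] := eqVneq (bump_flux dl (x - z)) 0; first by rewrite mulr0.
  by move=> /(bump_flux_neq0 dl0)/andP[_ /near]; lra.
Qed.

(** The volumes of two small bump fluxes agree, since both equal the same boundary integral at [z0];
    the size [Num.min d0 d], small enough for both points, carries the value from [z0] to [z]. *)
Lemma flux_const : Omega !=set0 -> exists2 c0, c0 < 0 & forall z k (f0 : E4), Omega z ->
  cauchy (fun=> f0) k z = conj4 k (f0 0) * c0.
Proof.
move=> [z0 Oz0]; have [d0 d00 h0] := flux_inside Oz0.
exists (vol (bump_flux d0)); first exact: vol_bump_flux.
move=> z k f0 Oz; have [d dp h] := flux_inside Oz.
have m0 : 0 < Num.min d0 d by rewrite lt_min d00.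
rewrite (h _ m0) ?ge_min ?lexx ?orbT //; congr (_ * _).
(* The quaternion 1, whose conjugate has real component 1, isolates the volume in the identity at
   [z0]. *)
pose u : E4 := delta_mx 0 0.
have E1 := h0 _ m0 _ 0 u; have E2 := h0 _ d00 _ 0 u.
have c1 : conj4 0 (u 0) = 1 by rewrite /conj4 /u /= mxE !eqxx.
move: E1 E2; rewrite c1 !mul1r => <-; last by rewrite ge_min lexx.
exact.
Qed.

Lemma closure_neq (z x : E4) : ~ closure Omega z -> closure Omega x -> x - z != 0.
Proof. by move=> nz xC; rewrite subr_eq0; apply/eqP => xz; apply: nz; rewrite -xz. Qed.

Lemma newton_shift_C1d (z : E4) (D : set E4) : (forall x, D x -> x - z != 0) ->
  C1d D (fun x => newton (x - z)) (fun c x => newton_grad c (x - z)).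
Proof. by move=> H x Dx; exact: (C1d_shift (z := z) (@newton_C1d R) (H x Dx)). Qed.

Lemma newton_grad_shift_C1d (z : E4) c (D : set E4) : (forall x, D x -> x - z != 0) ->
  C1d D (fun x => newton_grad c (x - z)) (fun a x => newton_hess a c (x - z)).
Proof. by move=> H x Dx; exact: (C1d_shift (z := z) (newton_grad_C1d c) (H x Dx)). Qed.

Lemma within_kernel (z : E4) c (A : set E4) : (forall x, A x -> x - z != 0) ->
  {within A, continuous (fun w => newton_grad c (w - z))}.
Proof.
move=> H; apply: continuous_in_subspaceT => x; rewrite inE => /H xz.
have := newton_grad_shift_C1d c (D := [set x]) (z := z) => C.
by apply: C1d_continuous (C _) _ => // y ->.
Qed.

Lemma newton_harmonic (z : E4) : ~ closure Omega z -> harmonic_on Omega (fun x => newton (x - z)).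
Proof.
move=> nz; have H x : Omega x -> x - z != 0.
  by move=> Ox; apply: closure_neq nz _; exact: subset_closure.
have C := newton_shift_C1d H.
have C2 c : C1d Omega (partial c (fun x => newton (x - z))) (fun a x => newton_hess a c (x - z)).
  apply: (C1d_eq Omega_open _ _ (newton_grad_shift_C1d c H)) => // x; rewrite inE => Ox.
  by have [_ ->] := C x Ox.
split=> [|c|x Ox]; [exact: C1d_C1_on Omega_open C|exact: C1d_C1_on Omega_open (C2 c)|].
rewrite -[RHS](newton_hess_trace (H x Ox)); apply: eq_bigr => a _.
by have [_ ->] := C2 a x Ox.
Qed.

Lemma partial_cst0 c : partial c (fun=> 0 : R) = (fun=> 0 : R) :> (E4 -> R).
Proof. by apply/funext => x; exact: derive_cst. Qed.

Lemma newton_Harm1 (z : E4) : ~ closure Omega z -> Harm1 Omega (fun x => Complex (newton (x - z)) 0).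
Proof.
move=> nz; have H x : Omega x -> x - z != 0.
  by move=> Ox; apply: closure_neq nz _; exact: subset_closure.
have C0 : C1_on Omega (fun=> 0 : R) by exact: C1d_C1_on Omega_open (@C1d_cst _ _ _ 0).
split; rewrite /=.
- exact: newton_harmonic.
- split=> // [c|x _]; first by rewrite partial_cst0.
  by rewrite big1 // => c _; rewrite !partial_cst0.
- split; first by have [] := newton_harmonic nz.
    apply: continuous_in_subspaceT => x; rewrite inE => xC.
    have C := newton_shift_C1d (D := [set x]) (z := z).
    by apply: C1d_continuous (C _) _ => // y ->; exact: closure_neq.
  move=> c; exists (fun w => newton_grad c (w - z)).
    by apply: within_kernel => x; exact: closure_neq.
  by move=> x Ox; have [_ ->] := newton_shift_C1d H Ox.
- split => //; first by move=> x; exact: cat_cst.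
  move=> c; exists (fun=> 0); first by move=> x; exact: cat_cst.
  by rewrite partial_cst0.
Qed.

Lemma const_regular (f0 : E4) : psi_regular Omega (fun=> f0).
Proof.
apply/psi_regularP; split=> [m|q _].
  exact: C1d_C1_on Omega_open (@C1d_cst _ _ _ (f0 0 m)).
have P a b : partial a (fun=> f0 0 b) q = 0 by exact: derive_cst.
by split; rewrite !P !(subr0, addr0).
Qed.

(** With the pole off the closure the kernel is the gradient of a harmonic function, and constants
    are regular, so [flux_zero] applies. *)
Lemma flux_outside (z : E4) k (f0 : E4) : ~ closure Omega z -> cauchy (fun=> f0) k z = 0.
Proof.
move=> nz; have H x : Omega x -> x - z != 0.
  by move=> Ox; apply: closure_neq nz _; exact: subset_closure.
apply: (flux_zero rho_C1 OmegaE drho_neq0 Omega_bounded Omega_open sigma_surface k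
  (const_regular f0) _ (newton_harmonic nz)).
- by move=> b x; exact: cat_cst.
- by move=> c; apply: within_kernel => x; exact: closure_neq.
- by move=> c x Ox; have [_ ->] := newton_shift_C1d H Ox.
Qed.

Variable f : E4 -> E4.
Hypothesis f_cont : forall b, {within bdry Omega, continuous (fun x => f x 0 b)}.

(** The orthogonality is tested with the real function [newton (x - z)], which belongs to [Harm1]
    because its pole is off the closure. *)
Lemma cauchy_outside (z : E4) k :
  (forall phi, Harm1 Omega phi -> qintegral sigma (bdry Omega)
       (fun q => qmul (qconj (f q)) (dbar_n_sub_jL Omega rho phi q)) = 0) ->
  ~ closure Omega z -> cauchy f k z = 0.
Proof.
move=> ortho nz; have := congr1 (fun r : 'rV[R]_4 => r 0 k) (ortho _ (newton_Harm1 nz)).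
have H x : Omega x -> x - z != 0.
  by move=> Ox; apply: closure_neq nz _; exact: subset_closure.
have st0 l : surface_tri rho Omega sigma l f (fun _ _ => 0) = 0.
  rewrite /surface_tri; transitivity (Rintegral sigma (bdry Omega) (fun=> 0)); last first.
    by rewrite /Rintegral integral0.
  by apply: eq_Rintegral => x _; rewrite tri0r mul0r.
rewrite (qintegral_tri rho_C1 OmegaE drho_neq0 Omega_bounded Omega_open sigma_surface
  (P := kernel z) (Q := fun _ _ => 0)) //.
- rewrite mxE => <-; rewrite [mul_i _ _](_ : _ = 0) ?addr0 //.
  by move: k; apply: ord4P; rewrite /mul_i /= st0 ?oppr0.
- by move=> c; apply: within_kernel => x; exact: closure_neq.
- by move=> c x; exact: cat_cst.
- move=> c x xC; apply: (@partial_closureE R Omega (fun y => newton (y - z))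
      (fun w => newton_grad c (w - z)) c x _ _ xC).
    by move=> y Oy; have [_ ->] := newton_shift_C1d H Oy.
  by apply: within_kernel => y; exact: closure_neq.
- move=> c x xC; apply: (@partial_closureE R Omega (fun=> 0) (fun=> 0) c x _ _ xC).
    by move=> y _; rewrite partial_cst0.
  by move=> y; exact: cat_cst.
Qed.

Let nS := measurable_bdry Omega.
Let S_lty := bdry_lty rho_C1 OmegaE Omega_open Omega_bounded sigma_surface drho_neq0.

Lemma bdry_neq (z x : E4) : Omega z -> bdry Omega x -> x - z != 0.
Proof.
move=> Oz xS; rewrite subr_eq0; apply/eqP => xz; move: xS; rewrite xz => /(bdryP rho_C1 OmegaE Omega_open)[_].
by move: Oz; rewrite OmegaE /= => rz rz0; move: rz; rewrite rz0 ltxx.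
Qed.

Lemma newton_gradN c (x : E4) : newton_grad c (- x) = - newton_grad c x.
Proof. by rewrite /newton_grad nsqN mxE; ring. Qed.

Lemma newton_hessN a c (x : E4) : newton_hess a c (- x) = newton_hess a c x.
Proof. by rewrite /newton_hess nsqN !mxE; ring. Qed.

Lemma within_hess (z : E4) a c (A : set E4) : (forall x, A x -> x - z != 0) ->
  {within A, continuous (fun w => newton_hess a c (w - z))}.
Proof.
move=> H; apply: continuous_in_subspaceT => x; rewrite inE => /H xz.
apply/continuous_at_eps => e e0.
have /continuous_at_eps/(_ e e0)[d dd hd] := @newton_hess_continuous R a c _ xz.
by exists d => // h /hd; rewrite [x + h - z]addrAC.
Qed.

Let G k (w z : E4) : R := tri k (f w 0) (fun a => partial a rho w) (kernel z ^~ w) / gradnorm rho w.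
(** The factor -1 comes from differentiating [w - z] in [z]. *)
Let dG k a (w z : E4) : R :=
  tri k (f w 0) (fun b => partial b rho w) (fun c => -1 * newton_hess a c (w - z)) / gradnorm rho w.

Lemma row_bound : exists2 A, 0 < A & forall w b, bdry Omega w -> `|f w 0 b| <= A.
Proof.
have /choice[A HA] b : exists A, 0 < A /\ forall w, bdry Omega w -> `|f w 0 b| <= A.
  have [A A0 H] := within_continuous_bounded (bdry_compact Omega_bounded) (@f_cont b).
  by exists A.
have A0 b : 0 < A b by have [] := HA b.
exists (\sum_b A b); first by rewrite sum4E !addr_gt0.
move=> w b wS; have [_ H] := HA b; apply: le_trans (H w wS) _.
by rewrite (bigD1 b) //= lerDl sumr_ge0 // => l _; exact: ltW.
Qed.

(** Every partial derivative of [rho] is at most [gradnorm], which the division cancels; no bound on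
    [rho] remains. *)
Lemma tri_quot_le k (u : 'I_4 -> R) p w A B : bdry Omega w -> (forall b, `|u b| <= A) ->
  (forall c, `|p c| <= B) ->
  `|tri k u (fun a => partial a rho w) p / gradnorm rho w| <= 8 * A * B.
Proof.
move=> wS uA pB; have g0 := gradnorm_bdry_gt0 rho_C1 OmegaE Omega_open drho_neq0 wS.
rewrite normrM normfV (gtr0_norm g0) ler_pdivrMr //.
have := tri_le k uA (fun a => gradnorm_ge rho a w) pB.
by rewrite (_ : 8 * A * gradnorm rho w * B = 8 * A * B * gradnorm rho w); [|ring].
Qed.

Lemma cauchy_C1d k : C1d Omega (cauchy f k)
  (fun a z => Rintegral sigma (bdry Omega) (fun w => dG k a w z)).
Proof.
apply: (Rintegral_C1d nS S_lty (G := G k) (dG := dG k)) => //.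
- move=> z Oz; apply: (bdry_tri_integrable rho_C1 OmegaE drho_neq0 Omega_bounded Omega_open sigma_surface) => // c.
  by apply: within_kernel => x; exact: bdry_neq.
- move=> a z Oz; apply: (bdry_tri_integrable rho_C1 OmegaE drho_neq0 Omega_bounded Omega_open sigma_surface
    (P := fun c w => -1 * newton_hess a c (w - z))) => // c x.
  by apply: (@catM _ (subspace _)); [exact: cat_cst|apply: within_hess => y; exact: bdry_neq].
- move=> w wS.
  have K c : C1d Omega (fun z => newton_grad c (w - z)) (fun a z => -1 * newton_hess a c (w - z)).
    have H z : Omega z -> z - w != 0 by move=> Oz; rewrite -oppr_eq0 opprB; exact: bdry_neq.
    apply: (C1d_eq Omega_open _ _ (C1dZ (-1) (newton_grad_shift_C1d c H))) => [z _|a z _].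
      by rewrite -[w - z]opprB newton_gradN mulN1r.
    by rewrite -[w - z]opprB newton_hessN.
  have T := @tri_C1d R k Omega (fun a => partial a rho w) (fun b _ => f w 0 b)
    (fun c z => newton_grad c (w - z)) (fun _ _ _ => 0) (fun a c z => -1 * newton_hess a c (w - z))
    (fun b => C1d_cst _) K.
  apply: (C1d_eq Omega_open _ _ (C1dZ (gradnorm rho w)^-1 T)) => [z _|a z _]; first by rewrite mulrC.
  by rewrite tri0l add0r mulrC.
- move=> z e Oz e0; have [A A0 fA] := row_bound.
  have e'0 : 0 < e / (8 * A) by rewrite divr_gt0 // mulr_gt0.
  pose K := [set w - z | w in bdry Omega].
  have cK : compact K.
    apply: continuous_compact; last exact: bdry_compact.
    apply: continuous_subspaceT => w; apply: continuous_rV => k'.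
    rewrite (_ : (fun t : E4 => _) = fun t => t 0 k' - z 0 k'); last by apply/funext => t; rewrite !mxE.
    by apply: catB; [exact: coord_continuous|exact: cat_cst].
  have /choice[t Ht] (ac : 'I_4 * 'I_4) : exists t, 0 < t /\ forall x h, K x -> `|h| < t ->
      `|newton_hess ac.1 ac.2 (x + h) - newton_hess ac.1 ac.2 x| < e / (8 * A).
    have [|t t0 H] := compact_equicontinuous (g := newton_hess ac.1 ac.2) cK _ e'0; last by exists t.
    by move=> _ [w wS <-]; apply: newton_hess_continuous; exact: bdry_neq.
  exists (\big[Num.min/1]_ac t ac).
    by apply: lt_bigmin => // ac _; have [] := Ht ac.
  move=> a w h wS hlt; rewrite /dG -mulrBl triB.
  rewrite (_ : e = 8 * A * (e / (8 * A))); last by rewrite mulrC divfK // gt_eqF // mulr_gt0.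
  apply: tri_quot_le => // [b|c]; first exact: fA.
  rewrite -mulrBr normrM normrN normr1 mul1r opprD addrA.
  have [_ H] := Ht (a, c); apply/ltW; apply: (H (w - z) (- h)); first by exists w.
  by rewrite normrN; apply: lt_le_trans hlt _; exact: bigmin_le_cond.
Qed.

(** For each [w] the integrand satisfies the equations by [conj4_regular]; being linear with
    constant coefficients, they pass to the integral. *)
Lemma cauchy_regular z c0 : Omega z -> regular_eqs (fun a b =>
  conj4 b (fun l => Rintegral sigma (bdry Omega) (fun w => dG l a w z)) / c0).
Proof.
move=> Oz; set I := fun a l => Rintegral sigma (bdry Omega) (fun w => dG l a w z).
apply: regular_eqsZ; apply/conj4_regularE.
have di l a : sigma.-integrable (bdry Omega) (EFin \o (fun w => dG l a w z)).
  apply: (bdry_tri_integrable rho_C1 OmegaE drho_neq0 Omega_bounded Omega_open sigma_surface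
    (P := fun c w => -1 * newton_hess a c (w - z))) => // c x.
  by apply: (@catM _ (subspace _)); [exact: cat_cst|apply: within_hess => y; exact: bdry_neq].
have pt w : bdry Omega w -> regular_eqs (fun a b => conj4 b (fun l => dG l a w z)).
  move=> wS; rewrite (_ : (fun a b => _) = fun a b => conj4 b (fun l => tri l (f w 0)
    (fun b => partial b rho w) (fun c => -1 * newton_hess a c (w - z))) / gradnorm rho w); last first.
    by apply/funext => a; apply/funext => b; exact: conj4Z.
  apply: regular_eqsZ; apply: conj4_regular => [a c|]; first by rewrite newton_hess_sym.
  by rewrite -mulr_sumr newton_hess_trace ?mulr0 //; exact: bdry_neq.
have L (s : 'I_4 -> R) (l : 'I_4 -> 'I_4) : (forall w, bdry Omega w ->
    \sum_j s j * dG (l j) j w z = 0) -> \sum_j s j * I j (l j) = 0.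
  exact: (Rintegral_linear0 nS (fun j => di (l j) j)).
by split; apply: L => w /pt/conj4_regularE[].
Qed.

Lemma cauchy_psi_regular (c0 : R) (F : E4 -> E4) :
  (forall z k, Omega z -> F z 0 k = conj4 k (fun l => cauchy f l z) / c0) ->
  psi_regular Omega F.
Proof.
move=> FE.
have FC1 k : C1d Omega (fun z => F z 0 k) (fun a z =>
    conj4 k (fun l => Rintegral sigma (bdry Omega) (fun w => dG l a w z)) / c0).
  (* Conjugation acts on component [k] as a sign, so the derivatives of [F] are multiples of those
     of the Cauchy integral. *)
  pose s : R := [:: 1; -1; -1; -1]`_k.
  have cE (q : 'I_4 -> R) : conj4 k q / c0 = s / c0 * q k.
    by rewrite mulrAC /s; congr (_ / _); move: k {s}; apply: ord4P; rewrite /conj4 /= ?mul1r ?mulN1r.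
  apply: (C1d_eq Omega_open _ _ (C1dZ (s / c0) (cauchy_C1d k))) => [z|a z]; rewrite inE => Oz.
    by rewrite FE // cE.
  by rewrite cE.
apply/psi_regularP; split=> [k|z Oz]; first exact: C1d_C1_on Omega_open (FC1 k).
rewrite (_ : (fun a b => _) = fun a b =>
  conj4 b (fun l => Rintegral sigma (bdry Omega) (fun w => dG l a w z)) / c0).
  exact: cauchy_regular.
by apply/funext => a; apply/funext => b; have [_ ->] := FC1 b z Oz.
Qed.
End CauchyIntegral.

(** * Boundary values *)

Section KernelDifference.
Variable R : realType.
Local Notation E4 := 'rV[R]_4.

(** No cancellation is used: each of the two terms is at most $2/b^3$. *)
Lemma newton_grad_diff_near c (x x' : E4) b : 0 < b -> b <= `|x| -> b <= `|x'| ->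
  `|newton_grad c x - newton_grad c x'| <= 4 / b ^+ 3.
Proof.
have H (y : E4) : 0 < b -> b <= `|y| -> `|newton_grad c y| <= 2 / b ^+ 3.
  move=> b0 bx; have y0 : y != 0 by rewrite -normr_gt0; exact: lt_le_trans bx.
  apply: le_trans (newton_grad_le c y0) _; apply: ler_wpM2l => //.
  rewrite lef_pV2 ?posrE ?exprn_gt0 ?normr_gt0 //.
  by rewrite lerXn2r ?nnegrE ?(ltW b0).
move=> b0 bx bx'; apply: le_trans (ler_normB _ _) _.
by have := H x b0 bx; have := H x' b0 bx'; move: (b ^+ 3)^-1 => i; lra.
Qed.

(** The segment from [w - z'] to [w - z] stays at distance at least half of $|w-p|$ from the pole,
    so the mean value theorem gains the factor [t] over the size of the kernel. *)
Lemma newton_grad_diff_far c (w z z' p : E4) t : 0 < t -> `|z - p| <= t -> `|z' - p| <= t ->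
  2 * t <= `|w - p| ->
  `|newton_grad c (w - z) - newton_grad c (w - z')| <= 1280 * t / `|w - p| ^+ 4.
Proof.
move=> t0 zt z't wt.
have wp0 : 0 < `|w - p| by apply: lt_le_trans wt; rewrite mulr_gt0.
have seg (u : R) : 0 <= u <= 1 -> `|w - p| / 2 <= `|w - z' + u *: (z' - z)|.
  move=> /andP[u0 u1].
  have -> : w - z' + u *: (z' - z) = (w - p) - ((1 - u) *: (z' - p) + u *: (z - p)).
    by apply/rowP => k; rewrite !mxE; ring.
  have H : `|(1 - u) *: (z' - p) + u *: (z - p)| <= t.
    apply: le_trans (ler_normD _ _) _; rewrite !normrZ (ger0_norm u0) ger0_norm ?subr_ge0 //.
    rewrite [leRHS](_ : t = (1 - u) * t + u * t); last by ring.
    by apply: lerD; apply: ler_wpM2l => //; rewrite subr_ge0.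
  have H' := lerB_dist (w - p) ((1 - u) *: (z' - p) + u *: (z - p)).
  apply: le_trans H'; lra.
have seg0 (u : R) : 0 <= u <= 1 -> w - z' + u *: (z' - z) != 0.
  by move=> /seg H; rewrite -normr_gt0; apply: lt_le_trans H; rewrite divr_gt0.
have [u u01|u u01] := @mean_value _ _ (newton_grad c) (w - z') (z' - z).
  by have [] := newton_grad_C1d c (seg0 u u01).
rewrite (_ : w - z' + (z' - z) = w - z); last by rewrite addrA subrK.
move=> ->; have [_ pE _] := newton_grad_C1d c (seg0 u u01).
have zz : `|z' - z| <= 2 * t.
  rewrite (_ : z' - z = (z' - p) - (z - p)); last by apply/rowP => k; rewrite !mxE; ring.
  by apply: le_trans (ler_normB _ _) _; lra.
(* 160 is the Hessian constant 10 times $2^4$ for the halved distance; four coordinates and a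
   displacement of at most [2 * t] then give 1280. *)
have hb k : `|partial k (newton_grad c) (w - z' + u *: (z' - z))| <= 160 / `|w - p| ^+ 4.
  rewrite pE; apply: le_trans (newton_hess_le _ _ (seg0 u u01)) _.
  have -> : 160 / `|w - p| ^+ 4 = 10 / (`|w - p| / 2) ^+ 4 by field; rewrite gt_eqF.
  apply: ler_wpM2l => //; rewrite lef_pV2 ?posrE ?exprn_gt0 ?divr_gt0 // ?normr_gt0 ?seg0 //.
  by rewrite lerXn2r ?nnegrE ?divr_ge0 ?(ltW wp0) //; exact: seg.
apply: le_trans (dlin_le _ hb) _.
have -> : 1280 * t / `|w - p| ^+ 4 = 4 * (160 / `|w - p| ^+ 4) * (2 * t).
  by field; rewrite gt_eqF.
by apply: ler_wpM2l => //; rewrite mulr_ge0 // divr_ge0 // exprn_ge0.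
Qed.

Lemma dyadic_interval (t s : R) J : 0 < t -> s <= 2 ^+ J * t ->
  s <= 2 * t \/ exists2 j, (j < J)%N & (2 ^+ j * t < s) /\ (s <= 2 ^+ j.+1 * t).
Proof.
move=> t0; elim: J => [|J IH] sJ.
  have [|st] := leP s (2 * t); [by left|right].
  by exfalso; move: sJ; rewrite expr0 mul1r; have := st; lra.
have [/IH[|[j jJ H]]|st] := leP s (2 ^+ J * t).
- by left.
- by right; exists j => //; exact: leqW.
- by right; exists J.
Qed.
End KernelDifference.

Section BoundaryValues.
Variables (R : realType) (rho : 'rV[R]_4 -> R) (Omega : set 'rV[R]_4).
Local Notation E4 := 'rV[R]_4.
Local Notation E3 := 'rV[R]_3.
Hypothesis rho_C1 : C1_on setT rho.
Hypothesis OmegaE : Omega = [set q | rho q < 0].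
Hypothesis drho_neq0 : forall q, bdry Omega q -> exists v, 'd rho q v != 0.
Hypothesis Omega_bounded : bounded_set Omega.
Hypothesis Omega_open : open Omega.
Variable sigma : {measure set (borel4 R) -> \bar R}.
Hypothesis sigma_surface : is_surface_measure (bdry Omega) sigma.
Local Notation kernel z := (fun c w => newton_grad c (w - z)).
Local Notation cauchy := (fun f k z => surface_tri rho Omega sigma k f (kernel z)).

Section AtPoint.
Variables (x0 : E4) (i : 'I_4) (s c M h r : R) (g : E3 -> R).
Hypothesis ch : chart rho x0 i s c M h r g.
Hypothesis x0S : bdry Omega x0.

Let y0 := prj i x0.
(** One plus the Lipschitz constant of [g]: points within [d] of [x0] have their gap and the
    distance from their foot to [x0] bounded by [L * d]. *)
Let L := 1 + 4 * M / c.
(** A common constant for the estimates of the kernel difference far from the foot (1280) and near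
    it. *)
Variable Q : R.
Hypotheses (Q1 : 1280 <= Q) (Q2 : 4 * (4 * M / c) ^+ 3 <= Q).
Let G := chart_graph x0 i r g.

Let c0 : 0 < c. Proof. exact: (chart_c ch). Qed.
Let M0 : 0 < M. Proof. exact: (chart_M ch). Qed.
Let r0 : 0 < r. Proof. exact: (chart_r ch). Qed.
Let rh : r <= h. Proof. exact: (chart_rh ch). Qed.
Let h0 : 0 < h. Proof. exact: lt_le_trans r0 rh. Qed.
Let L1 : 1 <= L. Proof. by rewrite lerDl divr_ge0 ?mulr_ge0 ?ltW. Qed.
Let Q0 : 0 < Q. Proof. by apply: lt_le_trans Q1; rewrite ltr0n. Qed.

(** The foot lies vertically over or under [z] and is not the nearest boundary point; the reflection
    is vertical as well. The chart makes the gap comparable with the values of [rho], which suffices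
    for the estimates. *)
Let foot (z : E4) : E4 := graph_pt i g (prj i z).
Let mirror (z : E4) : E4 := ptc i (prj i z) (2 * g (prj i z) - z 0 i).
Let gap (z : E4) : R := `|z 0 i - g (prj i z)|.

Let g_y0 : g y0 = x0 0 i.
Proof.
have [_ rx0] := (bdryP rho_C1 OmegaE Omega_open x0).1 x0S.
have H : `|x0 - x0| < r by rewrite subrr normr0.
have := chart_zero rho_C1 ch H rx0; rewrite -/y0 => E.
by have := ptc_i i y0 (g y0); rewrite /ptc => <-; rewrite [in RHS]E !mxE.
Qed.

Lemma near_geometry z d : `|z - x0| <= d -> L * d <= h / 2 -> L * d < r ->
  [/\ `|prj i z - y0| < r, gap z <= L * d, `|foot z - x0| <= L * d &
      [/\ `|z 0 i - x0 0 i| <= h, `|2 * g (prj i z) - z 0 i - x0 0 i| <= h,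
        `|z - x0| <= h & `|mirror z - x0| <= h]].
Proof.
move=> zd Ldh Ldr; have d0 : 0 <= d by apply: le_trans zd.
have dL : d <= L * d by rewrite ler_peMl.
have yz : `|prj i z - y0| <= d by rewrite /y0 -prjB; apply: le_trans (prj_norm_le _ _) zd.
have yr : `|prj i z - y0| < r by apply: le_lt_trans Ldr; apply: le_trans yz dL.
have ti : `|z 0 i - x0 0 i| <= d.
  by have := le_coord_norm (z - x0) i; rewrite !mxE => H; apply: le_trans H zd.
have gg : `|g (prj i z) - x0 0 i| <= 4 * M / c * d.
  have y0r : `|y0 - y0| < r by rewrite subrr normr0.
  have := chart_lip rho_C1 ch y0r yr; rewrite g_y0 => H.
  rewrite -(ler_pM2l c0); apply: le_trans H _.
  rewrite [leRHS](_ : _ = 4 * M * d); last by field; rewrite gt_eqF.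
  by apply: ler_wpM2l => //; rewrite mulr_ge0 // ltW.
have LE : L * d = d + 4 * M / c * d by rewrite /L mulrDl mul1r.
have gL : `|g (prj i z) - x0 0 i| <= L * d by apply: le_trans gg _; rewrite LE lerDr.
have hd : L * d <= h by lra.
have m1 : `|2 * g (prj i z) - z 0 i - x0 0 i| <= h.
  rewrite (_ : _ - x0 0 i = (g (prj i z) - x0 0 i) + (g (prj i z) - x0 0 i) - (z 0 i - x0 0 i)); last by ring.
  apply: le_trans (ler_normB _ _) _; apply: le_trans (lerD (ler_normD _ _) (lexx _)) _.
  by lra.
split => //.
- rewrite /gap (_ : z 0 i - g _ = (z 0 i - x0 0 i) - (g (prj i z) - x0 0 i)); last by ring.
  by apply: le_trans (ler_normB _ _) _; rewrite LE; lra.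
- by apply: ptc_norm_le_prj => //; apply: le_trans yz dL.
- split => //; [lra|lra|].
  by apply: ptc_norm_le_prj => //; lra.
Qed.

Let foot_dist z : `|z - foot z| <= gap z /\ `|mirror z - foot z| <= gap z.
Proof.
split.
  rewrite -[X in X - _](prjK i) /foot -[graph_pt _ _ _]/(ptc _ _ _) ptcB subrr.
  by apply: ptc_norm_le; rewrite /gap ?normr0.
rewrite /mirror /foot -[graph_pt _ _ _]/(ptc _ _ _) ptcB subrr.
apply: ptc_norm_le; rewrite /gap ?normr0 //.
by rewrite (_ : _ - _ = - (z 0 i - g (prj i z))) ?normrN //; ring.
Qed.

Section Reflect.
Variables (z : E4).
Hypothesis Oz : Omega z.
Hypotheses (yr : `|prj i z - y0| < r) (zi : `|z 0 i - x0 0 i| <= h)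
  (mi : `|2 * g (prj i z) - z 0 i - x0 0 i| <= h) (zh : `|z - x0| <= h)
  (mh : `|mirror z - x0| <= h).

Let yh : `|prj i z - y0| <= h. Proof. exact: le_trans (ltW yr) rh. Qed.
Let rz : rho z < 0. Proof. by move: Oz; rewrite OmegaE. Qed.
Let zE : ptc i (prj i z) (z 0 i) = z. Proof. exact: prjK. Qed.
Let rg : rho (ptc i (prj i z) (g (prj i z))) = 0.
Proof. by have [_] := chart_g ch yr. Qed.
Let gh : `|g (prj i z) - x0 0 i| <= h.
Proof. by have [/ltW] := chart_g ch yr. Qed.

Lemma gap_gt0 : 0 < gap z.
Proof.
rewrite /gap normr_gt0 subr_eq0; apply/eqP => E.
by move: rz; rewrite -zE E rg ltxx.
Qed.

(** [rho] is strictly monotone on the vertical line and vanishes at the foot, so it is positive at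
    the reflected point. Of the four cases, two contradict the negativity of [rho] at [z]. *)
Lemma mirror_outside : ~ closure Omega (mirror z).
Proof.
move=> /(rho_closure_le0 rho_C1 OmegaE); apply/negP; rewrite -ltNge.
have ct : 0 < c * gap z by rewrite mulr_gt0 // gap_gt0.
apply: lt_le_trans ct _.
have [s1|s1] := chart_s ch; have [zg|gz] := leP (z 0 i) (g (prj i z)).
- have zg' : g (prj i z) <= 2 * g (prj i z) - z 0 i by lra.
  have := chart_mono rho_C1 ch yh gh mi zg'; rewrite rg subr0 s1 mul1r -/(mirror z).
  by rewrite /gap distrC ger0_norm ?subr_ge0 // (_ : 2 * _ - _ - _ = g (prj i z) - z 0 i) //; ring.
- have := chart_mono rho_C1 ch yh gh zi (ltW gz); rewrite rg subr0 s1 mul1r zE => H.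
  have H0 : 0 < c * (z 0 i - g (prj i z)) by rewrite mulr_gt0 // subr_gt0.
  by exfalso; move: H rz H0; lra.
- have := chart_mono rho_C1 ch yh zi gh zg; rewrite rg sub0r s1 mulN1r opprK zE => H.
  have H0 : 0 <= c * (g (prj i z) - z 0 i) by rewrite mulr_ge0 ?(ltW c0) // subr_ge0.
  by exfalso; move: H rz H0; lra.
- have gz' : 2 * g (prj i z) - z 0 i <= g (prj i z) by lra.
  have := chart_mono rho_C1 ch yh mi gh gz'; rewrite rg sub0r s1 mulN1r opprK -/(mirror z).
  by rewrite /gap ger0_norm ?subr_ge0 ?(ltW gz) // (_ : g _ - (_ - _) = z 0 i - g (prj i z)) //; ring.
Qed.

Let rho_gap p : p = z \/ p = mirror z -> c * gap z <= `|rho p| /\ `|p - x0| <= h.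
Proof.
case=> ->; split => //.
  have := chart_dist rho_C1 ch yh gh zi; rewrite rg subr0 zE => H.
  by apply: le_trans H; rewrite /gap.
have := chart_dist rho_C1 ch yh gh mi; rewrite rg subr0 => H; apply: le_trans H.
rewrite (_ : 2 * _ - _ - _ = - (z 0 i - g (prj i z))); last by ring.
by rewrite normrN.
Qed.

(** At [z] and at its mirror image [rho] has size at least [c * gap z], it vanishes at [w], and
    [4 * M] is a Lipschitz constant. *)
Lemma bdry_gap w p : bdry Omega w -> `|w - x0| <= h -> p = z \/ p = mirror z ->
  c / (4 * M) * gap z <= `|w - p|.
Proof.
move=> wS wh /rho_gap[Hp ph]; have [_ rw] := (bdryP rho_C1 OmegaE Omega_open w).1 wS.
have := lipschitz_ball rho_C1 (chart_d ch) ph wh; rewrite rw sub0r normrN => H.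
have H2 : c * gap z <= 4 * M * `|w - p| by apply: le_trans Hp H.
rewrite mulrAC ler_pdivrMr ?mulr_gt0 //; lra.
Qed.

(** By [bdry_gap] both poles are at least a fixed fraction of the gap away from the boundary. The
    bound holds throughout the chart but is sharp only near the foot. *)
Lemma kernel_near k w : bdry Omega w -> `|w - x0| <= h ->
  `|newton_grad k (w - z) - newton_grad k (w - mirror z)| <= Q / gap z ^+ 3.
Proof.
move=> wS wh; have b0 : 0 < c / (4 * M) * gap z.
  by rewrite mulr_gt0 ?gap_gt0 // divr_gt0 // mulr_gt0.
have H := newton_grad_diff_near k b0 (bdry_gap wS wh (or_introl erefl))
  (bdry_gap wS wh (or_intror erefl)).
apply: le_trans H _; have t0 := gap_gt0.
have -> : 4 / (c / (4 * M) * gap z) ^+ 3 = 4 * (4 * M / c) ^+ 3 / gap z ^+ 3.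
  by field; rewrite !gt_eqF.
by apply: ler_wpM2r; rewrite ?invr_ge0 ?exprn_ge0 ?(ltW t0).
Qed.

Lemma kernel_far k w : 2 * gap z <= `|w - foot z| ->
  `|newton_grad k (w - z) - newton_grad k (w - mirror z)| <= Q * gap z / `|w - foot z| ^+ 4.
Proof.
move=> H; have [f1 f2] := foot_dist z.
apply: le_trans (newton_grad_diff_far k gap_gt0 f1 f2 H) _.
have e0 : 0 <= gap z / `|w - foot z| ^+ 4 by rewrite divr_ge0 ?exprn_ge0 // ltW // gap_gt0.
by rewrite -[leLHS]mulrA -[leRHS]mulrA; apply: ler_wpM2r.
Qed.

Let A (j : nat) : set (borel4 R) := [set x : E4 | (`|x - foot z| <= 2 ^+ j.+1 * gap z)%R] `&` G.
Definition dyadic_bound J (w : borel4 R) : R :=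
  \sum_(j < J) ((gap z ^+ 3)^-1 / 16 ^+ j) * \1_(A j) w.

Let mA j : measurable (A j).
Proof.
apply: measurableI; last exact: (measurable_chart_graph rho_C1 ch).
apply: closed_measurable_borel4.
have := @closed_comp _ _ (fun x : E4 => `|x - foot z|) [set t : R | t <= 2 ^+ j.+1 * gap z].
by apply; [move=> y _; exact: continuous_dist|exact: closed_le].
Qed.

Lemma dyadic_bound_ge0 J w : 0 <= dyadic_bound J w.
Proof.
apply: sumr_ge0 => j _; rewrite mulr_ge0 // ?indicE ?ler0n //.
by rewrite divr_ge0 ?exprn_ge0 // invr_ge0 exprn_ge0 // ltW // gap_gt0.
Qed.

Lemma kernel_dyadic J k w : G w -> bdry Omega w -> `|w - x0| <= h ->
  `|w - foot z| <= 2 ^+ J * gap z -> (0 < J)%N ->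
  `|newton_grad k (w - z) - newton_grad k (w - mirror z)| <= Q * dyadic_bound J w.
Proof.
move=> Gw wS wh wJ J0; have t0 := gap_gt0.
have term (j : 'I_J) : A j w -> (gap z ^+ 3)^-1 / 16 ^+ j <= dyadic_bound J w.
  move=> Aw; rewrite /dyadic_bound (bigD1 j) //= indicE mem_set //= mulr1 lerDl.
  apply: sumr_ge0 => l _; rewrite mulr_ge0 // ?indicE ?ler0n //.
  by rewrite divr_ge0 ?exprn_ge0 // invr_ge0 exprn_ge0 // ltW.
have [ws|[j jJ [w1 w2]]] := dyadic_interval t0 wJ.
  apply: le_trans (kernel_near k wS wh) _; apply: ler_wpM2l; first exact: ltW.
  by have := term (Ordinal J0); rewrite expr0 divr1; apply; split.
(* Shells are bounded below by $2^j$ gaps only, whereas the far estimate starts at two gaps; what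
   lies in between is served by the near estimate and the weight of index 0. *)
have [w2t|w2t] := leP (2 * gap z) `|w - foot z|; last first.
  apply: le_trans (kernel_near k wS wh) _; apply: ler_wpM2l; first exact: ltW.
  have := term (Ordinal J0); rewrite expr0 divr1; apply; split => //=; exact: ltW.
apply: le_trans (kernel_far k w2t) _; rewrite -mulrA; apply: ler_wpM2l; first exact: ltW.
apply: le_trans (term (Ordinal jJ) _); last by split.
have j0 : 0 < 2 ^+ j * gap z by rewrite mulr_gt0 // exprn_gt0.
apply: (@le_trans _ _ (gap z / (2 ^+ j * gap z) ^+ 4)).
  apply: ler_wpM2l; first exact: ltW.
  rewrite lef_pV2 ?posrE ?exprn_gt0 //; last by apply: lt_trans w1.
  by rewrite lerXn2r ?nnegrE ?(ltW j0) // ltW.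
have -> : 16 = 2 ^+ 4 :> R by ring.
rewrite -exprM mulnC exprM le_eqVlt; apply/orP; left; apply/eqP.
by move: (2 ^+ j) (exprn_gt0 j (ltr0n R 2)) => a a0; field; rewrite !gt_eqF //= a0.
Qed.

(** By [chart_growth] the shell of index [j] has measure at most [2 * M / c] times $64 \cdot 8^j$
    cubed gaps; the weight leaves $128 (M/c) 2^{-j}$. The gap cancels, so the bound depends neither
    on [z] nor on [J]. *)
Lemma dyadic_bound_integral J : sigma.-integrable (bdry Omega) (EFin \o dyadic_bound J) /\
  Rintegral sigma (bdry Omega) (dyadic_bound J) <= 256 * M / c.
Proof.
have t0 := gap_gt0.
have mS := measurable_bdry Omega.
have S_lty := bdry_lty rho_C1 OmegaE Omega_open Omega_bounded sigma_surface drho_neq0.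
have growth j : fine (sigma (A j `&` bdry Omega)) <= 2 * M / c * (2 ^+ j.+2 * gap z) ^+ 3.
  have tj : 0 < 2 ^+ j.+1 * gap z by rewrite mulr_gt0 // exprn_gt0.
  have := chart_growth rho_C1 OmegaE Omega_open sigma_surface ch (foot z) tj.
  rewrite -/G -/(A j) (_ : _ + _ = 2 ^+ j.+2 * gap z); last by rewrite [in RHS]exprS; ring.
  move=> H; have H2 : (sigma (A j `&` bdry Omega) <= sigma (A j))%E.
    by apply: le_measure; [exact/mem_set/measurableI|exact/mem_set|exact: subIsetl].
  have H3 := le_trans H2 H; rewrite -lee_fin fineK // ge0_fin_numE //.
  by apply: le_lt_trans H3 _; rewrite ltry.
have fin j : (sigma (A j `&` bdry Omega) < +oo)%E.
  by apply: le_lt_trans S_lty; apply: le_measure; [exact/mem_set/measurableI|exact/mem_set|exact: subIsetr].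
have i0 j : sigma.-integrable (bdry Omega) (EFin \o (\1_(A j) : borel4 R -> R)).
  apply: (bounded_integrable mS S_lty (C := 1)); first exact: measurable_indic.
  by move=> w _; rewrite indicE; case: (_ \in _); rewrite ?normr1 ?normr0.
have ii (j : 'I_J) : sigma.-integrable (bdry Omega) (EFin \o
    (fun w => ((gap z ^+ 3)^-1 / 16 ^+ j) * \1_(A j) w)).
  by have := integrableZl mS ((gap z ^+ 3)^-1 / 16 ^+ j) (i0 j).
have [i1 i2] := Rintegral_sum_fun (index_enum 'I_J) mS ii; split; first exact: i1.
rewrite [leLHS]i2.
have tm (j : 'I_J) : Rintegral sigma (bdry Omega) (fun w => ((gap z ^+ 3)^-1 / 16 ^+ j) * \1_(A j) w)
    <= 128 * M / c * (2^-1) ^+ j.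
  have E := RintegralZl ((gap z ^+ 3)^-1 / 16 ^+ j) mS (i0 j); rewrite [leLHS]E.
  have E2 : Rintegral sigma (bdry Omega) (\1_(A j) : borel4 R -> R) = fine (sigma (A j `&` bdry Omega)).
    by rewrite /Rintegral integral_indic.
  rewrite E2; have c16 : 0 <= (gap z ^+ 3)^-1 / 16 ^+ j.
    by rewrite divr_ge0 ?exprn_ge0 // invr_ge0 exprn_ge0 // ltW.
  apply: le_trans (ler_wpM2l c16 (growth j)) _.
  rewrite le_eqVlt; apply/orP; left; apply/eqP.
  have -> : 16 = 2 ^+ 4 :> R by ring.
  rewrite -exprM mulnC exprM exprVn !exprS.
  by move: (2 ^+ j) (exprn_gt0 j (ltr0n R 2)) => a a0; field; rewrite !gt_eqF //= a0.
apply: le_trans (ler_sum _ (fun j _ => tm j)) _; rewrite -mulr_sumr.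
have geo : \sum_(j < J) (2^-1 : R) ^+ j <= 2.
  have -> : \sum_(j < J) (2^-1 : R) ^+ j = 2 - 2 * 2^-1 ^+ J.
    elim: J {ii i1 i2 tm} => [|n IH]; first by rewrite big_ord0 expr0; ring.
    by rewrite big_ord_recr /= IH exprS; field.
  by rewrite lerBlDr lerDl mulr_ge0 // exprn_ge0.
have -> : 256 * M / c = 128 * M / c * 2 by ring.
by apply: ler_wpM2l geo; rewrite divr_ge0 ?mulr_ge0 // ltW.
Qed.
End Reflect.

Variable f : E4 -> E4.
Hypothesis f_cont : forall b, {within bdry Omega, continuous (fun x => f x 0 b)}.
Hypothesis f_ortho : forall phi, Harm1 Omega phi -> qintegral sigma (bdry Omega)
  (fun q => qmul (qconj (f q)) (dbar_n_sub_jL Omega rho phi q)) = 0.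

Let jump l z z' (w : borel4 R) : R := tri l (fun b => f w 0 b - f x0 0 b) (fun a => partial a rho w)
  (fun c => newton_grad c (w - z) - newton_grad c (w - z')) / gradnorm rho w.

(* Outside the closure both Cauchy integrals vanish, so the value at the reflected point
   can be subtracted for free. *)
Lemma jump_integral l z z' : Omega z -> ~ closure Omega z' ->
  sigma.-integrable (bdry Omega) (EFin \o jump l z z') /\
  cauchy f l z - cauchy (fun=> f x0) l z = Rintegral sigma (bdry Omega) (jump l z z').
Proof.
move=> Oz nz'.
have mS := measurable_bdry Omega.
have nz y : bdry Omega y -> y - z != 0 by move=> yS; exact: (bdry_neq rho_C1 OmegaE Omega_open Oz).
have nz'' y : bdry Omega y -> y - z' != 0 by move=> [yC _]; exact: closure_neq nz' yC.
have I (u : E4 -> E4) p : (forall b, {within bdry Omega, continuous (fun x => u x 0 b)}) ->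
    (forall y, bdry Omega y -> y - p != 0) ->
    sigma.-integrable (bdry Omega) (EFin \o (fun w => tri l (u w 0) (fun a => partial a rho w)
      (kernel p ^~ w) / gradnorm rho w : R)).
  move=> cu np; apply: (bdry_tri_integrable rho_C1 OmegaE drho_neq0 Omega_bounded Omega_open sigma_surface) => // c'.
  exact: within_kernel.
have cc b : {within bdry Omega, continuous (fun=> f x0 0 b)} by move=> y; exact: cat_cst.
have i1 := I f z f_cont nz; have i2 := I (fun=> f x0) z cc nz.
have i3 := I f z' f_cont nz''; have i4 := I (fun=> f x0) z' cc nz''.
have i5 := integrableB mS i1 i2; have i6 := integrableB mS i3 i4.
have i7 := integrableB mS i5 i6.
have E w : tri l (f w 0) (fun a => partial a rho w) (kernel z ^~ w) / gradnorm rho w -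
    tri l (f x0 0) (fun a => partial a rho w) (kernel z ^~ w) / gradnorm rho w -
    (tri l (f w 0) (fun a => partial a rho w) (kernel z' ^~ w) / gradnorm rho w -
    tri l (f x0 0) (fun a => partial a rho w) (kernel z' ^~ w) / gradnorm rho w) = jump l z z' w.
  by rewrite /jump -triBB !mulrBl.
split.
  rewrite (_ : EFin \o jump l z z' = (fun w => ((tri l (f w 0) (fun a => partial a rho w) (kernel z ^~ w) / gradnorm rho w)%:E -
    (tri l (f x0 0) (fun a => partial a rho w) (kernel z ^~ w) / gradnorm rho w)%:E -
    ((tri l (f w 0) (fun a => partial a rho w) (kernel z' ^~ w) / gradnorm rho w)%:E -
    (tri l (f x0 0) (fun a => partial a rho w) (kernel z' ^~ w) / gradnorm rho w)%:E))%E)) //.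
  by apply/funext => w; rewrite /= -E.
transitivity (cauchy f l z - cauchy (fun=> f x0) l z - (cauchy f l z' - cauchy (fun=> f x0) l z')).
  rewrite (cauchy_outside rho_C1 OmegaE drho_neq0 Omega_bounded Omega_open sigma_surface f_cont l f_ortho nz').
  rewrite (flux_outside rho_C1 OmegaE drho_neq0 Omega_bounded Omega_open sigma_surface l (f x0) nz').
  by rewrite !subr0.
rewrite /surface_tri -RintegralB // -RintegralB // -RintegralB //.
by apply: eq_Rintegral => w _; exact: E.
Qed.

(** Close to [x0] the oscillation of [f] is small and the dyadic bound has bounded integral; away
    from [x0] the oscillation is only bounded, but the kernel difference is of the order of the gap,
    which tends to 0. *)
Lemma cauchy_boundary e : 0 < e -> exists2 d, 0 < d & forall z l, Omega z -> `|z - x0| < d ->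
  `|cauchy f l z - cauchy (fun=> f x0) l z| <= e.
Proof.
move=> e0.
have mS := measurable_bdry Omega.
have S_lty := bdry_lty rho_C1 OmegaE Omega_open Omega_bounded sigma_surface drho_neq0.
have [Af Af0 fA] := row_bound Omega_bounded f_cont.
pose m := fine (sigma (bdry Omega)).
have m0 : 0 <= m by exact: fine_ge0.
(* Product of the constants of [tri_quot_le], of the kernel estimates and of
   [dyadic_bound_integral]; an oscillation of at most [E1] then contributes at most [e / 2]. *)
pose B := 8 * Q * (256 * M / c).
have B0 : 0 < B by rewrite !mulr_gt0 ?invr_gt0.
pose E1 := e / 2 / B.
have E10 : 0 < E1 by rewrite divr_gt0 // divr_gt0.
pose u (w : E4) := \sum_b `|f w 0 b - f x0 0 b|.
have cu : {within bdry Omega, continuous u}.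
  move=> w; apply: (@cat_sum _ (subspace _)) => b; apply: (@cat_norm _ (subspace _)).
  by apply: (@catB _ (subspace _)); [exact: f_cont|exact: cat_cst].
have u0 : u x0 = 0 by rewrite /u big1 // => b _; rewrite subrr normr0.
have /within_epsP/(_ x0 x0S E1 E10)[d1 d10 hd1] := cu.
pose dl := Num.min d1 r.
have dl0 : 0 < dl by rewrite lt_min d10.
have dlr : dl <= r by rewrite ge_min lexx orbT.
have [v vE v0] : exists2 v, v = (2 / dl) ^+ 4 & 0 <= v.
  by exists ((2 / dl) ^+ 4) => //; rewrite exprn_ge0 // divr_ge0 // ltW.
(* Bound, per unit of gap, for the part away from [x0]: there [f] oscillates by at most [2 * Af] and
   [v] bounds the inverse fourth power of the distance to the foot. *)
pose K2 := 8 * (2 * Af) * (Q * v) * m.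
have K20 : 0 <= K2 by rewrite !mulr_ge0 ?(ltW Af0) ?(ltW Q0).
(* The first two bounds keep the construction inside the chart. The third separates the foot from
   the points [w] away from [x0], where it also makes the far estimate available. The last bounds
   their contribution by [e / 2]. *)
pose D := Num.min (Num.min (h / 2) (r / 2)) (Num.min (dl / 4) (e / 2 / (K2 + 1))).
have K21 : 0 < K2 + 1 by lra.
have D0 : 0 < D by rewrite !lt_min !divr_gt0.
have [D1 D2 D3 D4] : [/\ D <= h / 2, D <= r / 2, D <= dl / 4 & D <= e / 2 / (K2 + 1)].
  by split; rewrite !ge_min lexx ?orbT.
have L0 : 0 < L by apply: lt_le_trans L1.
exists (D / L); first by rewrite divr_gt0.
move=> z l Oz /ltW zd.
have LD : L * (D / L) = D by rewrite mulrC divfK // gt_eqF.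
have [|| yr gD fD [zi mi zh mh]] := near_geometry zd; rewrite ?LD //; first by lra.
rewrite LD in gD fD.
have t0 := gap_gt0 Oz yr.
have nz' := mirror_outside Oz yr zi mi.
have [ji ->] := jump_integral l Oz nz'.
(* So many shells that they reach every point of the boundary within [dl] of [x0]. *)
have [J J0 HJ] : exists2 J, (0 < J)%N & 2 * h <= 2 ^+ J * gap z.
  exists (Num.bound (2 * h / gap z)).+1 => //.
  rewrite -ler_pdivrMr //; apply: le_trans (ltW (archi_boundP _)) _.
    by rewrite divr_ge0 ?mulr_ge0 // ltW.
  rewrite -natrX ler_nat; apply: leq_trans (ltnW (ltn_expl _ (ltnSn 1))) _.
  by rewrite leq_exp2l.
have [pi pI] := dyadic_bound_integral Oz yr J.
set Psi := dyadic_bound z J in pi pI.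
have bnd w : bdry Omega w -> `|jump l z (mirror z) w| <=
    8 * E1 * Q * Psi w + 8 * (2 * Af) * (Q * gap z * v).
  move=> wS; have [wd|wd] := ltP `|w - x0| dl.
    have wr : `|w - x0| < r by apply: lt_le_trans dlr.
    have wh : `|w - x0| <= h by apply: le_trans (ltW wr) rh.
    have wG : G w.
      apply: (ball_bdry_chart_graph rho_C1 OmegaE Omega_open ch); split => //.
      by rewrite -ball_normE /ball_ /= distrC.
    have wf : `|w - foot z| <= 2 ^+ J * gap z.
      apply: le_trans HJ; rewrite (_ : w - foot z = (w - x0) - (foot z - x0)); last first.
        by rewrite opprB addrA subrK.
      by apply: le_trans (ler_normB _ _) _; lra.
    have ub b : `|f w 0 b - f x0 0 b| <= E1.
      have wd1 : `|w - x0| < d1 by apply: lt_le_trans wd _; rewrite ge_min lexx.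
      have := hd1 w wS wd1; rewrite u0 subr0 => /ltW H; apply: le_trans H.
      apply: le_trans (ler_norm _).
      by rewrite /u (bigD1 b) //= lerDl sumr_ge0.
    have kb k := kernel_dyadic Oz yr zi mi zh mh k wG wS wh wf J0.
    apply: le_trans (tri_quot_le rho_C1 OmegaE drho_neq0 Omega_open l wS ub kb) _.
    have -> : 8 * E1 * (Q * dyadic_bound z J w) = 8 * E1 * Q * Psi w by rewrite /Psi mulrA.
    rewrite lerDl mulr_ge0 //; first by rewrite !mulr_ge0 ?(ltW Af0).
    by rewrite !mulr_ge0 ?(ltW Q0) ?(ltW t0).
  have ub b : `|f w 0 b - f x0 0 b| <= 2 * Af.
    by apply: le_trans (ler_normB _ _) _; have := fA w b wS; have := fA x0 b x0S; lra.
  have wf : dl / 2 <= `|w - foot z|.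
    rewrite (_ : w - foot z = (w - x0) - (foot z - x0)); last by rewrite opprB addrA subrK.
    by apply: le_trans (lerB_dist _ _); lra.
  have wf2 : 2 * gap z <= `|w - foot z| by apply: le_trans wf; lra.
  have kb k : `|newton_grad k (w - z) - newton_grad k (w - mirror z)| <= Q * gap z * v.
    apply: le_trans (kernel_far Oz yr k wf2) _.
    apply: ler_wpM2l; first by rewrite mulr_ge0 ?(ltW Q0) ?(ltW t0).
    have -> : v = ((dl / 2) ^+ 4)^-1 by rewrite vE -exprVn invf_div.
    have dl2 : 0 < dl / 2 by rewrite divr_gt0.
    rewrite lef_pV2 ?posrE ?exprn_gt0 // ?(lt_le_trans dl2) //.
    by rewrite lerXn2r ?nnegrE ?(ltW dl2).
  apply: le_trans (tri_quot_le rho_C1 OmegaE drho_neq0 Omega_open l wS ub kb) _.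
  rewrite lerDr mulr_ge0 //; first exact: (mulr_ge0 (mulr_ge0 (ler0n _ 8) (ltW E10)) (ltW Q0)).
  exact: (dyadic_bound_ge0 Oz yr).
have bi : sigma.-integrable (bdry Omega) (EFin \o (fun w => 8 * E1 * Q * Psi w)).
  by have := integrableZl mS (8 * E1 * Q) pi.
have ci : sigma.-integrable (bdry Omega) (EFin \o (fun=> 8 * (2 * Af) * (Q * gap z * v) : R)).
  by apply: (bounded_integrable (C := `|8 * (2 * Af) * (Q * gap z * v)|) mS S_lty (measurable_cst _)).
have N1 := le_normr_Rintegral mS ji; apply: le_trans N1 _.
apply: (@le_trans _ _ (Rintegral sigma (bdry Omega) (fun w =>
    8 * E1 * Q * Psi w + 8 * (2 * Af) * (Q * gap z * v)))).
  apply: le_Rintegral => //; first exact: integrable_norm.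
  by have := integrableD mS bi ci.
rewrite RintegralD // Rintegral_cst // -/m.
have Z := RintegralZl (8 * E1 * Q) mS pi; rewrite Z.
have P1 : 8 * E1 * Q * Rintegral sigma (bdry Omega) Psi <= e / 2.
  have X : 0 <= 8 * E1 * Q by exact: (mulr_ge0 (mulr_ge0 (ler0n _ 8) (ltW E10)) (ltW Q0)).
  apply: le_trans (ler_wpM2l X pI) _.
  rewrite (_ : 8 * E1 * Q * (256 * M / c) = E1 * B); last by rewrite /B; ring.
  by rewrite /E1 divfK // gt_eqF.
have P2 : 8 * (2 * Af) * (Q * gap z * v) * m <= e / 2.
  rewrite (_ : _ * m = K2 * gap z); last by rewrite /K2; ring.
  apply: (@le_trans _ _ ((K2 + 1) * D)).
    by apply: ler_pM => //; [exact: ltW|lra].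
  by rewrite mulrC -ler_pdivlMr.
lra.
Qed.
End AtPoint.

Lemma cauchy_boundary_value (f : E4 -> E4) x e :
  (forall b, {within bdry Omega, continuous (fun x => f x 0 b)}) ->
  (forall phi, Harm1 Omega phi -> qintegral sigma (bdry Omega)
    (fun q => qmul (qconj (f q)) (dbar_n_sub_jL Omega rho phi q)) = 0) ->
  bdry Omega x -> 0 < e -> exists2 d, 0 < d & forall z l, Omega z -> `|z - x| < d ->
  `|cauchy f l z - cauchy (fun=> f x) l z| <= e.
Proof.
move=> cf fo xS e0.
have [i [s [c [M [h [r [g ch]]]]]]] := bdry_chart rho_C1 OmegaE Omega_open drho_neq0 xS.
apply: (cauchy_boundary ch xS (Q := Num.max 1280 (4 * (4 * M / c) ^+ 3)) _ _ cf fo e0).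
- by rewrite le_max lexx.
- by rewrite le_max lexx orbT.
Qed.

(** By [flux_const] the Cauchy integral of the constant [f x] is the conjugate of [f x] times [k0],
    so [cauchy_boundary_value] says that [F] tends to [f x] from inside; along the boundary,
    continuity is that of [f]. *)
Theorem regular_extension (f : E4 -> E4) : Omega !=set0 ->
  {within bdry Omega, continuous f} ->
  (forall phi, Harm1 Omega phi -> qintegral sigma (bdry Omega)
    (fun q => qmul (qconj (f q)) (dbar_n_sub_jL Omega rho phi q)) = 0) ->
  exists F : E4 -> E4, [/\ psi_regular Omega F, {within closure Omega, continuous F} &
    forall q, bdry Omega q -> F q = f q].
Proof.
move=> On0 cf fo.
have cf' b : {within bdry Omega, continuous (fun x => f x 0 b)}.
  move=> x; apply: (@cat_comp (subspace _) x _ _ f (fun y => y 0 b)); first exact: cf.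
  exact: coord_continuous.
have [k0 k00 flux] := flux_const rho_C1 OmegaE drho_neq0 Omega_bounded Omega_open sigma_surface On0.
have k0n : k0 != 0 by rewrite lt_eqF.
pose E (z : E4) : E4 := \row_k (conj4 k (fun l => cauchy f l z) / k0).
pose F z := if pselect (Omega z) is left _ then E z else f z.
have FO z : Omega z -> F z = E z by rewrite /F; case: pselect.
have FS z : bdry Omega z -> F z = f z.
  by rewrite (bdryE Omega_open) => -[_ nO]; rewrite /F; case: pselect.
have Freg : psi_regular Omega F.
  apply: (cauchy_psi_regular rho_C1 OmegaE drho_neq0 Omega_bounded Omega_open sigma_surface cf'
    (c0 := k0)).
  by move=> z k Oz; rewrite FO // mxE.
exists F; split => // x.
apply: (@continuous_rV R (subspace (closure Omega)) 4 F x) => k; move: x.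
apply/within_epsP => x xC e e0.
have [Ox|xS] := closure_cases Omega_open xC.
  have [FC1 _] := Freg; have [dF _] := FC1 k x Ox.
  have /continuous_at_eps/(_ e e0)[d d0 hd] := differentiable_continuous dF.
  exists d => // x' _ xx'; have := hd (x' - x) xx'; by rewrite subrKC.
have e20 : 0 < e / 2 by rewrite divr_gt0.
(* The tolerance is scaled by [k0] because [F] divides the Cauchy integral by it. *)
have ek0 : 0 < e / 2 * `|k0| by rewrite mulr_gt0 // normr_gt0.
have [d d0 hd] := cauchy_boundary_value cf' fo xS ek0.
have /within_epsP/(_ x xS e e0)[d' d'0 hd'] := cf' k.
exists (Num.min d d'); first by rewrite lt_min d0.
move=> y yC; rewrite lt_min => /andP[yd yd'].
have [Oy|yS] := closure_cases Omega_open yC; last by rewrite !FS //; exact: hd'.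
rewrite FO // FS // mxE.
have fl l : cauchy (fun=> f x) l y = conj4 l (f x 0) * k0 by exact: flux.
have H : `|conj4 k (fun l => cauchy f l y) - f x 0 k * k0| <= e / 2 * `|k0|.
  have := hd y k Oy yd; rewrite fl.
  (* In the last three components conjugation changes the sign of both terms, which the absolute
     value ignores. *)
  have N (a b : R) : `|a - (- b) * k0| = `|- a - b * k0|.
    by rewrite -normrN; congr (`|_|); ring.
  by move: k {hd'}; apply: ord4P; rewrite /conj4 //= N.
rewrite (_ : _ / k0 - _ = (conj4 k (fun l => cauchy f l y) - f x 0 k * k0) / k0); last first.
  by rewrite mulrBl mulfK.
rewrite normrM normfV ltr_pdivrMr ?normr_gt0 //; apply: le_lt_trans H _.
by rewrite ltr_pM2r ?normr_gt0 // ltr_pdivrMr // ltr_pMr // ltr1n.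
Qed.
End BoundaryValues.

Theorem theorem4 (R : realType)
  (rho : 'rV[R]_4 -> R) (Omega : set 'rV[R]_4)
  (rho_C1 : C1_on setT rho)
  (OmegaE : Omega = [set q | rho q < 0])
  (drho_neq0 : forall q, bdry Omega q -> exists v, 'd rho q v != 0)
  (Omega_bounded : bounded_set Omega)
  (Omega_open : open Omega)
  (Omega_connected : connected Omega)
  (Omega_nonempty : Omega !=set0)
  (sigma : {measure set (borel4 R) -> \bar R})
  (sigma_surface : is_surface_measure (bdry Omega) sigma)
  (f : 'rV[R]_4 -> 'rV[R]_4)
  (f_continuous : {within bdry Omega, continuous f}) :
  (exists F : 'rV[R]_4 -> 'rV[R]_4,
     [/\ psi_regular Omega F,
         {within closure Omega, continuous F} &
         forall q, bdry Omega q -> F q = f q])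
  <->
  (forall phi : 'rV[R]_4 -> R[i], Harm1 Omega phi ->
     qintegral sigma (bdry Omega)
       (fun q => qmul (qconj (f q)) (dbar_n_sub_jL Omega rho phi q)) = 0).
Proof.
split=> [[F [Freg cF Ff]] phi hphi|fo].
  exact: (boundary_orthogonality rho_C1 OmegaE drho_neq0 Omega_bounded Omega_open
    sigma_surface Freg cF Ff f_continuous hphi).
exact: (regular_extension rho_C1 OmegaE drho_neq0 Omega_bounded Omega_open
  sigma_surface Omega_nonempty f_continuous fo).
Qed.
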